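(* Let $(S_t)_{t\ge0}$ be the semigroup of the voter model on $\Omega=\{0,1\}^{\mathbb{Z}^d}$ with translation-invariant kernel $p(x,y)=p(0,y-x)\ge0$, $\sum_yp(x,y)=1$, $\sum_y(y-x)^2p(x,y)<\infty$. Let $Z_t$ be the symmetric continuous-time random walk on $\mathbb{Z}^d$ started at $0$ that makes a jump by $a$ at rate $p(0,a)+p(0,-a)$. Then for any probability measure $\mu$ on $\Omega$ satisfying GEMB($c$), for all $t\ge0$, all $p\ge1$ and all bounded measurable $f:\Omega\to\mathbb{R}$, $$\|S_tf-\mathbb{E}_\mu(S_tf)\|_{L^p(\mu)}\leq2\sqrt c\,\Big(p\,\Gamma\big(\tfrac p2\big)\Big)^{1/p}\sqrt{\mathbb{P}(Z_t=0)}\;\|\delta f\|_1.$$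
   Context: $\Omega=\{0,1\}^{\mathbb{Z}^d}$ with product topology and Borel $\sigma$-field; $\eta^x$ is $\eta$ flipped at $x$. For $f:\Omega\to\mathbb{R}$, $\delta_if=\sup_\eta(f(\eta^i)-f(\eta))$ and $\|\delta f\|_p=(\sum_{i\in\mathbb{Z}^d}(\delta_if)^p)^{1/p}$ (possibly $+\infty$, in which case the bound is vacuous). GEMB($c$): a probability measure $\mu$ on $\Omega$ satisfies GEMB($c$), $c>0$, if $\mathbb{E}_\mu(e^{f-\mathbb{E}_\mu f})\leq e^{c\|\delta f\|_2^2}$ for all bounded measurable $f:\Omega\to\mathbb{R}$. Voter model: the spin-flip process with generator $Lf(\eta)=\sum_xc(x,\eta)(f(\eta^x)-f(\eta))$ on functions depending on finitely many sites, with rates $c(x,\eta)=\sum_yp(x,y)\eta(y)$ if $\eta(x)=0$ and $c(x,\eta)=\sum_yp(x,y)(1-\eta(y))$ if $\eta(x)=1$. $S_tf(\eta)=\mathbb{E}_\eta f(\eta_t)$. $\Gamma$ is Euler's Gamma function. (The letter $p$ without arguments is the integrability exponent.) *)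

(* Defs.v *)
From HB Require Import structures.
From mathcomp Require Import all_boot all_order all_algebra.
From mathcomp Require Import all_classical all_reals all_analysis.
From mathcomp Require Import measurable_realfun.
Set Implicit Arguments.
Unset Strict Implicit.
Unset Printing Implicit Defensive.
Import Order.TTheory GRing.Theory Num.Theory.
Import numFieldNormedType.Exports.
Local Open Scope classical_set_scope.
Local Open Scope ring_scope.

Notation Zd d := 'rV[int]_d.

(* {0,1}^(Z^d) with the product of the discrete topologies and its Borel
   sigma-algebra; true stands for 1. *)
Definition Omega (d : nat) : Type := prod_topology (fun _ : Zd d => bool).

HB.instance Definition _ d := Pointed.on (Omega d).
HB.instance Definition _ d := Topological.on (Omega d).
HB.instance Definition _ d :=
  @isMeasurable.Build (sigma_display (@open (Omega d))) (Omega d)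
    <<s (@open (Omega d)) >> (@sigma_algebra0 _ setT _) (@sigma_algebraC _ _)
    (@sigma_algebra_bigcup _ setT _).

Definition flip d (eta : Omega d) (x : Zd d) : Omega d :=
  fun y => if y == x then ~~ eta y else eta y.

Section variations.
Context (R : realType) (d : nat).
Implicit Types (f : Omega d -> R) (mu : probability (Omega d) R).

Definition delta f (i : Zd d) : \bar R :=
  ereal_sup [set (f (flip eta i) - f eta)%:E | eta in [set: Omega d]].

Definition delta_norm (p : R) f : \bar R :=
  ((\esum_(i in [set: Zd d]) delta f i `^ p) `^ p^-1)%E.

Definition GEMB (c : R) mu : Prop :=
  0 < c /\
  forall f, measurable_fun [set: Omega d] f -> bounded_fun f ->
    ('E_mu[(fun eta => expR (f eta - fine 'E_mu[f]))]
       <= expeR (c%:E * delta_norm 2 f ^+ 2))%E.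

End variations.

Definition Gamma (R : realType) (a : R) : R :=
  \int[lebesgue_measure]_(x in `]0, +oo[) (x `^ (a - 1) * expR (- x)).

Section spin_flip_process.
Context (R : realType) (d : nat).

Definition cylinder (f : Omega d -> R) : Prop :=
  exists A : set (Zd d), finite_set A /\
    forall eta xi : Omega d, {in A, eta =1 xi} -> f eta = f xi.

(* For a cylinder f only finitely many terms are nonzero, so the finitely
   supported sum below is the full sum over Z^d. *)
Definition spin_flip_generator (c : Zd d -> Omega d -> R) (f : Omega d -> R)
    (eta : Omega d) : R :=
  \sum_(x \in [set: Zd d]) c x eta * (f (flip eta x) - f eta).

(* Pr eta is the law of the process started from eta, X t the configuration
   at time t; only times t >= 0 matter. *)
Context {dT : measure_display} {T : measurableType dT}.
Implicit Types (Pr : Omega d -> probability T R) (X : R -> T -> Omega d).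

Definition semigroup Pr X (t : R) (f : Omega d -> R) (eta : Omega d) : R :=
  fine 'E_(Pr eta)[f \o X t].

Definition past X (s : R) : set (set T) :=
  <<s [set A | exists r B,
         [/\ 0 <= r <= s, measurable B & A = X r @^-1` B] ]>>.

Record is_spin_flip_process (c : Zd d -> Omega d -> R) Pr X : Prop := {
  sfp_measurable_state :
    forall t : R, 0 <= t -> measurable_fun [set: T] (X t) ;
  sfp_measurable_law :
    forall A : set T, measurable A ->
      measurable_fun [set: Omega d] (fun eta => Pr eta A) ;
  sfp_right_continuous :
    forall w (t : R), 0 <= t -> X s w @[s --> t^'+] --> X t w ;
  sfp_left_limits :
    forall w (t : R), 0 < t -> exists eta : Omega d, X s w @[s --> t^'-] --> eta ;
  sfp_start : forall eta, Pr eta [set w | X 0 w = eta] = 1%E ;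
  sfp_markov : forall eta (s t : R) A B, 0 <= s -> 0 <= t ->
    past X s A -> measurable B ->
    (Pr eta (A `&` X (s + t)%R @^-1` B)
       = \int[Pr eta]_(w in A) Pr (X s w) (X t @^-1` B))%E ;
  sfp_feller : forall (t : R) (f : Omega d -> R), 0 <= t ->
    continuous f -> continuous (semigroup Pr X t f) ;
  (* the generator, a limit in the supremum norm, extends L on cylinder
     functions *)
  sfp_generator : forall f, cylinder f -> forall e : R, 0 < e ->
    \forall h \near 0^'+, forall eta,
      `|(semigroup Pr X h f eta - f eta) / h - spin_flip_generator c f eta|
        <= e
}.

End spin_flip_process.

Section voter_model.
Context (R : realType) (d : nat).

Record voter_kernel (p : Zd d -> Zd d -> R) : Prop := {
  vk_ge0 : forall x y, 0 <= p x y ;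
  vk_translation : forall x y, p x y = p 0 (y - x) ;
  vk_sum1 : forall x, (\esum_(y in [set: Zd d]) (p x y)%:E = 1)%E ;
  vk_second_moment : forall x,
    (\esum_(y in [set: Zd d])
       ((\sum_(i < d) ((y - x) 0 i ^+ 2)%:~R) * p x y)%:E < +oo)%E
}.

Definition voter_rate (p : Zd d -> Zd d -> R) (x : Zd d) (eta : Omega d) : R :=
  if eta x
  then fine (\esum_(y in [set: Zd d]) (p x y * (1 - (eta y)%:R))%:E)%E
  else fine (\esum_(y in [set: Zd d]) (p x y * (eta y)%:R)%:E)%E.

Definition is_voter_model (p : Zd d -> Zd d -> R) {dT : measure_display}
    {T : measurableType dT} (Pr : Omega d -> probability T R)
    (X : R -> T -> Omega d) : Prop :=
  is_spin_flip_process (voter_rate p) Pr X.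

End voter_model.

(* Continuous-time random walk on Z^d started at 0 which jumps by a at rate
   r a: a pure jump process with independent stationary increments and
   infinitesimal jump probabilities given by r.  The value r 0 plays no role,
   a jump by 0 being no jump. *)
Record is_random_walk (R : realType) (d : nat) (r : Zd d -> R)
    {dW : measure_display} {W : measurableType dW} (P : probability W R)
    (Z : R -> W -> Zd d) : Prop := {
  rw_measurable : forall (t : R) a, 0 <= t -> measurable [set w | Z t w = a] ;
  rw_start : forall w, Z 0 w = 0 ;
  rw_right_continuous : forall w (t : R), 0 <= t ->
    \forall s \near t^'+, Z s w = Z t w ;
  rw_left_limits : forall w (t : R), 0 < t ->
    exists a, \forall s \near t^'-, Z s w = a ;
  rw_independent : forall (n : nat) (t : nat -> R) (a : nat -> Zd d),
    0 <= t 0%N -> (forall k, t k <= t k.+1) ->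
    (P (\bigcap_(k < n) [set w | (Z (t k.+1) w - Z (t k) w)%R = a k])
       = \prod_(k < n) P [set w | (Z (t k.+1) w - Z (t k) w)%R = a k])%E ;
  rw_stationary : forall (s h : R) (a : Zd d), 0 <= s -> 0 <= h ->
    P [set w | Z (s + h) w - Z s w = a] = P [set w | Z h w = a] ;
  rw_jump_rate : forall a : Zd d, a != 0 ->
    fine (P [set w | Z h w = a]) / h @[h --> 0^'+] --> r a ;
  rw_total_rate :
    fine (P [set w | Z h w != 0]) / h @[h --> 0^'+]
      --> fine (\esum_(a in [set a : Zd d | a != 0%R]) (r a)%:E)%E
}.

(* Main.v *)
Require Import Defs.
From HB Require Import structures.
From mathcomp Require Import all_boot all_order all_algebra finmap.
From mathcomp Require Import all_classical all_reals all_analysis.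
From mathcomp Require Import measurable_realfun.
From mathcomp Require Import ring lra.
Set Implicit Arguments.
Unset Strict Implicit.
Unset Printing Implicit Defensive.
Import Order.TTheory GRing.Theory Num.Theory.
Import numFieldNormedType.Exports.
Local Open Scope classical_set_scope.
Local Open Scope ring_scope.

(* GEMB applied to the multiples of g = S_t f gives a Gaussian bound on the
   exponential moments of g - E g, with constant c * sum_i (delta_i g)^2; the
   Chernoff bound and the layer cake formula turn it into the L^q bound, where
   Gamma (q / 2) is the integral of u^(q/2 - 1) exp(- u).  It remains to prove
   |delta (S_t f)|_2 <= sqrt(P(Z_t = 0)) |delta f|_1.  If m is a subprobability
   on Z^d with delta_i (S_t f) <= sum_z m(i - z) delta_z f, this follows from
   Young's inequality and sum_a m(a)^2 <= P(Z_t = 0).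

   Morally m is the law of one walk with kernel p at time t: a single voter's
   ancestral line.  To avoid constructing the dual, S_t is approximated by an
   Euler scheme with time step h = t / N in a finite volume.  One step is an
   average of copyings of sites, so N steps bound the gradient by the law m_N
   of N steps of the lazy walk jumping with probability h.  The opinions read
   outside the volume cost an error controlled by the first moment of the walk.
   The autocorrelation of m_N satisfies, up to O(h^2) per step, the recursion
   of the law of the symmetric walk Z sampled at multiples of h, so
   sum_a m_N(a)^2 is asymptotically at most P(Z_t = 0); m is an ultrafilter
   limit of the m_N.

   The kernel bound holds for cylinder functions and compares the laws of X_t
   started from eta^i and from eta.  A bounded measurable f is approximated by
   inf-convolutions of its levels, restricted to closed sets of large measure
   under the second law, for the cost sum_{eta z <> xi z} (b z + eps) with b = delta f.
   On these closed sets they are at most f; by compactness their lower limit is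
   at least f up to the spacing of the levels. *)

(** * Gaussian exponential moments and L^q norms *)

(** The generator is given on cylinder functions only, with an error that is uniform in the
    configuration but not over these functions, and applying it enlarges the set of sites a function
    depends on. In a finite volume all Euler iterates, whatever the time step, stay in one
    finite-dimensional space, where the error is uniform. The volume is therefore fixed before N
    tends to infinity.

    The autocorrelation of m_N is the law of the difference of two independent lazy walks. Both jump
    in the same step with probability h^2; over t / h steps this adds up to t h, which vanishes in
    the limit.

    Uniform approximation by cylinder functions cannot reach every bounded measurable f: an
    indicator of a tail event has all delta_i f = 0 and may be discontinuous everywhere. But an
    upper bound on the difference of two integrals tolerates biased approximations: not much above f
    under one law, not much below f under the other. *)

Section gamma_function.
Context {R : realType}.
Local Notation leb := (@lebesgue_measure R).
Implicit Types a x y : R.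

Lemma continuous_powR a x : 0 < x -> {for x, continuous (fun u => u `^ a)}.
Proof.
move=> x0; apply: differentiable_continuous; apply/derivable1_diffP.
by apply: derivable_powR; rewrite in_itv/= x0.
Qed.

Lemma integral_powR_cc a x y : 0 < x -> x < y ->
  (\int[leb]_(u in `[x, y]) (a * u `^ (a - 1))%:E = (y `^ a - x `^ a)%:E)%E.
Proof.
move=> x0 xy; have cp b z : x <= z -> {for z, continuous (fun u : R => u `^ b)}.
  by move=> xz; apply: continuous_powR; exact: lt_le_trans xz.
rewrite (@continuous_FTC2 _ _ (fun u => u `^ a)) ?EFinB//.
- apply: continuous_in_subspaceT => z /set_mem/=; rewrite in_itv/= => /andP[xz _].
  by apply: cvgM; [exact: cvg_cst|exact: cp].
- split => [z||].
  + rewrite in_itv/= => /andP[xz _]; apply: derivable_powR.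
    by rewrite in_itv/= andbT (lt_trans x0).
  + by apply: cvg_at_right_filter; exact: cp.
  + by apply: cvg_at_left_filter; apply: cp; exact: ltW.
- move=> z; rewrite in_itv/= => /andP[xz _].
  by rewrite powR_derive1// in_itv/= andbT (lt_trans x0).
Qed.

(** For a < 1 the integrand is unbounded at 0, so the fundamental theorem is used on
    [y / (n + 2), y], nondegenerate already for n = 0, followed by monotone convergence. *)
Lemma integral_powR_oc a y : 0 < a -> 0 < y ->
  (\int[leb]_(u in `]0%R, y]) (a * u `^ (a - 1))%:E = (y `^ a)%:E)%E.
Proof.
move=> a0 y0; pose F n : set R := `[y / n.+2%:R, y]%classic.
have mp b D : measurable_fun D (fun u : R => (a * u `^ b)%:E).
  apply/measurable_EFinP/measurable_funTS; exact: measurable_funM.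
have ndF : nondecreasing_seq F.
  apply/nondecreasing_seqP => n; rewrite subsetEset => u; rewrite /F/=.
  rewrite !in_itv/= => /andP[+ ->]; rewrite andbT; apply: le_trans.
  by rewrite ler_pM2l// lef_pV2 ?posrE ?ltr0n// ler_nat.
have yn n : 0 < y / n.+2%:R by rewrite divr_gt0// ltr0n.
have /= := @ge0_nondecreasing_set_cvg_integral _ (measurableTypeR R) R F
  (fun u => (a * u `^ (a - 1))%:E) leb ndF (fun=> measurable_itv _)
  (fun=> mp _ _) (fun n u _ => mulr_ge0 (ltW a0) (powR_ge0 u (a - 1))).
have -> : \bigcup_i F i = `]0, y]%classic.
  apply/seteqP; split => u.
    move=> [n _]; rewrite /F/= !in_itv/= => /andP[nu ->]; rewrite andbT.
    exact: lt_le_trans nu.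
  rewrite /= in_itv/= => /andP[u0 uy].
  exists (Num.truncn (y / u)) => //; rewrite /F/= in_itv/= uy andbT.
  rewrite ler_pdivrMr ?ltr0n// mulrC -ler_pdivrMr//.
  apply: (le_trans (ltW (truncnS_gt _))); by rewrite ler_nat.
have cv : (\int[leb]_(u in F n) (a * u `^ (a - 1))%:E)%E @[n --> \oo] --> (y `^ a)%:E.
  rewrite (_ : (fun n => _) = (fun n => (y `^ a - (y / n.+2%:R) `^ a)%:E)); last first.
    apply/funext => n; rewrite integral_powR_cc//.
    by rewrite ltr_pdivrMr ?ltr0n// -[ltLHS]mulr1 ltr_pM2l// ltr1n.
  apply: cvg_EFin; first by near=> n.
  rewrite -[X in _ --> X]subr0; apply: cvgB; first exact: cvg_cst.
  apply: (@cvg_comp _ _ _ (fun n => y / n.+2%:R) (fun z => z `^ a) _ (0^'+)); last first.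
    exact: powR_cvg0.
  have c0 : y / n.+2%:R @[n --> \oo] --> 0.
    rewrite -[X in _ --> X](mulr0 y); apply: cvgM; first exact: cvg_cst.
    have := @cvg_harmonic R; rewrite -(@cvg_shiftS _ (@harmonic R)); exact.
  by move=> A /= /c0[N _ HN]; exists N => // n /HN/=; apply.
by move=> /cvg_unique; apply => //.
Unshelve. all: by end_near. Qed.

Lemma integral_gamma_lty a : 0 < a ->
  (\int[leb]_(x in `]0%R, +oo[) (x `^ (a - 1) * expR (- x))%:E < +oo)%E.
Proof.
move=> a0.
have mg D : measurable_fun D (fun x : R => (x `^ (a - 1) * expR (- x))%:E).
  apply/measurable_EFinP/measurable_funTS; apply: measurable_funM.
    exact: (@measurable_powR R).
  by apply: measurableT_comp => //; exact: measurable_funN.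
have mp D : measurable_fun D (fun u : R => (a * u `^ (a - 1))%:E).
  apply/measurable_EFinP/measurable_funTS; exact: measurable_funM.
have -> : `]0%R, +oo[%classic = `]0%R, 1%R] `|` `]1%R, +oo[ :> set R.
  by rewrite -itv_bndbnd_setU// bnd_simp.
rewrite ge0_integral_setU//=; first last.
- by apply/disj_set2P/seteqP; split=> x //=; rewrite !in_itv/= => -[/andP[_ x1]]; rewrite andbT ltNge x1.
- by move=> x _; rewrite lee_fin mulr_ge0 ?powR_ge0 ?expR_ge0.
  exact: mg.
apply: lte_add_pinfty.
  apply: (@le_lt_trans _ _ (\int[leb]_(x in `]0%R, 1%R]) (a^-1 * (a * x `^ (a - 1)))%:E)%E).
    apply: ge0_le_integral => //=.
    - by move=> x _; rewrite lee_fin mulr_ge0 ?powR_ge0 ?expR_ge0.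
    - exact: mg.
    - apply/measurable_EFinP; apply: measurable_funM => //.
      by have /measurable_EFinP := mp `]0, 1]%classic.
    move=> x; rewrite in_itv/= => /andP[x0 _]; rewrite lee_fin.
    rewrite mulrA mulVf ?gt_eqF// mul1r ler_piMr ?powR_ge0//.
    by rewrite -expR0 ler_expR oppr_le0 ltW.
  under eq_integral do rewrite EFinM.
  rewrite ge0_integralZl//=.
  - by rewrite integral_powR_oc// -EFinM ltry.
  - exact: mp.
  - by move=> x _; rewrite lee_fin mulr_ge0 ?powR_ge0 ?ltW.
  - by rewrite lee_fin invr_ge0 ltW.
(* From x <= 2 n exp(x / (2 n)) follows x^n <= (2 n)^n exp(x / 2), and n exceeds a - 1: half of the
   exponential decay absorbs the power. *)
pose n := (Num.truncn a).+1; pose C := (2 * n%:R) ^+ n :> R.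
have C0 : 0 < C by rewrite exprn_gt0// mulr_gt0// ltr0n.
have bnd (x : R) : 1 <= x -> x `^ (a - 1) * expR (- x) <= C * expR (- (2^-1 * x)).
  move=> x1; have x0 : 0 < x by exact: lt_le_trans x1.
  have -> : - x = - (2^-1 * x) + - (2^-1 * x) by lra.
  rewrite expRD mulrA ler_wpM2r ?expR_ge0// expRN ler_pdivrMr ?expR_gt0//.
  apply: (@le_trans _ _ (x ^+ n)).
    rewrite -(powR_mulrn _ (ltW x0)); apply: ler_powR => //.
    by rewrite lerBlDr ler_wpDr// ltW// truncnS_gt.
  have n0 : 0 < 2 * n%:R :> R by rewrite mulr_gt0// ltr0n.
  have xE : x = 2 * n%:R * (x / (2 * n%:R)) by field; rewrite pnatr_eq0.
  have -> : 2^-1 * x = n%:R * (x / (2 * n%:R)).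
    by field; rewrite pnatr_eq0.
  rewrite expRM_natl /C -exprMn; apply: lerXn2r; rewrite ?nnegrE ?(ltW x0)//.
  rewrite [leLHS]xE ler_pM2l//; apply: le_trans (expR_ge1Dx _).
  by rewrite lerDr.
apply: (@le_lt_trans _ _ (\int[leb]_(x in `[1%R, +oo[) (C * expR (- (2^-1 * x)))%:E)%E).
  rewrite integral_itv_obnd_cbnd//.
  apply: ge0_le_integral => //=.
  - by move=> x _; rewrite lee_fin mulr_ge0 ?powR_ge0 ?expR_ge0.
  - exact: mg.
  - apply/measurable_EFinP; apply: measurable_funM => //.
    apply: measurableT_comp => //; apply: measurable_funN => //.
  - by move=> x; rewrite in_itv/= andbT => x1; rewrite lee_fin bnd.
pose F (x : R) := - (2 * C) * expR (- (2^-1 * x)).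
have dF (x : R) : is_derive x 1 F (C * expR (- (2^-1 * x))).
  apply: is_derive_eq.
  by rewrite /= ?scaler1 ?scaler0 ?addr0 /GRing.scale/=; lra.
have cE : continuous (fun x : R => C * expR (- (2^-1 * x))).
  move=> x; apply: cvgM; first exact: cvg_cst.
  apply: continuous_comp; last exact: continuous_expR.
  by apply: cvgN; apply: cvgM; [exact: cvg_cst|exact: cvg_id].
rewrite (@ge0_continuous_FTC2y _ _ F 1 0).
- by rewrite -EFinB ltry.
- by move=> x _; rewrite mulr_ge0 ?expR_ge0 ?ltW.
- exact: continuous_subspaceT.
- rewrite /F -[X in _ --> X](mulr0 (- (2 * C))); apply: cvgM; first exact: cvg_cst.
  apply: (@cvg_comp _ _ _ (fun x : R => 2^-1 * x) (fun y : R => expR (- y)) _ +oo); last first.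
    exact: cvgr_expR.
  by apply: gt0_cvgMry => //; lra.
- by move=> x _; have [] := dF x.
- apply: cvg_at_right_filter; apply: differentiable_continuous.
  by apply/derivable1_diffP; have [] := dF 1.
- by move=> x _; rewrite derive1E; have [_ ->] := dF x.
Qed.

End gamma_function.

Section subgaussian.
Context {R : realType}.
Local Notation leb := (@lebesgue_measure R).

Lemma measurable_gamma_integrand (a : R) D :
  measurable_fun D (fun x : R => (x `^ (a - 1) * expR (- x))%:E).
Proof.
apply/measurable_EFinP/measurable_funTS; apply: measurable_funM.
  exact: (@measurable_powR R).
by apply: measurableT_comp => //; exact: measurable_funN.
Qed.

(** [Gamma] is the [fine] part of an extended integral, so this rests on the integral being
    finite. *)
Lemma Gamma_EFin (a : R) : 0 < a -> (Gamma a)%:E =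
  (\int[leb]_(x in `]0%R, +oo[) (x `^ (a - 1) * expR (- x))%:E)%E.
Proof.
move=> a0; rewrite /Gamma /Rintegral fineK// ge0_fin_numE.
  exact: integral_gamma_lty.
by apply: integral_ge0 => x _; rewrite lee_fin mulr_ge0 ?powR_ge0 ?expR_ge0.
Qed.

(** On ]0, 1] the exponential is at least exp(- 1), and the remaining power has integral 1 / a. *)
Lemma Gamma_gt0 (a : R) : 0 < a -> 0 < Gamma a.
Proof.
move=> a0; rewrite -lte_fin Gamma_EFin//.
have mp D : measurable_fun D (fun u : R => (a * u `^ (a - 1))%:E).
  apply/measurable_EFinP/measurable_funTS; exact: measurable_funM.
apply: (@lt_le_trans _ _ (\int[leb]_(x in `]0%R, 1%R])
    ((expR (- 1) / a)%:E * (a * x `^ (a - 1))%:E))%E).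
  rewrite ge0_integralZl//=; last 3 first.
  - exact: mp.
  - by move=> x _; rewrite lee_fin mulr_ge0 ?powR_ge0 ?ltW.
  - by rewrite lee_fin divr_ge0 ?expR_ge0 ?ltW.
  by rewrite integral_powR_oc// powR1 mule1 lte_fin divr_gt0 ?expR_gt0.
apply: (@le_trans _ _ (\int[leb]_(x in `]0%R, 1%R]) (x `^ (a - 1) * expR (- x))%:E)%E).
  apply: ge0_le_integral => //=.
  - by move=> x _; rewrite -EFinM lee_fin !mulr_ge0 ?invr_ge0 ?powR_ge0 ?expR_ge0// ltW.
  - apply/measurable_EFinP; apply: measurable_funM => //.
    by have /measurable_EFinP := mp `]0, 1]%classic.
  - exact: measurable_gamma_integrand.
  - move=> x; rewrite in_itv/= => /andP[x0 x1]; rewrite -EFinM lee_fin.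
    rewrite mulrA mulfVK ?gt_eqF// mulrC ler_wpM2l ?powR_ge0//.
    by rewrite ler_expR lerN2.
apply: ge0_subset_integral => //=.
- exact: measurable_gamma_integrand.
- by move=> x _; rewrite lee_fin mulr_ge0 ?powR_ge0 ?expR_ge0.
- by move=> x/=; rewrite !in_itv/= => /andP[-> _].
Qed.

Context d (T : measurableType d) (P : probability T R).

(** Y^a is the integral of a u^(a - 1) over 0 < u <= Y; Tonelli exchanges it with the
    expectation. *)
Lemma integral_powR_layer_cake (Y : T -> R) (a : R) : 0 < a ->
  measurable_fun setT Y -> (forall x, 0 <= Y x) ->
  (\int[P]_x (Y x `^ a)%:E =
   \int[leb]_(u in `]0%R, +oo[) ((a * u `^ (a - 1))%:E * P [set x | (u <= Y x)%R]))%E.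
Proof.
move=> a0 mY Y0; pose A : set (T * measurableTypeR R) := [set z | 0 < z.2 <= Y z.1].
have mp : measurable_fun setT (fun u : measurableTypeR R => a * u `^ (a - 1)).
  exact: measurable_funM.
have mA : measurable A.
  rewrite (_ : A = [set z | 0 < z.2] `&` [set z | z.2 <= Y z.1]); last first.
    by apply/seteqP; split=> z /andP.
  have mY1 : measurable_fun setT (fun z : T * measurableTypeR R => Y z.1).
    exact: measurableT_comp.
  apply: measurableI; rewrite -[X in measurable X]setTI.
    have : measurable_fun setT (fun z : T * measurableTypeR R => (0 < z.2)%R).
      exact: measurable_fun_ltr.
    by move=> /(_ measurableT [set true]); apply.
  have : measurable_fun setT (fun z : T * measurableTypeR R => (z.2 <= Y z.1)%R).
    exact: measurable_fun_ler.
  by move=> /(_ measurableT [set true]); apply.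
pose f (z : T * measurableTypeR R) := (a * z.2 `^ (a - 1) * \1_A z)%:E.
have f0 z : (0 <= f z)%E.
  by rewrite lee_fin !mulr_ge0 ?powR_ge0 ?(ltW a0)// indicE.
have mf : measurable_fun setT f.
  apply/measurable_EFinP; apply: measurable_funM; last exact: measurable_indic.
  exact: (measurableT_comp mp).
transitivity (\int[P]_x \int[leb]_u f (x, u))%E.
  apply: eq_integral => x _; have [Yx0|Yx0] := eqVneq (Y x) 0.
    rewrite Yx0 powR0 ?gt_eqF// integral0_eq// => u _; rewrite /f indicE memNset ?mulr0// /A/= Yx0.
    by move=> /andP[/lt_le_trans h /h]; rewrite ltxx.
  have Yp : 0 < Y x by rewrite lt_neqAle eq_sym Yx0 Y0.
  rewrite -(integral_powR_oc a0 Yp) integral_mkcond; apply: eq_integral => u _.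
  rewrite /f indicE patchE/=; case: ifPn => [/set_mem|/negP uY].
    by rewrite /= in_itv/= => uY; rewrite mem_set ?mulr1.
  rewrite memNset ?mulr0// => uA; apply: uY; apply/mem_set.
  by rewrite /= in_itv.
rewrite (fubini_tonelli f)//= [RHS]integral_mkcond; apply: eq_integral => u _.
rewrite patchE; case: ifPn => [/set_mem|/negP u0].
  rewrite /= in_itv/= andbT => u0.
  transitivity (\int[P]_x ((a * u `^ (a - 1))%:E * (\1_[set y | (0 < u <= Y y)%R] x)%:E))%E.
    by apply: eq_integral => x _; rewrite /f EFinM.
  rewrite ge0_integralZl//=; last 2 first.
  - apply/measurable_EFinP/measurable_indic; rewrite -[X in measurable X]setTI.
    have : measurable_fun setT (fun x => (0 < u <= Y x)%R).
      by apply: measurable_and => //; exact: measurable_fun_ler.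
    by move=> /(_ measurableT [set true]); apply.
  - by rewrite lee_fin mulr_ge0 ?powR_ge0 ?(ltW a0).
  congr (_ * _)%E; rewrite integral_indic ?setIT//.
    by congr (P _); apply/seteqP; split=> x /=; rewrite u0.
  rewrite -[X in measurable X]setTI.
  have : measurable_fun setT (fun x => (0 < u <= Y x)%R).
    by apply: measurable_and => //; exact: measurable_fun_ler.
  by move=> /(_ measurableT [set true]); apply.
rewrite integral0_eq// => x _; rewrite /f indicE memNset ?mulr0// /A/=.
by move=> /andP[u0' _]; apply: u0; apply/mem_set; rewrite /= in_itv/= u0'.
Qed.

Lemma exp_moment_tail (g : T -> R) (K s : R) : measurable_fun setT g -> 0 < K ->
  (forall l : R, (\int[P]_x (expR (l * g x))%:E <= (expR (K * l ^+ 2))%:E)%E) ->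
  0 <= s -> (P [set x | (s <= g x)%R] <= (expR (- (s ^+ 2 / (4 * K))))%:E)%E.
Proof.
(* The minimizer of K l^2 - l s, with minimum - s^2 / (4 K). *)
move=> mg K0 hg s0; pose l := s / (2 * K).
have l0 : 0 <= l by rewrite divr_ge0// mulr_ge0// ltW.
have mA : measurable [set x | (s <= g x)%R].
  rewrite -[X in measurable X]setTI.
  have : measurable_fun setT (fun x => (s <= g x)%R) by exact: measurable_fun_ler.
  by move=> /(_ measurableT [set true]); apply.
have me : measurable_fun setT (fun x => expR (l * g x)).
  by apply: measurableT_comp => //; exact: measurable_funM.
apply: (@le_trans _ _ (\int[P]_x ((expR (- (l * s)))%:E * (expR (l * g x))%:E))%E).
  rewrite -[X in P X]setIT -integral_indic//; apply: ge0_le_integral => //=.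
  - exact/measurable_EFinP/measurable_indic.
  - under eq_fun do rewrite -EFinM; apply/measurable_EFinP.
    exact: measurable_funM.
  - move=> x _; rewrite -EFinM lee_fin indicE; case: (boolP (_ \in _)) => [/set_mem/= sg|_]; last first.
      by rewrite mulr_ge0 ?expR_ge0.
    by rewrite -expRD -expR0 ler_expR addrC subr_ge0 ler_wpM2l.
rewrite ge0_integralZl//=; last exact/measurable_EFinP.
apply: (le_trans (lee_wpmul2l _ (hg l)))=> //.
rewrite -EFinM lee_fin -expRD ler_expR /l le_eqVlt; apply/orP; left; apply/eqP.
by field; rewrite gt_eqF.
Qed.

(** The substitution u = s^2 / (4 K) turns the Gaussian tail into an exponential one, the weight in
    the integral of [Gamma]. The factor 2 accounts for the tails of g and - g. *)
Lemma exp_moment_sqr_tail (g : T -> R) (K u : R) : measurable_fun setT g -> 0 < K ->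
  (forall l : R, (\int[P]_x (expR (l * g x))%:E <= (expR (K * l ^+ 2))%:E)%E) ->
  0 <= u -> (P [set x | (u <= g x ^+ 2 / (4 * K))%R] <= (2 * expR (- u))%:E)%E.
Proof.
move=> mg K0 hg u0; pose s := Num.sqrt (4 * K * u).
have K4 : 0 < 4 * K by rewrite mulr_gt0.
have sE : s ^+ 2 / (4 * K) = u.
  rewrite sqr_sqrtr; last by rewrite mulr_ge0 ?(ltW K4).
  by field; rewrite gt_eqF.
have mN : measurable_fun setT (fun x => - g x) by exact: measurable_funN.
have mA (h : T -> R) v : measurable_fun setT h -> measurable [set x | (v <= h x)%R].
  move=> mh; rewrite -[X in measurable X]setTI.
  have : measurable_fun setT (fun x => (v <= h x)%R) by exact: measurable_fun_ler.
  by move=> /(_ measurableT [set true]); apply.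
have t1 := exp_moment_tail mg K0 hg (sqrtr_ge0 (4 * K * u)).
have hN l : (\int[P]_x (expR (l * - g x))%:E <= (expR (K * l ^+ 2))%:E)%E.
  have := hg (- l); rewrite sqrrN.
  by under eq_integral do rewrite mulNr -mulrN.
have t2 := exp_moment_tail mN K0 hN (sqrtr_ge0 (4 * K * u)).
have mg2 : measurable_fun setT (fun x => g x ^+ 2 / (4 * K)).
  by apply: measurable_funM => //; exact: measurable_funX.
apply: (@le_trans _ _ (P ([set x | (s <= g x)%R] `|` [set x | (s <= - g x)%R]))).
  apply: le_measure; rewrite ?inE; [exact: mA| |].
    by apply: measurableU; exact: mA.
  move=> x /=; rewrite ler_pdivlMr// mulrC => ug.
  have : s <= `|g x|.
    by rewrite -[leRHS]ger0_norm// -sqrtr_sqr ler_sqrt ?sqr_ge0// real_normK// num_real.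
  by rewrite ler_normr => /orP.
apply: (le_trans (measureU2 _ _ _)); [exact: mA|exact: mA|].
rewrite mulr_natl mulr2n EFinD; rewrite -sE; exact: leeD.
Qed.

(** With Y = g^2 / (4 K), the layer cake formula bounds E Y^(q/2) by the integral of (q/2) u^(q/2 -
    1) 2 exp(- u), which is q Gamma(q/2). The q-th root of (4 K)^(q/2) is 2 sqrt K. *)
Lemma exp_moment_Lnorm (g : T -> R) (K q : R) : measurable_fun setT g -> 0 < K -> 1 <= q ->
  (forall l : R, (\int[P]_x (expR (l * g x))%:E <= (expR (K * l ^+ 2))%:E)%E) ->
  ('N[P]_(q%:E)[EFin \o g] <= (2 * Num.sqrt K * (q * Gamma (q / 2)) `^ q^-1)%:E)%E.
Proof.
move=> mg K0 q1 hg.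
have q0 : 0 < q by exact: lt_le_trans q1.
have a0 : 0 < q / 2 by rewrite divr_gt0.
have K4 : 0 < 4 * K by rewrite mulr_gt0.
pose Y x := g x ^+ 2 / (4 * K).
have mY : measurable_fun setT Y.
  by apply: measurable_funM => //; exact: measurable_funX.
have Y0 x : 0 <= Y x by rewrite divr_ge0 ?sqr_ge0 ?ltW.
have C0 : 0 <= (4 * K) `^ (q / 2) by exact: powR_ge0.
have gE x : (`|g x|%:E `^ q = ((4 * K) `^ (q / 2))%:E * (Y x `^ (q / 2))%:E)%E.
  rewrite poweR_EFin -EFinM; congr EFin.
  rewrite -powRM ?Y0 ?(ltW K4)// /Y mulrC divfK ?gt_eqF//.
  have -> : q = 2 * (q / 2) by field.
  by rewrite powRrM powR_mulrn// real_normK ?num_real//; congr (_ `^ _); field.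
have bnd : (\int[P]_x (`|g x|%:E `^ q) <= ((4 * K) `^ (q / 2) * (q * Gamma (q / 2)))%:E)%E.
  under eq_integral do rewrite gE.
  have mYp : measurable_fun setT (fun x => (Y x `^ (q / 2))%:E).
    apply/measurable_EFinP; exact: (measurableT_comp (@measurable_powR R (q / 2))).
  rewrite ge0_integralZl//=; last by move=> x _; rewrite lee_fin powR_ge0.
  rewrite EFinM lee_wpmul2l// integral_powR_layer_cake// EFinM Gamma_EFin//.
  rewrite -ge0_integralZl//=; last 3 first.
  - exact: measurable_gamma_integrand.
  - by move=> x _; rewrite lee_fin mulr_ge0 ?powR_ge0 ?expR_ge0.
  - by rewrite lee_fin ltW.
  have mPY : measurable_fun (`]0%R, +oo[%classic : set (measurableTypeR R)) (fun u : measurableTypeR R => P [set x | (u <= Y x)%R]).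
    have mA u : measurable [set x | (u <= Y x)%R].
      rewrite -[X in measurable X]setTI.
      have : measurable_fun setT (fun x => (u <= Y x)%R) by exact: measurable_fun_ler.
      by move=> /(_ measurableT [set true]); apply.
    apply: (eq_measurable_fun (EFin \o (fun u => fine (P [set x | (u <= Y x)%R])))) => [u _|].
      by rewrite /= fineK// fin_num_measure.
    apply/measurable_EFinP; apply: nonincreasing_measurable => // u v uv.
    rewrite fine_le ?fin_num_measure// le_measure ?inE// => x /=.
    exact: le_trans.
  apply: ge0_le_integral => //=.
  - move=> u _; apply: mule_ge0; last exact: measure_ge0.
    by rewrite lee_fin mulr_ge0 ?powR_ge0 ?(ltW a0).
  - apply: emeasurable_funM => //; apply/measurable_EFinP.
    by apply: measurable_funTS; exact: measurable_funM.
  - by apply: measurable_funeM; exact: measurable_gamma_integrand.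
  move=> u; rewrite in_itv/= andbT => u0.
  have t := exp_moment_sqr_tail mg K0 hg (ltW u0).
  apply: (le_trans (lee_wpmul2l _ t)).
    by rewrite lee_fin mulr_ge0 ?powR_ge0 ?(ltW a0).
  by rewrite -!EFinM lee_fin le_eqVlt; apply/orP; left; apply/eqP; field.
rewrite unlock; apply: (le_trans (gt0_ler_poweR _ _ _ bnd)).
- by rewrite invr_ge0 ltW.
- by rewrite in_itv/= leey andbT integral_ge0// => x _; exact: poweR_ge0.
- by rewrite in_itv/= leey andbT lee_fin !mulr_ge0 ?powR_ge0 ?(ltW q0)// ltW// Gamma_gt0.
rewrite poweR_EFin lee_fin powRM ?powR_ge0//; last first.
  by rewrite mulr_ge0 ?(ltW q0)// ltW// Gamma_gt0.
rewrite -powRrM (_ : q / 2 * q^-1 = 2^-1); last by field; rewrite gt_eqF.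
rewrite powR12_sqrt ?(ltW K4)// sqrtrM// (_ : 4 = 2 ^+ 2) ?sqrtr_sqr ?ger0_norm//.
by rewrite -natrX.
Qed.

End subgaussian.

(** * Autocorrelation of the lazy walk and the walk Z *)

Section esum_complements.
Context {R : realType}.
Local Open Scope ereal_scope.

Lemma esumT_le (T : choiceType) (f : T -> \bar R) x :
  (forall A, finite_set A -> \sum_(i \in A) f i <= x) ->
  \esum_(i in [set: T]) f i <= x.
Proof. by move=> fx; apply: ge_ereal_sup => _ [A [finA _] <-]; exact: fx. Qed.

Lemma fsum_le_esumT (T : choiceType) (f : T -> \bar R) A : finite_set A ->
  \sum_(i \in A) f i <= \esum_(i in [set: T]) f i.
Proof. by move=> finA; apply: ereal_sup_ubound; exists A. Qed.

Lemma sum_le_esumT (T : choiceType) (f : T -> \bar R) (s : seq T) : uniq s ->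
  \sum_(i <- s) f i <= \esum_(i in [set: T]) f i.
Proof.
move=> us; apply: le_trans (fsum_le_esumT _ (finite_seq s)).
rewrite fsbig_seq//; exact: lexx.
Qed.

Lemma term_le_esumT (T : choiceType) (f : T -> \bar R) t :
  f t <= \esum_(i in [set: T]) f i.
Proof. by have := @sum_le_esumT T f [:: t] isT; rewrite big_seq1. Qed.

Lemma esumTZl_EFin (T : choiceType) (f : T -> \bar R) (c : R) : (0 <= c)%R ->
  (forall i, 0 <= f i) ->
  \esum_(i in [set: T]) (c%:E * f i) = c%:E * \esum_(i in [set: T]) f i.
Proof.
have le (g : T -> \bar R) (b : R) : (0 <= b)%R -> (forall i, 0 <= g i) ->
    \esum_(i in [set: T]) (b%:E * g i) <= b%:E * \esum_(i in [set: T]) g i.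
  move=> b0 g0; apply: esumT_le => A finA.
  rewrite -ge0_mule_fsumr//; apply: lee_wpmul2l; first by rewrite lee_fin.
  exact: fsum_le_esumT.
move=> c0 f0; apply/eqP; rewrite eq_le le//=.
have [->|cN0] := eqVneq c 0%R.
  by rewrite mul0e esum_ge0// => i _; rewrite mul0e.
have {cN0}c0 : (0 < c)%R by rewrite lt_neqAle eq_sym cN0.
rewrite muleC -lee_pdivlMr// muleC.
have /= := @le (fun i => c%:E * f i) (c^-1)%R.
rewrite invr_ge0 ltW// => /(_ isT); under eq_esum do rewrite muleA -EFinM mulVf ?gt_eqF// mul1e.
by apply => i; rewrite mule_ge0// lee_fin ltW.
Qed.

Lemma esumTZl (T : choiceType) (f : T -> \bar R) (c : \bar R) : 0 <= c ->
  (forall i, 0 <= f i) ->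
  \esum_(i in [set: T]) (c * f i) = c * \esum_(i in [set: T]) f i.
Proof.
move: c => [c c0 f0|_ f0|//]; first exact: esumTZl_EFin.
have [[i fi]|nf] := pselect (exists i, f i != 0).
  have fi0 : 0 < f i by rewrite lt_neqAle eq_sym fi f0.
  have le1 := @term_le_esumT T f i.
  rewrite gt0_mulye; last exact: lt_le_trans le1.
  apply/eqP; rewrite -leye_eq.
  by apply: le_trans (@term_le_esumT T (fun i => +oo * f i) i); rewrite gt0_mulye.
have f00 i : f i = 0 by apply/eqP/negPn/negP => fi; apply: nf; exists i.
by rewrite !esum1 ?mule0// => i _; rewrite f00// mule0.
Qed.

Lemma esumTZr (T : choiceType) (f : T -> \bar R) (c : \bar R) : 0 <= c ->
  (forall i, 0 <= f i) ->
  \esum_(i in [set: T]) (f i * c) = (\esum_(i in [set: T]) f i) * c.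
Proof.
by move=> c0 f0; rewrite muleC -esumTZl//; apply: eq_esum => i _; rewrite muleC.
Qed.

Lemma esumT_swap (T U : choiceType) (f : T -> U -> \bar R) :
  (forall i j, 0 <= f i j) ->
  \esum_(i in [set: T]) \esum_(j in [set: U]) f i j =
  \esum_(j in [set: U]) \esum_(i in [set: T]) f i j.
Proof.
move=> f0; rewrite (esum_esum (J := fun=> setT))// (esum_esum (J := fun=> setT))//.
rewrite (@reindex_esum _ _ _ (setT `*`` (fun=> setT)) _ (fun z : T * U => (z.2, z.1)))//=.
split => //=; last by move=> [j i] _; exists (i, j).
by move=> [i j] [i' j'] _ _ /= [-> ->].
Qed.

Lemma esumT_bij (T : choiceType) (f : T -> \bar R) (g : T -> T) : bijective g ->
  \esum_(i in [set: T]) f (g i) = \esum_(i in [set: T]) f i.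
Proof.
move=> bg; rewrite [RHS](@reindex_esum _ _ _ setT _ g)//.
by rewrite setTT_bijective.
Qed.

Lemma esumT_addr (G : zmodType) (f : G -> \bar R) (a : G) :
  \esum_(i in [set: G]) f (i + a)%R = \esum_(i in [set: G]) f i.
Proof.
apply: (esumT_bij f); exists (fun x => x - a)%R => x; [exact: addrK|exact: subrK].
Qed.

Lemma esumT_opp (G : zmodType) (f : G -> \bar R) :
  \esum_(i in [set: G]) f (- i)%R = \esum_(i in [set: G]) f i.
Proof. by apply: (esumT_bij f); exists -%R => x; exact: opprK. Qed.

Lemma esumT_if_eq (T : choiceType) (f : T -> \bar R) t : 0 <= f t ->
  \esum_(i in [set: T]) (if i == t then f i else 0) = f t.
Proof.
move=> ft; rewrite -[RHS](esum_set1 ft) [RHS]esum_mkcond; apply: eq_esum => i _.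
have -> : (i \in [set t]%classic) = (i == t).
  by apply/idP/eqP => [/set_mem//|->]; exact/mem_set.
by case: eqP => // ->.
Qed.

End esum_complements.

(** * The lazy walk and the recursion of its autocorrelation *)

Section lazy_walk.
Context {R : realType} {G : zmodType} (p : G -> R).
Hypotheses (p_ge0 : forall a, 0 <= p a)
  (p_sum1 : (\esum_(a in [set: G]) (p a)%:E = 1)%E).
Local Open Scope ereal_scope.

(** The convolution of p and u: the law u after one more jump. *)
Definition jump_average (u : G -> \bar R) (a : G) : \bar R :=
  \esum_(b in [set: G]) ((p b)%:E * u (a - b)%R).

(* m_k = ((1-h) delta_0 + h p)^{*k}: the walk which, at each step, jumps with
   probability h. *)
Fixpoint lazy_walk (h : R) (k : nat) (a : G) : \bar R :=
  if k is k'.+1 then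
    (1 - h)%R%:E * lazy_walk h k' a + h%:E * jump_average (lazy_walk h k') a
  else (a == 0%R)%:R%:E.

(** For a probability u, the law of the difference of two independent samples; its value at 0 is the
    squared l^2 norm of u. *)
Definition autocorrelation (u : G -> \bar R) (c : G) : \bar R :=
  \esum_(a in [set: G]) (u a * u (a + c)%R).

Lemma jump_average_ge0 u a : (forall b, 0 <= u b) -> 0 <= jump_average u a.
Proof. by move=> u0; apply: esum_ge0 => b _; rewrite mule_ge0 ?lee_fin. Qed.

Lemma esum_jump_average u : (forall b, 0 <= u b) ->
  \esum_(a in [set: G]) jump_average u a = \esum_(a in [set: G]) u a.
Proof.
move=> u0; rewrite esumT_swap => [|a b]; last by rewrite mule_ge0 ?lee_fin.
under eq_esum => b _.
  rewrite esumTZl ?lee_fin//; rewrite (esumT_addr u (- b)); over.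
by rewrite esumTZr ?p_sum1 ?mul1e ?esum_ge0// => b; rewrite lee_fin.
Qed.

Section lazy_walk_h.
Variable h : R.
Hypotheses (h0 : (0 <= h)%R) (h1 : (h <= 1)%R).
Let m := lazy_walk h.

Lemma lazy_walk_ge0 k a : 0 <= m k a.
Proof.
rewrite /m; elim: k a => [|k IH] a /=; first by rewrite lee_fin.
by rewrite adde_ge0// mule_ge0 ?lee_fin ?subr_ge0// jump_average_ge0.
Qed.

Lemma esum_lazy_walk k : \esum_(a in [set: G]) m k a = 1.
Proof.
rewrite /m; elim: k => [|k IH] /=.
  under eq_esum => a _.
    rewrite (_ : _%:E = if a == 0%R then 1 else 0); last by case: eqP. over.
  by rewrite (esumT_if_eq (f := cst 1)).
have l0 a : 0 <= lazy_walk h k a by exact: lazy_walk_ge0.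
have j0 a : 0 <= jump_average (lazy_walk h k) a by exact: jump_average_ge0.
rewrite esumD => [|a _|a _]; [|by rewrite mule_ge0 ?lee_fin ?subr_ge0..].
rewrite !esumTZl ?lee_fin ?subr_ge0// esum_jump_average//.
by rewrite IH !mule1 -EFinD subrK.
Qed.

Lemma lazy_walk_le1 k a : m k a <= 1.
Proof. by rewrite -(esum_lazy_walk k); exact: term_le_esumT. Qed.

Lemma autocorrelation_lazy_walk_le1 k c : autocorrelation (m k) c <= 1.
Proof.
rewrite -(esum_lazy_walk k); apply: le_esum => a _.
by rewrite -[leRHS]mule1 lee_wpmul2l ?lazy_walk_ge0 ?lazy_walk_le1.
Qed.

(** Two independent lazy walks make one step. Both stay with probability (1 - h)^2. Exactly one
    jumps, each with probability h (1 - h): a jump b moves the difference by b or by - b according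
    to the walk that makes it, hence the symmetrized kernel. Both jump with probability h^2, and the
    autocorrelation met there is at most 1. *)
Lemma autocorrelation_lazy_walkS k c :
  autocorrelation (m k.+1) c <=
    ((1 - h) ^+ 2)%:E * autocorrelation (m k) c
    + (h * (1 - h))%:E *
      (\esum_(b in [set: G]) ((p b + p (- b)%R)%:E * autocorrelation (m k) (c - b)%R))
    + (h ^+ 2)%:E.
Proof.
set u := m k; pose v := jump_average u.
have u0 a : 0 <= u a by exact: lazy_walk_ge0.
have v0 a : 0 <= v a by exact: jump_average_ge0.
have g0 x : 0 <= autocorrelation u x by apply: esum_ge0 => a _; exact: mule_ge0.
have sv : \esum_(a in [set: G]) v a = 1 by rewrite esum_jump_average ?esum_lazy_walk.
have v1 a : v a <= 1 by rewrite -sv; exact: term_le_esumT.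
have h1' : (0 <= 1 - h)%R by rewrite subr_ge0.
have uv : \esum_(a in [set: G]) (u a * v (a + c)%R) =
    \esum_(b in [set: G]) ((p b)%:E * autocorrelation u (c - b)%R).
  under eq_esum => a _.
    rewrite -esumTZl => [|//|b]; last by rewrite mule_ge0 ?lee_fin. over.
  rewrite esumT_swap => [|a b]; last by rewrite !mule_ge0 ?lee_fin.
  apply: eq_esum => b _; rewrite -esumTZl ?lee_fin => [|//|a]; last exact: mule_ge0.
  by apply: eq_esum => a _; rewrite muleCA addrA.
have vu : \esum_(a in [set: G]) (v a * u (a + c)%R) =
    \esum_(b in [set: G]) ((p (- b)%R)%:E * autocorrelation u (c - b)%R).
  rewrite -[RHS]esumT_opp; under eq_esum => a _.
    rewrite -esumTZr => [|//|b]; last by rewrite mule_ge0 ?lee_fin. over.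
  rewrite esumT_swap => [|a b]; last by rewrite !mule_ge0 ?lee_fin.
  apply: eq_esum => b _; rewrite opprK -(esumT_addr _ b).
  rewrite -esumTZl ?lee_fin => [|//|a]; last exact: mule_ge0.
  by apply: eq_esum => a _; rewrite -muleA addrK -addrA (addrC b).
have vv : \esum_(a in [set: G]) (v a * v (a + c)%R) <= 1.
  rewrite -sv; apply: le_esum => a _.
  by rewrite -[leRHS]mule1 lee_wpmul2l.
have -> : autocorrelation (m k.+1) c = \esum_(a in [set: G])
    ((((1 - h) ^+ 2)%:E * (u a * u (a + c)%R) +
     (h * (1 - h))%:E * (u a * v (a + c)%R + v a * u (a + c)%R)) +
     (h ^+ 2)%:E * (v a * v (a + c)%R)).
  apply: eq_esum => a _; rewrite /m /= -/m -/u -/v.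
  have fu b : u b \is a fin_num.
    by rewrite ge0_fin_numE// (le_lt_trans (lazy_walk_le1 _ _))// ltry.
  have fv b : v b \is a fin_num.
    by rewrite ge0_fin_numE// (le_lt_trans (v1 _))// ltry.
  rewrite -(fineK (fu a)) -(fineK (fu (a + c)%R)) -(fineK (fv a)) -(fineK (fv (a + c)%R)).
  by rewrite -!(EFinM, EFinD); congr EFin; ring.
rewrite esumD => [|a _|a _]; last 2 first.
- rewrite adde_ge0// mule_ge0 ?lee_fin ?exprn_ge0 ?mulr_ge0//; first exact: mule_ge0.
  by rewrite adde_ge0// mule_ge0.
- by rewrite mule_ge0 ?lee_fin ?exprn_ge0// mule_ge0.
rewrite esumD => [|a _|a _]; last 2 first.
- by rewrite mule_ge0 ?lee_fin ?exprn_ge0// mule_ge0.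
- by rewrite mule_ge0 ?lee_fin ?mulr_ge0// adde_ge0// mule_ge0.
rewrite !esumTZl_EFin ?exprn_ge0 ?mulr_ge0//; last 3 first.
- by move=> a; rewrite mule_ge0.
- by move=> a; rewrite adde_ge0// mule_ge0.
- by move=> a; rewrite mule_ge0.
rewrite esumD => [|a _|a _]; [|exact: mule_ge0..].
rewrite uv vu -esumD => [|b _|b _]; [|by rewrite mule_ge0 ?lee_fin..].
have vvh : ((h ^+ 2)%:E * (\esum_(a in [set: G]) (v a * v (a + c)%R)) <= (h ^+ 2)%:E)%E.
  by rewrite -[leRHS]mule1; apply: lee_wpmul2l; rewrite ?lee_fin ?exprn_ge0.
rewrite leeD//.
rewrite leeD// lee_wpmul2l ?lee_fin ?mulr_ge0//; apply: le_esum => b _.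
by rewrite EFinD ge0_muleDl ?lee_fin.
Qed.

End lazy_walk_h.
End lazy_walk.

(** * Comparison of the autocorrelation with a given convolution recursion *)

Section walk_comparison.
Context {R : realType} {G : zmodType} (p : G -> R).
Hypotheses (p_ge0 : forall a, 0 <= p a)
  (p_sum1 : (\esum_(a in [set: G]) (p a)%:E = 1)%E).
Local Open Scope ereal_scope.

(** Each step adds at most [err], the mass of [eps], since autocorrelations are at most 1, and h^2
    for simultaneous jumps. As [nu] has mass at most 1, earlier errors are not amplified. *)
Lemma autocorrelation_le_walk (h err : R) (nu eps : G -> \bar R)
    (rho : nat -> G -> \bar R) : (0 <= h)%R -> (h <= 1)%R ->
  (forall b, 0 <= nu b) -> \esum_(b in [set: G]) nu b <= 1 ->
  (forall b, 0 <= eps b) -> \esum_(b in [set: G]) eps b <= err%:E ->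
  (forall c : G, (c == 0%R)%:R%:E <= rho 0%N c) ->
  (forall k c, \esum_(b in [set: G]) (nu b * rho k (c - b)%R) <= rho k.+1 c) ->
  (forall k c, 0 <= rho k c) ->
  (forall b : G, ((1 - h) ^+ 2 * (b == 0%R)%:R + h * (1 - h) * (p b + p (- b)%R))%:E
     <= nu b + eps b) ->
  forall k c, autocorrelation (lazy_walk p h k) c
     <= rho k c + (k%:R * (err + h ^+ 2))%:E.
Proof.
move=> h0 h1 nu0 nu1 eps0 epsE rho0 rhoS rhop ker; elim=> [|k IH] c.
  rewrite mul0r adde0; apply: le_trans (rho0 c).
  have c0 : 0 <= (c == 0%R)%:R%:E :> \bar R by rewrite lee_fin.
  have <- := @esumT_if_eq R G (fun=> (c == 0%R)%:R%:E) 0%R c0.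
  apply: le_esum => a _ /=; case: eqP => [->|_]; last by rewrite mul0e.
  by rewrite mul1e add0r.
have err0 : 0 <= err%:E by apply: le_trans epsE; exact: esum_ge0.
have h1' : (0 <= 1 - h)%R by rewrite subr_ge0.
have u0 a : 0 <= lazy_walk p h k a by exact: lazy_walk_ge0.
have g0 x : 0 <= autocorrelation (lazy_walk p h k) x.
  by apply: esum_ge0 => a _; exact: mule_ge0.
have kerr0 : (0 <= k%:R * (err + h ^+ 2))%R.
  by rewrite mulr_ge0 ?addr_ge0 ?exprn_ge0.
apply: (le_trans (autocorrelation_lazy_walkS _ _ _ _ _ _)) => //.
set g := autocorrelation (lazy_walk p h k) in IH g0 *.
have g1 x : g x <= 1 by exact: autocorrelation_lazy_walk_le1.
apply: (@le_trans _ _ ((\esum_(b in [set: G]) (nu b * rho k (c - b)%R)) +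
   (k%:R * (err + h ^+ 2))%:E + err%:E + (h ^+ 2)%:E)); last first.
  have -> : (k.+1%:R * (err + h ^+ 2))%:E =
      (k%:R * (err + h ^+ 2))%:E + err%:E + (h ^+ 2)%:E.
    by rewrite -!EFinD; congr EFin; rewrite -natr1; ring.
  by rewrite !addeA !leeD2r.
rewrite leeD2r//.
apply: (@le_trans _ _ (\esum_(b in [set: G]) (nu b * g (c - b)%R + eps b * g (c - b)%R))).
  rewrite -[in X in X + _ <= _](subr0 c).
  have g00 : 0 <= ((1 - h) ^+ 2)%:E * g (c - 0)%R by rewrite mule_ge0 ?lee_fin ?exprn_ge0.
  have <- := @esumT_if_eq R G (fun b => ((1 - h) ^+ 2)%:E * g (c - b)%R) 0%R g00.
  rewrite -esumTZl ?lee_fin ?mulr_ge0//; last first.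
    by move=> b; rewrite mule_ge0 ?lee_fin ?addr_ge0.
  rewrite -esumD => [|b _|b _]; last 2 first.
  - by case: ifP => // _; rewrite mule_ge0 ?lee_fin ?exprn_ge0.
  - by rewrite !mule_ge0 ?lee_fin ?addr_ge0 ?mulr_ge0.
  apply: le_esum => b _; rewrite -ge0_muleDl//.
  apply: le_trans (lee_wpmul2r (g0 _) (ker b)).
  rewrite muleA -EFinM; case: eqP => _; rewrite ?mulr1 ?mulr0.
    by rewrite EFinD ge0_muleDl ?lee_fin ?exprn_ge0 ?mulr_ge0// (addr_ge0 (p_ge0 _) (p_ge0 _)).
  by rewrite add0e add0r.
rewrite esumD => [|b _|b _]; [|exact: mule_ge0..].
apply: leeD; last first.
  apply: le_trans epsE; apply: le_esum => b _.
  by rewrite -[leRHS]mule1 lee_wpmul2l.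
apply: (@le_trans _ _ (\esum_(b in [set: G]) (nu b * rho k (c - b)%R + nu b * (k%:R * (err + h ^+ 2))%:E))).
  apply: le_esum => b _; rewrite -ge0_muleDr ?lee_fin//.
  by rewrite lee_wpmul2l.
rewrite esumD => [|b _|b _]; [|by rewrite mule_ge0 ?lee_fin..].
rewrite leeD// esumTZr ?lee_fin// -[leRHS]mul1e lee_wpmul2r// ?lee_fin//.
Qed.

End walk_comparison.

(** * Tails of convergent sums *)

Section esum_tail.
Context {R : realType} {T : choiceType}.
Local Open Scope ereal_scope.

Lemma esumT_seq (s : seq T) (f : T -> \bar R) : uniq s -> (forall b, 0 <= f b) ->
  \esum_(b in [set: T]) (if b \in s then f b else 0) = \sum_(b <- s) f b.
Proof.
move=> us f0; rewrite fsbig_seq// -esum_fset//= [RHS]esum_mkcond.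
by apply: eq_esum => b _; rewrite mem_setE.
Qed.

Lemma esumT_seqID (s : seq T) (f : T -> \bar R) : uniq s -> (forall b, 0 <= f b) ->
  \esum_(b in [set: T]) f b =
  \sum_(b <- s) f b + \esum_(b in [set: T]) (if b \in s then 0 else f b).
Proof.
move=> us f0; rewrite -esumT_seq// -esumD.
- by apply: eq_esum => b _; case: ifP => _; rewrite ?adde0 ?add0e.
- by move=> b _; case: ifP.
- by move=> b _; case: ifP.
Qed.

(** The prescribed point t will be the origin: outside s the kernel then has no mass from the event
    that neither walk jumps. *)
Lemma esum_tail (f : T -> R) (t : T) (e : R) : (forall b, 0 <= f b)%R ->
  \esum_(b in [set: T]) (f b)%:E < +oo -> (0 < e)%R ->
  exists s, [/\ uniq s, t \in s &
    \esum_(b in [set: T]) (if b \in s then 0 else (f b)%:E) <= e%:E].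
Proof.
move=> f0 foo e0; set F := fun b => (f b)%:E.
have F0 b : 0 <= F b by rewrite lee_fin.
have Ffin : \esum_(b in [set: T]) F b \is a fin_num by rewrite ge0_fin_numE ?esum_ge0.
have [_ [A [finA _] <-] AE] := ub_ereal_sup_adherent e0 Ffin.
have finB : finite_set (t |` A) by rewrite finite_setU; split.
exists (fset_set (t |` A)); split.
- exact: fset_uniq.
- by rewrite in_fset_set// mem_set//; left.
set s := fset_set _; have us : uniq s by exact: fset_uniq.
have AB : \sum_(i \in A) F i <= \sum_(i <- s) F i.
  rewrite -fsbig_finite//; apply: lee_fsum_nneg_subset => //.
  exact/subsetP/subsetUr.
have tot := esumT_seqID us F0.
have sfin : \sum_(i <- s) F i \is a fin_num by rewrite sumEFin.
have sE : \esum_(b in [set: T]) F b - e%:E <= \sum_(i <- s) F i.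
  exact: le_trans (ltW AE) AB.
move: sE; rewrite tot -[X in _ <= X]adde0 -addeA leeD2lE//.
by rewrite leeBlDr// add0e.
Qed.

End esum_tail.

(** * Laws of the walk Z *)

Section random_walk.
Context {R : realType} {d : nat} (r : Zd d -> R)
  {dW : measure_display} {W : measurableType dW} (P : probability W R)
  (Z : R -> W -> Zd d) (hZ : is_random_walk r P Z).
Local Open Scope ereal_scope.

Lemma measurable_walk_increment (s t : R) a : (0 <= s)%R -> (0 <= t)%R ->
  measurable [set w | (Z t w - Z s w)%R = a].
Proof.
move=> s0 t0; rewrite (_ : [set _ | _] = \bigcup_(b in [set: Zd d])
    ([set w | Z s w = b] `&` [set w | Z t w = (a + b)%R])); last first.
  apply/seteqP; split=> [w /= wa|w [b _ /= [<- ->]]]; last by rewrite addrK.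
  by exists (Z s w) => //=; rewrite -wa subrK.
apply: countable_bigcupT_measurable => [|b]; first exact: countableP.
by apply: measurableI; exact: (rw_measurable hZ).
Qed.

(** Half of the Chapman-Kolmogorov equation: over finitely many b, the events that Z is at c - b at
    time s and then moves by b are disjoint, and independent stationary increments give their
    probabilities. *)
Lemma walk_law_convolution (s h : R) (c : Zd d) : (0 <= s)%R -> (0 <= h)%R ->
  \esum_(b in [set: Zd d]) (P [set w | Z h w = b] * P [set w | Z s w = (c - b)%R])
    <= P [set w | Z (s + h) w = c].
Proof.
move=> s0 h0; have sh0 : (0 <= s + h)%R by rewrite addr_ge0.
apply: esumT_le => A finA.
pose E b := [set w | (Z s w - Z 0 w)%R = (c - b)%R] `&` [set w | (Z (s + h) w - Z s w)%R = b].
have mE b : measurable (E b) by apply: measurableI; exact: measurable_walk_increment.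
have EE b : P [set w | Z h w = b] * P [set w | Z s w = (c - b)%R] = P (E b).
  (* The times 0, s, s + h, continued by the constant s + h to a nondecreasing sequence. *)
  pose t k : R := if k is k'.+1 then (if k' is _.+1 then s + h else s)%R else 0%R.
  pose a k := if k is k'.+1 then b else (c - b)%R.
  have := @rw_independent _ _ _ _ _ _ _ hZ 2 t a (lexx _).
  rewrite bigcap_mkord !big_ord_recl !big_ord0 /= setIT mule1 => ->; last first.
    by move=> [|[|k]] //=; rewrite lerDl.
  rewrite muleC (rw_stationary hZ)//; congr (_ * _).
  by congr (P _); apply/seteqP; split=> w /=; rewrite (rw_start hZ) subr0.
under eq_fsbigr do rewrite EE.
rewrite -measure_fin_bigcup//; last first.
  move=> b b' _ _ [w [[_ /= <-] [_ /= <-]]]//.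
apply: le_measure; rewrite ?inE.
- exact: fin_bigcup_measurable.
- exact: (rw_measurable hZ).
- move=> w [b _ [/= h1 h2]]; move: h1; rewrite (rw_start hZ) subr0 => h1.
  by rewrite -(subrK (Z s w) (Z (s + h)%R w)) h2 h1 addrC subrK.
Qed.

Lemma walk_law_sum_le1 (h : R) : (0 <= h)%R ->
  \esum_(b in [set: Zd d]) P [set w | Z h w = b] <= 1.
Proof.
move=> h0; apply: esumT_le => A finA; rewrite -measure_fin_bigcup//.
- apply: probability_le1; apply: fin_bigcup_measurable => // b _.
  exact: (rw_measurable hZ).
- by move=> b b' _ _ [w [/= <- <-]].
- by move=> b _; exact: (rw_measurable hZ).
Qed.

(** The total jump rate is finite, so P(Z_h != 0) is of order h. *)
Lemma walk_return_near : \forall h \near (0:R)^'+,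
  (2^-1 <= fine (P [set w | Z h w = 0%R]))%R.
Proof.
pose C := fine (\esum_(a in [set a : Zd d | a != 0%R]) (r a)%:E).
have C0 : (0 < `|C| + 1)%R by rewrite ltr_wpDl.
have := rw_total_rate hZ => /cvgrPdist_le/(_ _ ltr01); rewrite -/C => nearC.
near=> h.
have h0 : (0 < h)%R by [].
have mZ : measurable [set w | Z h w = 0%R] by apply: (rw_measurable hZ); exact: ltW.
have -> : [set w | Z h w = 0%R] = ~` [set w | Z h w != 0%R].
  by apply/seteqP; split => w /=; [move=> ->; rewrite eqxx|move/negP/negPn/eqP].
have mN : measurable [set w | Z h w != 0%R].
  rewrite (_ : [set _ | _] = ~` [set w | Z h w = 0%R]); first exact: measurableC.
  by apply/seteqP; split => w /= /eqP.
rewrite probability_setC// fineB ?fin_num_measure//=.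
have : (`|C - fine (P [set w | Z h w != 0%R]) / h| <= 1)%R by near: h.
set x := fine _ => xh.
have hC : (h * (`|C| + 1) <= 2^-1)%R.
  by rewrite -ler_pdivlMr//; near: h; apply: nbhs_right_le; rewrite divr_gt0.
have : (x / h <= `|C| + 1)%R.
  move: xh; rewrite distrC => xh.
  rewrite -[leLHS](subrK C) addrC lerD//; first exact: ler_norm.
  exact: le_trans (ler_norm _) xh.
rewrite ler_pdivrMr// mulrC => xC; lra.
Unshelve. all: by end_near. Qed.

(** Cut [0, t] into N intervals so short that no displacement over one of them has probability at
    least 1/2; by the convolution inequality these probabilities multiply. *)
Lemma walk_return_gt0 (t : R) : (0 <= t)%R -> (0 < fine (P [set w | Z t w = 0%R]))%R.
Proof.
rewrite le_eqVlt => /predU1P[<-|t0].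
  rewrite (_ : [set _ | _] = setT) ?probability_setT ?ltr01//.
  by apply/seteqP; split => w //= _; exact: (rw_start hZ).
have [N /= N0 NP] : exists2 N : nat, (0 < N)%N & (2^-1 <= fine (P [set w | Z (t / N%:R)%R w = 0%R]))%R.
  have [e /= e0 He] := walk_return_near.
  exists (Num.truncn (t / e)).+1 => //; apply: He; last by rewrite divr_gt0// ltr0n.
  rewrite /= sub0r normrN ger0_norm ?divr_ge0 ?(ltW t0)//.
  rewrite ltr_pdivrMr ?ltr0n// mulrC -ltr_pdivrMr//; exact: truncnS_gt.
set h := (t / N%:R)%R in NP; have h0 : (0 < h)%R by rewrite divr_gt0// ltr0n.
have Pfin s : (0 <= s)%R -> P [set w | Z s w = 0%R] \is a fin_num.
  by move=> s0; apply: fin_num_measure; exact: (rw_measurable hZ).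
suff H k : (0 < fine (P [set w | Z (k%:R * h)%R w = 0%R]))%R.
  by have := H N; rewrite /h mulrC divfK// pnatr_eq0 -lt0n.
elim: k => [|k IH].
  rewrite mul0r (_ : [set _ | _] = setT) ?probability_setT ?ltr01//.
  by apply/seteqP; split => w //= _; exact: (rw_start hZ).
have kh0 : (0 <= k%:R * h)%R by rewrite mulr_ge0// ltW.
have := walk_law_convolution 0%R kh0 (ltW h0).
have -> : (k%:R * h + h = k.+1%:R * h)%R by rewrite -natr1 mulrDl mul1r.
move=> le1; have := le_trans (term_le_esumT _ 0%R) le1.
have kh1 : (0 <= k.+1%:R * h)%R by rewrite mulr_ge0// ltW.
rewrite /= subr0 -(fineK (Pfin _ kh0)) -(fineK (Pfin _ (ltW h0))) -EFinM.
rewrite -(fineK (Pfin _ kh1)) lee_fin; apply: lt_le_trans.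
by rewrite mulr_gt0// (lt_le_trans _ NP).
Qed.

End random_walk.

(** * The autocorrelation and the law of Z at multiples of h *)

Section walk_autocorrelation.
Context {R : realType} {d : nat} (p : Zd d -> R).
Hypotheses (p_ge0 : forall a, 0 <= p a)
  (p_sum1 : (\esum_(a in [set: Zd d]) (p a)%:E = 1)%E).
Context {dW : measure_display} {W : measurableType dW} (P : probability W R)
  (Z : R -> W -> Zd d) (hZ : is_random_walk (fun a => p a + p (- a)) P Z).
Local Open Scope ereal_scope.
Let r a := (p a + p (- a))%R.

Let r0 a : (0 <= r a)%R. Proof. by rewrite addr_ge0. Qed.

Let sum_r : \esum_(a in [set: Zd d]) (r a)%:E = 2%:E.
Proof.
under eq_esum => a _ do rewrite EFinD.
rewrite esumD => [|a _|a _]; [|by rewrite lee_fin..].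
by rewrite (esumT_opp (fun a => (p a)%:E)) p_sum1 -EFinD.
Qed.

Let total_rate : fine (\esum_(a in [set a : Zd d | a != 0%R]) (r a)%:E) = (2 - r 0)%R.
Proof.
have rE0 a : 0 <= (r a)%:E by rewrite lee_fin.
have := sum_r; rewrite (@esumT_seqID _ _ [:: 0%R] (fun a => (r a)%:E))//.
rewrite big_seq1 [\esum_(a in [set a : Zd d | a != 0%R]) _]esum_mkcond.
have <- : \esum_(a in [set: Zd d]) (if a \in [:: 0%R] then 0 else (r a)%:E) =
    \esum_(a in [set: Zd d]) (if a \in [set a : Zd d | a != 0%R] then (r a)%:E else 0).
  apply: eq_esum => a _; rewrite inE; case: ifPn => [/eqP->|a0].
    by rewrite memNset//= eqxx.
  by rewrite mem_set.
set X := esum _ _ => h; have Xf : X \is a fin_num by move: h; case: X.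
by move: h; rewrite -(fineK Xf) -EFinD => -[<-] /=; rewrite addrAC subrr add0r.
Qed.

Let fP (h : R) b := fine (P [set w | Z h w = b]).

(** Both sides agree to first order in h. For b != 0 they are h r(b). At b = 0, jumps by 0 do not
    count in the total rate, which is therefore 2 - r(0), and 1 - h (2 - r(0)) matches (1 - h)^2 + h
    (1 - h) r(0). *)
Let near_kernel (e : R) b : (0 < e)%R -> \forall h \near (0:R)^'+,
  ((1 - h) ^+ 2 * (b == 0%R)%:R + h * (1 - h) * r b <= fP h b + h * e)%R.
Proof.
move=> e0; have [->|b0] := eqVneq b 0%R; last first.
  have /cvgrPdist_le/(_ _ e0) H := rw_jump_rate hZ b0.
  near=> h; have h0 : (0 < h)%R by [].
  have : (`|r b - fP h b / h| <= e)%R by near: h.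
  rewrite mulr0 add0r => /(le_trans (ler_norm _)) /(ler_wpM2l (ltW h0)).
  rewrite (_ : h * (r b - fP h b / h) = h * r b - fP h b)%R; last first.
    by field; rewrite gt_eqF.
  rewrite lerBlDl; apply: le_trans; rewrite mulrAC ler_piMr ?mulr_ge0 ?(ltW h0)//.
  by rewrite lerBlDr lerDl ltW.
have e2 : (0 < e / 2)%R by rewrite divr_gt0.
have /cvgrPdist_le/(_ _ e2) := rw_total_rate hZ.
rewrite total_rate => H; near=> h; have h0 : (0 < h)%R by [].
have he : (h <= e / 2)%R by near: h; exact: nbhs_right_le.
have : (`|2 - r 0 - fine (P [set w | Z h w != 0%R]) / h| <= e / 2)%R by near: h.
have mZ : measurable [set w | Z h w = 0%R] by apply: (rw_measurable hZ); exact: ltW.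
have -> : [set w | Z h w != 0%R] = ~` [set w | Z h w = 0%R].
  by apply/seteqP; split => w /= /eqP.
rewrite probability_setC// fineB ?fin_num_measure//= -/(fP h 0%R).
set x := fP h 0%R; rewrite distrC => /(le_trans (ler_norm _)) /(ler_wpM2l (ltW h0)).
rewrite (_ : h * ((1 - x) / h - (2 - r 0)) = 1 - x - h * (2 - r 0))%R; last first.
  by field; rewrite gt_eqF.
move=> hx.
have hh : (h * h <= h * (e / 2))%R by rewrite ler_pM2l.
have hr : (0 <= h * h * r 0)%R by rewrite !mulr_ge0// ltW.
nra.
Unshelve. all: by end_near. Qed.

Lemma near_all_seq {T : eqType} (s : seq T) (Q : T -> R -> Prop) :
  (forall b, \forall h \near (0:R)^'+, Q b h) ->
  \forall h \near (0:R)^'+, forall b, b \in s -> Q b h.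
Proof.
move=> nQ; elim: s => [|a s IH]; first by near=> h.
near=> h => b; rewrite inE => /predU1P[->|]; first by near: h.
by move: b; near: h.
Unshelve. all: by end_near. Qed.

(** The jump rates are known pointwise, hence uniformly only on finite sets: s carries all but e / 3
    of the mass of r. Per step, the sites of s, the tail of r and the simultaneous jumps each cost
    at most h e / 3. *)
Lemma autocorrelation_near_walk (e : R) : (0 < e)%R ->
  \forall h \near (0:R)^'+, forall k c,
    autocorrelation (lazy_walk p h k) c
      <= P [set w | Z (k%:R * h) w = c] + (k%:R * (h * e))%:E.
Proof.
move=> e0; have e3 : (0 < e / 3)%R by rewrite divr_gt0.
have roo : \esum_(a in [set: Zd d]) (r a)%:E < +oo by rewrite sum_r ltry.
have [s [us s0 sE]] : exists s : seq (Zd d), [/\ uniq s, 0%R \in s &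
    \esum_(b in [set: Zd d]) (if b \in s then 0 else (r b)%:E) <= (e / 3)%:E].
  exact: esum_tail.
have ss0 : (0 < (size s)%:R :> R)%R by rewrite ltr0n; case: (s) s0.
pose e' := (e / 3 / (size s)%:R)%R; have e'0 : (0 < e')%R by rewrite divr_gt0.
have nk := near_all_seq s (fun b => near_kernel b e'0).
near=> h; have h0 : (0 < h)%R by [].
have h1 : (h <= 1)%R by near: h; exact: nbhs_right_le.
have he : (h <= e / 3)%R by near: h; exact: nbhs_right_le.
have hk : forall b, b \in s -> ((1 - h) ^+ 2 * (b == 0%R)%:R + h * (1 - h) * r b <= fP h b + h * e')%R.
  by near: h.
move=> k c.
pose eps b := (if b \in s then h * e' else h * r b)%:E.
have eps0 b : 0 <= eps b.
  by rewrite /eps lee_fin; case: ifP => _; rewrite mulr_ge0 ?(ltW h0)// ltW.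
have epsE : \esum_(b in [set: Zd d]) eps b <= (h * (e / 3 * 2))%:E.
  rewrite (esumT_seqID us)//.
  rewrite (_ : (h * (e / 3 * 2))%:E = (h * (e / 3))%:E + (h * (e / 3))%:E); last first.
    by rewrite -EFinD -mulrDr -[in RHS](mulr1 (e / 3)%R) -mulrDr.
  apply: leeD.
    rewrite (eq_big_seq (fun=> (h * e')%:E)); last by move=> b; rewrite /eps => ->.
    rewrite sumEFin big_const_seq count_predT iter_addr_0 lee_fin.
    rewrite le_eqVlt; apply/orP; left; apply/eqP; rewrite /e' -mulr_natr.
    by field; rewrite gt_eqF.
  rewrite EFinM; apply: le_trans (lee_wpmul2l _ sE); last by rewrite lee_fin ltW.
  rewrite -esumTZl ?lee_fin ?(ltW h0)//; last by move=> b; case: ifP; rewrite ?lee_fin.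
  apply: le_esum => b _; rewrite /eps.
  by have [bs|/negbTE bs] := boolP (b \in s); rewrite ?bs ?mule0 ?EFinM.
have kh j : (0 <= j%:R * h)%R by rewrite mulr_ge0// ltW.
apply: (le_trans (@autocorrelation_le_walk _ _ p p_ge0 p_sum1 h (h * (e / 3 * 2))
    (fun b => P [set w | Z h w = b]) eps (fun k c => P [set w | Z (k%:R * h)%R w = c])
    (ltW h0) h1 _ _ eps0 epsE _ _ _ _ k c)).
- by move=> b; exact: measure_ge0.
- by apply: (walk_law_sum_le1 hZ); exact: ltW.
- move=> b; rewrite mul0r; case: eqP => [->|_]; last by rewrite mulr0n measure_ge0.
  rewrite (_ : [set _ | _] = setT) ?probability_setT//.
  by apply/seteqP; split => w //= _; exact: (rw_start hZ).
- move=> j b.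
  have -> : (j.+1%:R * h = j%:R * h + h)%R by rewrite -natr1 mulrDl mul1r.
  by apply: (walk_law_convolution hZ); [exact: kh|exact: ltW].
- by move=> j b; exact: measure_ge0.
- move=> b; rewrite -[X in X + _](@fineK _ (P _)); last first.
    by apply: fin_num_measure; apply: (rw_measurable hZ); exact: ltW.
  rewrite -EFinD lee_fin; case: ifPn => bs; first exact: hk.
  have -> : (b == 0%R) = false by apply/eqP => b0; rewrite b0 s0 in bs.
  rewrite mulr0 add0r -[leLHS]add0r lerD ?fine_ge0//.
  by rewrite -/(r b) mulrAC ler_piMr ?mulr_ge0 ?(ltW h0)// lerBlDr lerDl ltW.
rewrite leeD2l// lee_fin ler_wpM2l//.
have : (h ^+ 2 <= h * (e / 3))%R by rewrite expr2 ler_pM2l.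
lra.
Unshelve. all: by end_near. Qed.

End walk_autocorrelation.

(** * Limits along an ultrafilter *)

Section ultralimit.
Context {R : realType}.

(** Compactness gives a cluster point, and a cluster point of an ultrafilter is its limit: otherwise
    the complement of some neighbourhood would belong to it. *)
Lemma bounded_ultra_cvg (U : set_system nat) (u : nat -> R) (a b : R) :
  UltraFilter U -> (forall n, a <= u n <= b) -> exists l : R, u n @[n --> U] --> l.
Proof.
move=> UU uab; have PU := ultra_proper.
have FU : (u n @[n --> U]) `[a, b]%classic.
  by apply: (@filterE _ U) => n /=; rewrite in_itv/=; exact: uab.
have [l [_ ul]] := @segment_compact R a b (u n @[n --> U]) _ FU.
exists l => A Al; case: (in_ultra_setVsetC (u @^-1` A) UU) => // uA.
by have [x [/= nAx Ax]] := ul (~` A) A uA Al.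
Qed.

Lemma cvg_lin_comb {T : eqType} (U : set_system nat) (u : nat -> T -> R) (m : T -> R)
    (s : seq T) (D : T -> R) : ProperFilter U ->
  (forall a, u n a @[n --> U] --> m a) ->
  (\sum_(a <- s) u n a * D a) @[n --> U] --> \sum_(a <- s) m a * D a.
Proof.
move=> PU um; elim: s => [|a s IH].
  rewrite big_nil; under eq_fun do rewrite big_nil; exact: cvg_cst.
rewrite big_cons; under eq_fun do rewrite big_cons.
by apply: cvgD => //; apply: cvgM => //; exact: cvg_cst.
Qed.

Lemma cvg_sum_sqr {T : eqType} (U : set_system nat) (u : nat -> T -> R) (m : T -> R)
    (s : seq T) : ProperFilter U ->
  (forall a, u n a @[n --> U] --> m a) ->
  (\sum_(a <- s) u n a ^+ 2) @[n --> U] --> \sum_(a <- s) m a ^+ 2.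
Proof.
move=> PU um; elim: s => [|a s IH].
  rewrite big_nil; under eq_fun do rewrite big_nil; exact: cvg_cst.
rewrite big_cons; under eq_fun do rewrite big_cons.
by apply: cvgD => //; rewrite expr2; under eq_fun do rewrite expr2; exact: cvgM.
Qed.

(* A limit along an ultrafilter is needed because sums against m must be exact
   limits of the sums against u n. *)
Lemma subprobability_limit {T : choiceType} (u : nat -> T -> R) (C : R) :
  (forall n a, 0 <= u n a) ->
  (forall n, (\esum_(a in [set: T]) (u n a)%:E <= 1)%E) ->
  (forall e, 0 < e -> \forall n \near \oo,
    (\esum_(a in [set: T]) ((u n a) ^+ 2)%:E <= (C + e)%:E)%E) ->
  exists m : T -> R, [/\ forall a, 0 <= m a,
    (\esum_(a in [set: T]) (m a)%:E <= 1)%E,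
    (\esum_(a in [set: T]) ((m a) ^+ 2)%:E <= C%:E)%E &
    forall (s : seq T) (D : T -> R) (B : R),
      (forall e, 0 < e -> \forall n \near \oo, B <= \sum_(a <- s) u n a * D a + e) ->
      B <= \sum_(a <- s) m a * D a].
Proof.
move=> u0 u1 u2; have [U [UU ooU]] := ultraFilterLemma eventually_filter.
have PU : ProperFilter U by exact: ultra_proper.
have ule1 n a : u n a <= 1.
  rewrite -lee_fin; apply: le_trans (u1 n); exact: (@term_le_esumT _ _ (fun a => (u n a)%:E)).
have /choice[m um] : forall a, exists l : R, u n a @[n --> U] --> l.
  by move=> a; apply: (@bounded_ultra_cvg U _ 0 1) => // n; rewrite u0 ule1.
exists m; split.
- by move=> a; apply: cvgr_to_ge (um a) _; exact: nearW.
- apply: esumT_le => A finA; rewrite fsbig_finite//= sumEFin lee_fin.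
  have := @cvg_lin_comb _ U u m (fset_set A) (fun=> 1) PU um.
  under eq_bigr do rewrite mulr1; move/cvgr_to_le; apply; apply: nearW => n.
  under eq_bigr do rewrite mulr1.
  rewrite -lee_fin -sumEFin; apply: le_trans (u1 n).
  by apply: (@sum_le_esumT _ _ (fun a => (u n a)%:E)); exact: fset_uniq.
- apply: esumT_le => A finA; rewrite fsbig_finite//= sumEFin lee_fin.
  apply/ler_addgt0Pr => e e0.
  apply: (cvgr_to_le (@cvg_sum_sqr _ U u m (fset_set A) PU um)).
  apply: ooU; apply: filterS (u2 e e0) => n H.
  rewrite -lee_fin -sumEFin; apply: le_trans H.
  by apply: (@sum_le_esumT _ _ (fun a => (u n a ^+ 2)%:E)); exact: fset_uniq.
- move=> s D B H; apply/ler_addgt0Pr => e e0.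
  rewrite -lerBlDr; apply: (cvgr_to_ge (@cvg_lin_comb _ U u m s D PU um)).
  by apply: ooU; apply: filterS (H e e0) => n; rewrite lerBlDr.
Qed.

End ultralimit.

(** * Euler scheme for the voter model in a finite volume *)

Section finite_volume.
Context {R : realType} {d : nat} (p : Zd d -> Zd d -> R) (hp : voter_kernel p).
Implicit Types (eta xi : Omega d) (x y z : Zd d) (v : Omega d -> R).

Definition set_site eta x (b : bool) : Omega d := fun y => if y == x then b else eta y.

Definition depends_on (s : seq (Zd d)) v :=
  forall eta xi, {in s, eta =1 xi} -> v eta = v xi.

(** Flipping is an involution, so the one-sided increments in [delta] yield such two-sided
    bounds. *)
Definition gradient_bound v (D : Zd d -> R) :=
  forall x eta, `|v (flip eta x) - v eta| <= D x.

Lemma flip_set_site eta x : flip eta x = set_site eta x (~~ eta x).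
Proof. by apply/funext => y; rewrite /flip /set_site; case: eqP => // ->. Qed.

Lemma set_site_id eta x : set_site eta x (eta x) = eta.
Proof. by apply/funext => y; rewrite /set_site; case: eqP => // ->. Qed.

Lemma flipK x : involutive (@flip d ^~ x).
Proof. by move=> eta; apply/funext => y; rewrite /flip; case: eqP => // _; rewrite negbK. Qed.

Lemma set_site_flip_same eta x b : set_site (flip eta x) x b = set_site eta x b.
Proof. by apply/funext => y; rewrite /set_site /flip; case: eqP. Qed.

Lemma set_site_flip eta x i b : x != i ->
  set_site (flip eta i) x b = flip (set_site eta x b) i.
Proof.
move=> xi; apply/funext => y; rewrite /set_site /flip.
by case: (eqVneq y x) => // ->; rewrite (negbTE xi).
Qed.

Lemma gradient_bound_ge0 v D x : gradient_bound v D -> 0 <= D x.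
Proof. by move=> vD; apply: le_trans (vD x (fun=> false)). Qed.

Lemma gradient_bound_set_site v D eta x b b' : gradient_bound v D ->
  `|v (set_site eta x b) - v (set_site eta x b')| <= (b != b')%:R * D x.
Proof.
move=> vD; case: (eqVneq b b') => [->|bb']; first by rewrite subrr normr0 mul0r.
rewrite mul1r; have -> : set_site eta x b = flip (set_site eta x b') x.
  rewrite flip_set_site; apply/funext => y; rewrite /set_site eqxx.
  by case: eqP => // _; case: b b' bb' => [] [].
exact: vD.
Qed.

Lemma depends_on_flip s v eta x : depends_on s v -> x \notin s -> v (flip eta x) = v eta.
Proof.
move=> sv xs; apply: sv => y ys; rewrite /flip; case: eqP => // yx.
by rewrite yx (negbTE xs) in ys.
Qed.

(** The probability that the voter at x consults a site outside s. *)
Definition leak (s : seq (Zd d)) x : R := 1 - \sum_(y <- s) p x y.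

(** The voter generator when all sites outside s hold opinion 0. Unlike the true generator it
    preserves the functions of the sites in s. *)
Definition finite_generator (s : seq (Zd d)) v eta : R :=
  \sum_(x <- s) (\sum_(y <- s) p x y * (v (set_site eta x (eta y)) - v eta)
                 + leak s x * (v (set_site eta x false) - v eta)).

Definition euler_step (s : seq (Zd d)) (h : R) v : Omega d -> R :=
  fun eta => v eta + h * finite_generator s v eta.

Section fixed_volume.
Variable (s : seq (Zd d)).
Hypothesis us : uniq s.

Lemma leak_ge0 x : 0 <= leak s x.
Proof.
rewrite subr_ge0 -lee_fin -(vk_sum1 hp x) -sumEFin.
exact: (sum_le_esumT (fun y => (p x y)%:E)).
Qed.

(** For h |s| <= 1 the right side is an average: x copies y with weight h p(x, y), takes opinion 0
    with weight h times its leak, and nothing happens with the remaining weight. Sup norms and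
    gradients are propagated through this form. *)
Lemma euler_stepE h v eta : euler_step s h v eta =
  (1 - h * (size s)%:R) * v eta + h * \sum_(x <- s)
    (\sum_(y <- s) p x y * v (set_site eta x (eta y)) + leak s x * v (set_site eta x false)).
Proof.
rewrite /euler_step /finite_generator.
rewrite (eq_bigr (fun x => (\sum_(y <- s) p x y * v (set_site eta x (eta y)) +
    leak s x * v (set_site eta x false)) - v eta)); last first.
  move=> x _; under eq_bigr do rewrite mulrBr.
  rewrite sumrB -mulr_suml /leak; ring.
rewrite sumrB big_const_seq count_predT iter_addr_0 -mulr_natr; ring.
Qed.

Lemma depends_on_euler_step h v : depends_on s v -> depends_on s (euler_step s h v).
Proof.
move=> sv eta xi ex.
have E x b b' : b = b' -> v (set_site eta x b) = v (set_site xi x b').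
  by move=> ->; apply: sv => y ys; rewrite /set_site; case: eqP => // _; exact: ex.
rewrite !euler_stepE (sv _ _ ex); congr (_ + _ * _).
apply: eq_big_seq => x xs; rewrite (E x false false)//; congr (_ + _).
by apply: eq_big_seq => y ys; rewrite (E x _ (xi y))// ex.
Qed.

Lemma euler_step_bound h v M : 0 <= h -> h * (size s)%:R <= 1 ->
  (forall eta, `|v eta| <= M) -> forall eta, `|euler_step s h v eta| <= M.
Proof.
move=> h0 hs vM eta; rewrite euler_stepE; apply: (le_trans (ler_normD _ _)).
rewrite !normrM (ger0_norm h0) ger0_norm ?subr_ge0//.
have -> : M = (1 - h * (size s)%:R) * M + h * (M * (size s)%:R) by ring.
apply: lerD; first by rewrite ler_wpM2l// subr_ge0.
rewrite ler_wpM2l//; apply: (le_trans (ler_norm_sum _ _ _)).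
rewrite mulr_natr -iter_addr_0 -[size s]count_predT -big_const_seq.
apply: ler_sum => x _; apply: (le_trans (ler_normD _ _)).
rewrite normrM (ger0_norm (leak_ge0 x)).
have -> : M = \sum_(y <- s) p x y * M + leak s x * M by rewrite -mulr_suml /leak; ring.
apply: lerD; last by rewrite ler_wpM2l// leak_ge0.
apply: (le_trans (ler_norm_sum _ _ _)); apply: ler_sum => y _.
by rewrite normrM ger0_norm ?(vk_ge0 hp)// ler_wpM2l// (vk_ge0 hp).
Qed.

(** Compare the copying of y onto x from eta and from its flip at i. If x = i the discrepancy at i
    is overwritten, otherwise it persists and costs D i; if y = i it is also passed on to x, at cost
    D x. Since x = i occurs with total weight h, the coefficient of D i falls to 1 - h. *)
Lemma euler_step_gradient h v D i eta : 0 <= h -> h * (size s)%:R <= 1 ->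
  gradient_bound v D -> i \in s ->
  `|euler_step s h v (flip eta i) - euler_step s h v eta|
    <= (1 - h) * D i + h * \sum_(x <- s) p x i * D x.
Proof.
move=> h0 hs vD is_; have D0 x : 0 <= D x by exact: gradient_bound_ge0 vD.
have p0 x y : 0 <= p x y by exact: vk_ge0.
pose n : R := (size s)%:R.
pose A xi x := \sum_(y <- s) p x y * v (set_site xi x (xi y)) + leak s x * v (set_site xi x false).
have key x : x \in s -> `|A (flip eta i) x - A eta x| <= (x != i)%:R * D i + p x i * D x.
  move=> xs; have -> : A (flip eta i) x - A eta x =
     \sum_(y <- s) p x y * (v (set_site (flip eta i) x (flip eta i y)) - v (set_site eta x (eta y)))
     + leak s x * (v (set_site (flip eta i) x false) - v (set_site eta x false)).
    rewrite /A; under [in RHS]eq_bigr do rewrite mulrBr.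
    by rewrite sumrB; ring.
  apply: (le_trans (ler_normD _ _)); rewrite normrM (ger0_norm (leak_ge0 x)).
  have t y b : `|v (set_site (flip eta i) x b) - v (set_site eta x (eta y))|
      <= (x != i)%:R * D i + (b != eta y)%:R * D x.
    case: (eqVneq x i) => [->|xi].
      by rewrite set_site_flip_same mul0r add0r; exact: gradient_bound_set_site.
    rewrite mul1r set_site_flip//.
    rewrite -[X in `|X|](subrKA (v (set_site eta x b))).
    apply: (le_trans (ler_normD _ _)); apply: lerD; first exact: vD.
    exact: gradient_bound_set_site.
  have -> : (x != i)%:R * D i + p x i * D x =
     \sum_(y <- s) p x y * ((x != i)%:R * D i + (y == i)%:R * D x) + leak s x * ((x != i)%:R * D i).
    under eq_bigr do rewrite mulrDr.
    have E : \sum_(y <- s) p x y * ((y == i)%:R * D x) = p x i * D x.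
      rewrite (bigD1_seq i)//= eqxx mul1r big1 ?addr0// => y /negbTE->.
      by rewrite mul0r mulr0.
    by rewrite big_split/= E -mulr_suml /leak; ring.
  apply: lerD; last first.
    rewrite ler_wpM2l ?leak_ge0//; case: (eqVneq x i) => [->|xi].
      by rewrite set_site_flip_same subrr normr0 mul0r.
    by rewrite set_site_flip// mul1r; exact: vD.
  apply: (le_trans (ler_norm_sum _ _ _)); apply: ler_sum => y _.
  rewrite normrM ger0_norm// ler_wpM2l//; apply: (le_trans (t y _)); rewrite lerD2l.
  rewrite /flip; case: (eqVneq y i) => _; last by rewrite eqxx.
  by rewrite ler_wpM2r// lern1 leq_b1.
rewrite !euler_stepE -!/(A _ _).
have -> : (1 - h * n) * v (flip eta i) + h * (\sum_(x <- s) A (flip eta i) x) -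
    ((1 - h * n) * v eta + h * \sum_(x <- s) A eta x) =
    (1 - h * n) * (v (flip eta i) - v eta) + h * \sum_(x <- s) (A (flip eta i) x - A eta x).
  by rewrite sumrB; ring.
apply: (le_trans (ler_normD _ _)); rewrite !normrM (ger0_norm h0) ger0_norm ?subr_ge0//.
have sn : \sum_(x <- s) (x != i)%:R * D i = (n - 1) * D i.
  rewrite -mulr_suml; congr (_ * _).
  rewrite (eq_bigr (fun x => 1 - (x == i)%:R)); last by move=> x _; case: eqP => //= _; rewrite ?subrr ?subr0.
  rewrite sumrB big_const_seq count_predT iter_addr_0 (bigD1_seq i)//= eqxx big1 ?addr0//.
  by move=> x /negbTE ->.
have -> : (1 - h) * D i + h * \sum_(x <- s) p x i * D x =
   (1 - h * n) * D i + h * \sum_(x <- s) ((x != i)%:R * D i + p x i * D x).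
  by rewrite big_split/= sn; ring.
apply: lerD; first by rewrite ler_wpM2l ?subr_ge0.
rewrite ler_wpM2l//; apply: (le_trans (ler_norm_sum _ _ _)).
by rewrite big_seq [leRHS]big_seq; apply: ler_sum => x xs; exact: key.
Qed.

End fixed_volume.
End finite_volume.

Lemma spin_flip_generatorE {R : realType} {d : nat} (c : Zd d -> Omega d -> R)
    (s : seq (Zd d)) (v : Omega d -> R) (eta : Omega d) : uniq s -> depends_on s v ->
  spin_flip_generator c v eta = \sum_(x <- s) c x eta * (v (flip eta x) - v eta).
Proof.
move=> us sv; rewrite /spin_flip_generator [RHS]fsbig_seq//; symmetry.
apply: fsbig_widen => // x [_ /= /negP xs]; apply/eqP; rewrite mulf_eq0 subr_eq0.
by rewrite (depends_on_flip _ sv)// eqxx orbT.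
Qed.

(** * The voter model against its finite-volume version *)

Section voter_euler.
Context {R : realType} {d : nat} (p : Zd d -> Zd d -> R) (hp : voter_kernel p).
Implicit Types (eta xi : Omega d) (x y z : Zd d) (v g : Omega d -> R) (s : seq (Zd d)).

Let p_ge0 x y : 0 <= p x y. Proof. exact: vk_ge0. Qed.

Lemma esum_leak s x : uniq s ->
  (\esum_(y in [set: Zd d]) (if y \in s then 0 else (p x y)%:E) = (leak p s x)%:E)%E.
Proof.
move=> us; have p0 y : (0 <= (p x y)%:E)%E by rewrite lee_fin.
have := vk_sum1 hp x; rewrite (esumT_seqID us p0) sumEFin.
set X := esum _ _ => h; have Xf : X \is a fin_num by move: h; case: X.
by move: h; rewrite -(fineK Xf) -EFinD => -[/= h]; rewrite /leak -h addrAC subrr add0r.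
Qed.

Lemma voter_rateE x eta : voter_rate p x eta =
  fine (\esum_(y in [set: Zd d]) (p x y * (eta y != eta x)%:R)%:E)%E.
Proof.
rewrite /voter_rate; case: (eta x); congr fine; apply: eq_esum => y _.
  by case: (eta y); rewrite ?subrr ?subr0.
by case: (eta y).
Qed.

(** The sites outside s contribute between 0 and the leak to the true rate, and either 0 or the
    whole leak to the finite-volume one. *)
Lemma voter_rate_finite s x eta : uniq s ->
  `|voter_rate p x eta -
     (\sum_(y <- s) p x y * (eta y != eta x)%:R + leak p s x * (eta x)%:R)| <= leak p s x.
Proof.
move=> us; have q0 y : (0 <= (p x y * (eta y != eta x)%:R)%:E)%E by rewrite lee_fin mulr_ge0.
have L0 := leak_ge0 hp us x.
rewrite voter_rateE (esumT_seqID us q0) sumEFin.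
set X := esum _ _.
have X0 : (0 <= X)%E by apply: esum_ge0 => y _; case: ifP.
have XL : (X <= (leak p s x)%:E)%E.
  rewrite -esum_leak//; apply: le_esum => y _; case: ifP => // _.
  by rewrite lee_fin; case: (_ != _); rewrite ?mulr1 ?mulr0.
have Xf : X \is a fin_num by rewrite ge0_fin_numE// (le_lt_trans XL)// ltry.
rewrite -(fineK Xf) -EFinD /= opprD addrACA subrr add0r.
have : 0 <= fine X <= leak p s x by rewrite -!lee_fin fineK// X0.
case/andP => x0 xL; case: (eta x); rewrite ?mulr1 ?mulr0 ?subr0.
  by rewrite distrC ger0_norm ?subr_ge0// lerBlDr lerDl.
by rewrite ger0_norm.
Qed.

Lemma finite_generatorE s v eta : finite_generator p s v eta =
  \sum_(x <- s) (\sum_(y <- s) p x y * (eta y != eta x)%:R + leak p s x * (eta x)%:R)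
    * (v (flip eta x) - v eta).
Proof.
have E x b : v (set_site eta x b) - v eta = (b != eta x)%:R * (v (flip eta x) - v eta).
  case: (eqVneq b (eta x)) => [->|bx]; first by rewrite set_site_id subrr mul0r.
  by rewrite mul1r flip_set_site; congr (v (set_site _ _ _) - _); case: b (eta x) bx => [] [].
apply: eq_bigr => x _; rewrite [RHS]mulrDl mulr_suml E; congr (_ + _).
  by apply: eq_bigr => y _; rewrite E mulrA.
by rewrite mulrA; case: (eta x).
Qed.

Lemma generator_finite_error s v D eta : uniq s -> depends_on s v -> gradient_bound v D ->
  `|spin_flip_generator (voter_rate p) v eta - finite_generator p s v eta|
    <= \sum_(x <- s) leak p s x * D x.
Proof.
move=> us sv vD; rewrite (spin_flip_generatorE _ _ us sv) finite_generatorE -sumrB; apply: (le_trans (ler_norm_sum _ _ _)).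
apply: ler_sum => x _; rewrite -mulrBl normrM.
by apply: ler_pM => //; exact: voter_rate_finite.
Qed.

Let p0_ge0 a : 0 <= p 0 a. Proof. exact: p_ge0. Qed.
Let p0_sum1 : (\esum_(a in [set: Zd d]) (p 0 a)%:E = 1)%E. Proof. exact: vk_sum1. Qed.

Section time_step.
Variable h : R.
Hypotheses (h0 : 0 <= h) (h1 : h <= 1).
Let m k a := fine (lazy_walk (p 0) h k a).

Lemma lazy_walk_EFin k a : ((m k a)%:E = lazy_walk (p 0) h k a)%E.
Proof.
rewrite fineK// ge0_fin_numE ?lazy_walk_ge0//.
by apply: le_lt_trans (lazy_walk_le1 p0_ge0 p0_sum1 h0 h1 k a) _; rewrite ltry.
Qed.

Lemma lazy_walk_fine_ge0 k a : 0 <= m k a.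
Proof. by rewrite fine_ge0// lazy_walk_ge0. Qed.

Lemma lazy_walk_fineS k (t : seq (Zd d)) (i z : Zd d) : uniq t ->
  (1 - h) * m k (i - z) + h * \sum_(x <- t) p x i * m k (x - z) <= m k.+1 (i - z).
Proof.
move=> ut; rewrite -lee_fin lazy_walk_EFin /= EFinD !EFinM lazy_walk_EFin leeD2l//.
apply: lee_wpmul2l; first by rewrite lee_fin.
have inj : injective (fun x : Zd d => i - x) by move=> x y /addrI/oppr_inj.
rewrite -sumEFin.
have -> : (\sum_(x <- t) (p x i * m k (x - z)%R)%:E =
    \sum_(b <- [seq (i - x)%R | x <- t]) (p 0 b)%:E * lazy_walk (p 0) h k (i - z - b)%R)%E.
  rewrite big_map; apply: eq_bigr => x _; rewrite EFinM lazy_walk_EFin (vk_translation hp x).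
  by congr (_ * lazy_walk _ _ _ _)%E; rewrite opprB [RHS]addrC addrA subrK.
by apply: (@sum_le_esumT _ _ (fun b => (p 0 b)%:E * lazy_walk (p 0) h k (i - z - b)%R)%E); rewrite map_inj_uniq.
Qed.

(** Each step convolves the bound with the one-step law of the lazy walk. At sites outside s there
    is nothing to prove, as the iterates depend on s only. *)
Lemma euler_iter_gradient s g D k : uniq s -> h * (size s)%:R <= 1 ->
  depends_on s g -> gradient_bound g D ->
  gradient_bound (iter k (euler_step p s h) g)
    (fun i => \sum_(z <- s) m k (i - z) * D z).
Proof.
move=> us hs sg gD; have D0 x : 0 <= D x by exact: gradient_bound_ge0 gD.
have sk j : depends_on s (iter j (euler_step p s h) g).
  by elim: j => // j IH; exact: depends_on_euler_step.
have z0 j i : 0 <= \sum_(z <- s) m j (i - z) * D z.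
  by apply: sumr_ge0 => z _; rewrite mulr_ge0 ?lazy_walk_fine_ge0.
elim: k => [|k IH] i eta.
  have [is_|is_] := boolP (i \in s); last first.
    by rewrite (depends_on_flip _ (sk 0%N))// subrr normr0 z0.
  apply: (le_trans (gD i eta)); rewrite (bigD1_seq i)//= /m/= subrr eqxx mul1r lerDl.
  by apply: sumr_ge0 => z _; rewrite mulr_ge0.
have [is_|is_] := boolP (i \in s); last first.
  by rewrite (depends_on_flip _ (sk k.+1))// subrr normr0 z0.
apply: (le_trans (euler_step_gradient hp us eta h0 hs IH is_)).
rewrite mulr_sumr mulr_sumr.
under [X in _ + X]eq_bigr do rewrite mulr_sumr mulr_sumr.
rewrite exchange_big/= -big_split/=; apply: ler_sum => z _.
apply: le_trans (ler_wpM2r (D0 z) (lazy_walk_fineS k i z us)).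
rewrite [leRHS]mulrDl mulrA lerD2l// mulr_sumr mulr_suml le_eqVlt; apply/orP; left; apply/eqP.
by apply: eq_bigr => x _; rewrite !mulrA.
Qed.

End time_step.

Definition l1_weight (a : Zd d) : R := \sum_(i < d) `|(a 0 i)%:~R|.

Lemma l1_weight_ge0 a : 0 <= l1_weight a.
Proof. by apply: sumr_ge0. Qed.

Lemma l1_weightD a b : l1_weight (a + b) <= l1_weight a + l1_weight b.
Proof.
rewrite -big_split/=; apply: ler_sum => i _; rewrite mxE intrD; exact: ler_normD.
Qed.

Lemma l1_weight0 : l1_weight 0 = 0.
Proof. by rewrite /l1_weight big1// => i _; rewrite mxE normr0. Qed.

Definition mean_jump : R := fine (\esum_(a in [set: Zd d]) (p 0 a * l1_weight a)%:E)%E.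

(** Integers satisfy |n| <= n^2, so the second moment controls the first. *)
Lemma mean_jump_EFin : (\esum_(a in [set: Zd d]) (p 0 a * l1_weight a)%:E = mean_jump%:E)%E.
Proof.
rewrite fineK// ge0_fin_numE; last first.
  by apply: esum_ge0 => a _; rewrite lee_fin mulr_ge0// l1_weight_ge0.
apply: le_lt_trans (vk_second_moment hp 0); apply: le_esum => a _.
rewrite lee_fin mulrC ler_wpM2r// subr0; apply: ler_sum => i _.
rewrite -intr_norm ler_int -[leRHS]real_normK ?num_real// expr2.
have [->|n0] := eqVneq (a 0 i) 0; first by rewrite normr0.
by rewrite ler_peMr// -gtz0_ge1 normr_gt0.
Qed.

Lemma mean_jump_ge0 : 0 <= mean_jump.
Proof.
rewrite fine_ge0// esum_ge0// => a _.
by rewrite lee_fin mulr_ge0// l1_weight_ge0.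
Qed.

Section first_moment.
Variable h : R.
Hypotheses (h0 : 0 <= h) (h1 : h <= 1).
Local Open Scope ereal_scope.

Lemma lazy_walk_first_moment k :
  \esum_(a in [set: Zd d]) (lazy_walk (p 0%R) h k a * (l1_weight a)%:E)
    <= (k%:R * (h * mean_jump))%:E.
Proof.
have w0 a : 0 <= (l1_weight a)%:E by rewrite lee_fin l1_weight_ge0.
have h1' : (0 <= 1 - h)%R by rewrite subr_ge0.
elim: k => [|k IH].
  rewrite mul0r esum1// => a _ /=; case: eqP => [->|_]; last by rewrite mul0e.
  by rewrite l1_weight0 mule0.
set u := lazy_walk (p 0%R) h k in IH *.
have u0 a : 0 <= u a by exact: lazy_walk_ge0.
have q0 a : 0 <= (p 0%R a)%:E by rewrite lee_fin.
have j0 a : 0 <= jump_average (p 0%R) u a by exact: jump_average_ge0.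
have jw : \esum_(a in [set: Zd d]) (jump_average (p 0%R) u a * (l1_weight a)%:E) <=
    mean_jump%:E + \esum_(a in [set: Zd d]) (u a * (l1_weight a)%:E).
  under eq_esum => a _.
    rewrite -esumTZr => [|//|b]; last exact: mule_ge0. over.
  rewrite esumT_swap => [|a b]; last by rewrite !mule_ge0.
  apply: (@le_trans _ _ (\esum_(b in [set: Zd d])
      ((p 0%R b * l1_weight b)%:E + (p 0%R b)%:E * \esum_(a in [set: Zd d]) (u a * (l1_weight a)%:E)))).
    apply: le_esum => b _; rewrite -(esumT_addr _ b).
    apply: (@le_trans _ _ (\esum_(a in [set: Zd d])
        ((p 0%R b * l1_weight b)%:E * u a + (p 0%R b)%:E * (u a * (l1_weight a)%:E)))).
      apply: le_esum => a _; rewrite addrK EFinM -!muleA -ge0_muleDr ?mule_ge0//.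
      rewrite lee_wpmul2l// [X in X + _]muleC -ge0_muleDr//.
      by rewrite lee_wpmul2l// -EFinD lee_fin addrC; exact: l1_weightD.
    rewrite esumD => [|a _|a _]; last 2 first.
    - by rewrite mule_ge0// lee_fin mulr_ge0// l1_weight_ge0.
    - by rewrite !mule_ge0.
    rewrite !esumTZl//; last 2 first.
    - by move=> a; rewrite mule_ge0.
    - by rewrite lee_fin mulr_ge0// l1_weight_ge0.
    by rewrite /u esum_lazy_walk// mule1.
  rewrite esumD => [|b _|b _]; last 2 first.
  - by rewrite lee_fin mulr_ge0// l1_weight_ge0.
  - by rewrite mule_ge0// esum_ge0// => a _; rewrite mule_ge0.
  rewrite mean_jump_EFin esumTZr// ?p0_sum1 ?mul1e//.
  by apply: esum_ge0 => a _; rewrite mule_ge0.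
under eq_esum => a _.
  rewrite /= -/u ge0_muleDl ?mule_ge0 ?lee_fin// -!muleA. over.
rewrite esumD => [|a _|a _]; last 2 first.
- by rewrite !mule_ge0 ?lee_fin ?l1_weight_ge0.
- by rewrite !mule_ge0 ?lee_fin ?l1_weight_ge0.
rewrite !esumTZl ?lee_fin//; try by move=> a; rewrite mule_ge0.
set S := esum _ (fun a => u a * _) in IH jw *.
have S0 : 0 <= S by apply: esum_ge0 => a _; rewrite mule_ge0.
have Sf : S \is a fin_num by rewrite ge0_fin_numE// (le_lt_trans IH)// ltry.
apply: (@le_trans _ _ ((1 - h)%:E * S + h%:E * (mean_jump%:E + S))).
  by rewrite leeD2l// lee_wpmul2l// lee_fin.
move: IH; rewrite -(fineK Sf) -!(EFinM, EFinD) !lee_fin -natr1; lra.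
Qed.

(** Markov's inequality: a site outside s has weight at least n, while the site consulted from x has
    mean weight at most that of x plus [mean_jump]. *)
Lemma leak_first_moment (s : seq (Zd d)) (n : R) x : uniq s -> (0 <= n)%R ->
  (forall a, a \notin s -> n <= l1_weight a)%R ->
  (n * leak p s x <= l1_weight x + mean_jump)%R.
Proof.
move=> us n0 sn; have q0 a : 0 <= (p 0%R a)%:E by rewrite lee_fin.
have w0 a : 0 <= (l1_weight a)%:E by rewrite lee_fin l1_weight_ge0.
rewrite -lee_fin EFinM -esum_leak// -esumTZl_EFin//; last by move=> y; case: ifP; rewrite ?lee_fin.
apply: (@le_trans _ _ (\esum_(y in [set: Zd d]) ((p x y)%:E * (l1_weight y)%:E))).
  apply: le_esum => y _; case: ifPn => [_|ys].
    by rewrite mule0 mule_ge0// lee_fin.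
  by rewrite muleC lee_wpmul2l ?lee_fin// sn.
rewrite -(esumT_addr _ x).
apply: (@le_trans _ _ (\esum_(b in [set: Zd d]) ((p 0%R b)%:E * (l1_weight x)%:E + (p 0%R b * l1_weight b)%:E))).
  apply: le_esum => b _; rewrite (vk_translation hp x) addrK EFinM -ge0_muleDr//.
  by rewrite lee_wpmul2l// -EFinD lee_fin addrC; exact: l1_weightD.
rewrite esumD => [|b _|b _]; last 2 first.
- by rewrite mule_ge0.
- by rewrite lee_fin mulr_ge0// l1_weight_ge0.
by rewrite mean_jump_EFin esumTZr// p0_sum1 mul1e EFinD.
Qed.

(** The mean leak seen by the lazy walk from z after k steps. It is of order 1 / n, and k enters
    through k h only, so the bound is uniform over all steps of a scheme of fixed duration. *)
Lemma leak_lazy_walk (s : seq (Zd d)) (n : R) k (z : Zd d) : uniq s -> (0 < n)%R ->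
  (forall a, a \notin s -> n <= l1_weight a)%R ->
  (\sum_(x <- s) leak p s x * fine (lazy_walk (p 0%R) h k (x - z)%R)
    <= n^-1 * (k%:R * (h * mean_jump) + l1_weight z + mean_jump))%R.
Proof.
move=> us n0 sn; rewrite ler_pdivlMl// -lee_fin.
have w0 a : 0 <= (l1_weight a)%:E by rewrite lee_fin l1_weight_ge0.
have u0 a : 0 <= lazy_walk (p 0%R) h k a by exact: lazy_walk_ge0.
apply: (@le_trans _ _ (\esum_(x in [set: Zd d]) (lazy_walk (p 0%R) h k (x - z)%R *
    (l1_weight (x - z)%R)%:E + lazy_walk (p 0%R) h k (x - z)%R * (l1_weight z + mean_jump)%:E))).
  apply: le_trans (sum_le_esumT _ us).
  rewrite mulr_sumr -sumEFin; apply: lee_sum => x _.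
  rewrite -ge0_muleDr ?lee_fin ?addr_ge0 ?l1_weight_ge0 ?mean_jump_ge0//.
  rewrite -lazy_walk_EFin// -EFinD -EFinM lee_fin mulrA mulrC.
  rewrite ler_wpM2l ?lazy_walk_fine_ge0//.
  apply: (le_trans (leak_first_moment x us (ltW n0) sn)).
  by rewrite addrA lerD2r -{1}(subrK z x); exact: l1_weightD.
rewrite esumD => [|b _|b _]; [|by rewrite mule_ge0 ?lee_fin ?addr_ge0 ?l1_weight_ge0 ?mean_jump_ge0..].
rewrite esumTZr ?lee_fin ?addr_ge0 ?l1_weight_ge0 ?mean_jump_ge0//.
rewrite (esumT_addr (fun x => lazy_walk (p 0%R) h k x) (- z)%R) esum_lazy_walk// mul1e.
rewrite (esumT_addr (fun x => lazy_walk (p 0%R) h k x * (l1_weight x)%:E) (- z)%R).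
rewrite -addrA [leRHS]EFinD leeD2r//; exact: lazy_walk_first_moment.
Qed.

End first_moment.

Lemma l1_ball_exhaustion (n : nat) : exists s : seq (Zd d),
  uniq s /\ forall a, a \notin s -> n%:R <= l1_weight a.
Proof.
(* Enumerates the cube [- n, n]^d. *)
pose f (w : {ffun 'I_d -> 'I_(n + n).+1}) : Zd d := \row_i ((w i)%:Z - n%:Z).
exists (undup [seq f w | w <- enum {ffun 'I_d -> 'I_(n + n).+1}]).
split; first exact: undup_uniq.
move=> a; rewrite mem_undup => ans.
have [i ni] : exists i, (n%:Z <= `|a 0 i|)%R.
  apply/not_existsP => small; move/negP: ans; apply.
  have lt (i : 'I_d) : (absz (a 0 i + n%:Z)%R < (n + n).+1)%N.
    have /negP := small i; rewrite -ltNge ltr_norml => /andP[l1 l2].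
    rewrite -ltz_nat gez0_abs; last by rewrite -lerBlDr sub0r ltW.
    have -> : ((n + n).+1)%:Z = n%:Z + n%:Z + 1 by rewrite -[(n + n).+1]addn1 !PoszD.
    by move: l1 l2; set b := a 0 i; lra.
  apply/mapP; exists [ffun i => Ordinal (lt i)]; first by rewrite mem_enum.
  apply/matrixP => j i; rewrite ord1 mxE ffunE /= gez0_abs ?addrK//.
  by have /negP := small i; rewrite -ltNge ltr_norml => /andP[l1 _]; rewrite -lerBlDr sub0r ltW.
rewrite /l1_weight (bigD1 i)//= ler_wpDr ?sumr_ge0//.
by rewrite -intr_norm -(ler_int R) in ni *.
Qed.

End voter_euler.

(** * Gradient of the semigroup on cylinder functions *)

Section bounded_mean.
Context {R : realType} {d : measure_display} {T : measurableType d} (P : probability T R).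
Implicit Types (f g : T -> R) (M e : R).

Lemma bounded_integrable f M : measurable_fun setT f -> (forall x, `|f x| <= M) ->
  P.-integrable setT (EFin \o f).
Proof.
move=> mf fM; apply: measurable_bounded_integrable => //.
  exact: le_lt_trans (probability_le1 P measurableT) (ltry 1).
exists M; split; first exact: num_real.
by move=> N MN x _; apply: le_trans (fM x) (ltW MN).
Qed.

Lemma mean_cst e : \int[P]_(_ in [set: T]) e = e.
Proof.
rewrite Rintegral_cst// -[RHS]mulr1; congr (_ * _).
exact: (congr1 fine (probability_setT P)).
Qed.

Lemma mean_dist f g M e : measurable_fun setT f -> measurable_fun setT g ->
  (forall x, `|f x| <= M) -> (forall x, `|g x| <= M) ->
  (forall x, `|f x - g x| <= e) -> `|\int[P]_x f x - \int[P]_x g x| <= e.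
Proof.
move=> mf mg fM gM fge.
have If := bounded_integrable mf fM; have Ig := bounded_integrable mg gM.
have Ifg : P.-integrable setT (EFin \o (f \- g)).
  by apply: (bounded_integrable (M := e)) => //; exact: measurable_funB.
rewrite -RintegralB//; apply: (le_trans (le_normr_Rintegral _ Ifg)) => //.
rewrite -[leRHS](mean_cst e).
apply: le_Rintegral => //.
- apply: (bounded_integrable (M := e)) => [|x]; last by rewrite /= normr_id.
  by apply: measurableT_comp => //; exact: measurable_funB.
- exact: (bounded_integrable (M := `|e|)).
- by move=> x _; exact: fge.
Qed.

Lemma mean_bound f M : measurable_fun setT f -> (forall x, `|f x| <= M) ->
  `|\int[P]_x f x| <= M.
Proof.
move=> mf fM; have := @mean_dist f (cst 0) M M mf; rewrite Rintegral_cst// mul0r subr0.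
have M0 : 0 <= M by apply: le_trans (fM point).
apply => // [x|x]; first by rewrite normr0.
by rewrite subr0.
Qed.

Lemma mean_lin_comb (I : finType) (a : I -> R) (b : I -> T -> R) M :
  (forall i, measurable_fun setT (b i)) -> (forall i x, `|b i x| <= M) ->
  \int[P]_x (\sum_i a i * b i x) = \sum_i a i * \int[P]_x b i x.
Proof.
move=> mb bM; have Ib i := bounded_integrable (mb i) (bM i).
have Iab i : P.-integrable setT (EFin \o (fun x => a i * b i x)).
  apply: (bounded_integrable (M := `|a i| * M)) => [|x]; first exact: measurable_funM.
  by rewrite normrM ler_wpM2l.
have key (s : seq I) : \int[P]_x (\sum_(i <- s) a i * b i x) = \sum_(i <- s) a i * \int[P]_x b i x.
  elim: s => [|i s IH].
    by under eq_Rintegral do rewrite big_nil; rewrite Rintegral_cst// mul0r big_nil.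
  under eq_Rintegral do rewrite big_cons.
  rewrite RintegralD// ?big_cons ?IH ?RintegralZl//.
  - rewrite (_ : EFin \o _ = (fun x => \sum_(j <- s) (a j * b j x)%:E)%E); last first.
      by apply/funext => x /=; rewrite -sumEFin.
    by apply: integrable_sum => // j _; exact: Iab.
exact: key.
Qed.

(** The g n may fail to converge, but at each point the minimum of g n and f is eventually f, so
    dominated convergence applies to these minima. *)
Lemma mean_eventually_le (g : nat -> T -> R) f M (C : R) :
  (forall n, measurable_fun setT (g n)) -> measurable_fun setT f ->
  (forall n xi, `|g n xi| <= M) -> (forall xi, `|f xi| <= M) ->
  (forall xi, \forall n \near \oo, f xi <= g n xi) ->
  (forall n, \int[P]_xi g n xi <= C) -> \int[P]_xi f xi <= C.
Proof.
move=> mg mf gM fM fg gC; pose h n xi := Num.min (g n xi) (f xi).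
have mh n : measurable_fun setT (h n) by apply: measurable_minr => //; exact: mg.
have hM n xi : `|h n xi| <= M by rewrite /h; case: (leP (g n xi) (f xi)).
have hC n : \int[P]_xi h n xi <= C.
  apply: le_trans (gC n); apply: le_Rintegral => //.
  - exact: bounded_integrable (hM n).
  - exact: bounded_integrable (gM n).
  - by move=> xi _; rewrite /h ge_min lexx.
have M0 : 0 <= M by exact: le_trans (fM point).
have [] := @dominated_convergence _ _ _ P setT measurableT (fun n xi => (h n xi)%:E)
    (fun xi => (f xi)%:E) (cst M%:E).
- by move=> n; exact/measurable_EFinP.
- exact/measurable_EFinP.
- apply/aeW => xi _; apply: cvg_EFin; first exact: nearW.
  apply: cvg_near_cst; have := fg xi; apply: filterS => n fgn.
  by rewrite /= /h; apply/min_idPr.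
- apply: (@bounded_integrable (cst M) M) => // xi.
  by rewrite /= ger0_norm.
- by apply/aeW => xi n _; rewrite /= lee_fin.
have fE : (\int[P]_xi (f xi)%:E = (\int[P]_xi f xi)%:E)%E.
  by rewrite /Rintegral fineK// integrable_fin_num//; exact: bounded_integrable fM.
rewrite fE => _ _ /fine_cvg cv.
by apply: (cvgr_to_le cv); exact: nearW.
Qed.

End bounded_mean.

(** * Cylinder functions as combinations of patterns *)

Section cylinder_functions.
Context {R : realType} {d : nat}.
Implicit Types (eta xi : Omega d) (x y z : Zd d) (v g : Omega d -> R) (s : seq (Zd d)).

Lemma measurable_site x : measurable_fun setT (fun eta : Omega d => eta x).
Proof.
apply: (measurable_fun_bool true); rewrite setTI; apply: sub_sigma_algebra.
have pc : forall A : set bool, open A -> open ((fun eta : Omega d => eta x) @^-1` A).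
  apply/continuousP; exact: (@proj_continuous (Zd d) (fun=> bool) x).
by apply: (pc [set true]); exact: discrete_open.
Qed.

Lemma measurable_pattern s (w : seq bool) :
  measurable_fun setT (fun eta : Omega d => map eta s == w).
Proof.
elim: s w => [|x s IH] [|b w]; try exact: measurable_cst.
under eq_fun do rewrite /= eqseq_cons.
apply: measurable_and => //; case: b.
  by under eq_fun do rewrite eqb_id; exact: measurable_site.
by under eq_fun do rewrite eqbF_neg; apply: measurable_neg; exact: measurable_site.
Qed.

Definition extend_pattern s (w : seq bool) : Omega d := fun x => nth false w (index x s).

Definition pattern_fun s (w : seq bool) : Omega d -> R := fun eta => (map eta s == w)%:R.

(** The functions of the sites in s are spanned by finitely many indicators. Measurability, the
    semigroup property and the uniform generator estimate are all reduced to these indicators. *)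
Lemma pattern_decomposition s v eta : depends_on s v ->
  v eta = \sum_(w : (size s).-tuple bool) v (extend_pattern s w) * pattern_fun s w eta.
Proof.
move=> sv; pose w0 := map_tuple eta (in_tuple s).
rewrite (bigD1 w0)//= big1 ?addr0; last first.
  move=> w ww0; rewrite /pattern_fun; case: eqP => [E|_]; last by rewrite mulr0.
  by case/eqP: ww0; apply: val_inj.
rewrite /pattern_fun eqxx mulr1; apply: sv => x xs.
by rewrite /extend_pattern (nth_map x) ?index_mem// nth_index.
Qed.

Lemma pattern_fun_indic s w :
  pattern_fun s w = \1_[set eta : Omega d | map eta s == w] :> (Omega d -> R).
Proof.
apply/funext => eta; rewrite /pattern_fun indicE; congr (_%:R).
by congr nat_of_bool; apply/idP/idP => [h|/set_mem//]; exact/mem_set.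
Qed.

Lemma measurable_pattern_set s w : measurable [set eta : Omega d | map eta s == w].
Proof.
rewrite -[X in measurable X]setTI.
by have := measurable_pattern s w measurableT (Y := [set true]); apply.
Qed.

Lemma measurable_pattern_fun s w : measurable_fun setT (pattern_fun s w).
Proof. by rewrite pattern_fun_indic; apply: measurable_indic; exact: measurable_pattern_set. Qed.

Lemma pattern_fun_bound s w eta : `|pattern_fun s w eta| <= 1.
Proof. by rewrite /pattern_fun ger0_norm// lern1 leq_b1. Qed.

Lemma depends_on_pattern_fun s w : depends_on s (pattern_fun s w).
Proof. by move=> eta xi /eq_in_map e; rewrite /pattern_fun e. Qed.

Lemma depends_on_cylinder s v : depends_on s v -> cylinder v.
Proof.
move=> sv; exists [set` s]; split; first exact: finite_seq.
by move=> eta xi e; apply: sv => x xs; apply: e; rewrite mem_setE.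
Qed.

Lemma measurable_depends_on s v : depends_on s v -> measurable_fun setT v.
Proof.
move=> sv; rewrite (_ : v = fun eta => \sum_(w : (size s).-tuple bool)
    v (extend_pattern s w) * pattern_fun s w eta); last first.
  by apply/funext => eta; exact: pattern_decomposition.
apply: measurable_sum => w; apply: measurable_funM => //.
exact: measurable_pattern_fun.
Qed.

End cylinder_functions.

(** * The semigroup of a spin-flip process *)

Section process_semigroup.
Context {R : realType} {d : nat} (c : Zd d -> Omega d -> R)
  {dT : measure_display} {T : measurableType dT}
  (Pr : Omega d -> probability T R) (X : R -> T -> Omega d)
  (hX : is_spin_flip_process c Pr X).
Implicit Types (eta xi : Omega d) (f v : Omega d -> R) (s : seq (Zd d)) (M e t : R).
Let S := semigroup Pr X.

Lemma semigroupE t f eta : S t f eta = \int[Pr eta]_w f (X t w).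
Proof. by rewrite /S /semigroup unlock. Qed.

Lemma measurable_path t f : 0 <= t -> measurable_fun setT f ->
  measurable_fun setT (fun w => f (X t w)).
Proof. by move=> t0 mf; apply: measurableT_comp => //; exact: (sfp_measurable_state hX). Qed.

Lemma semigroup_dist t f v M e eta : 0 <= t ->
  measurable_fun setT f -> measurable_fun setT v ->
  (forall xi, `|f xi| <= M) -> (forall xi, `|v xi| <= M) ->
  (forall xi, `|f xi - v xi| <= e) -> `|S t f eta - S t v eta| <= e.
Proof.
move=> t0 mf mv fM vM fv; rewrite !semigroupE.
by apply: (@mean_dist _ _ _ _ _ _ M) => //; exact: measurable_path.
Qed.

Lemma semigroup_bound t f M eta : 0 <= t -> measurable_fun setT f ->
  (forall xi, `|f xi| <= M) -> `|S t f eta| <= M.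
Proof.
by move=> t0 mf fM; rewrite semigroupE; apply: mean_bound => //; exact: measurable_path.
Qed.

Lemma semigroup_decomposition s v t eta : 0 <= t -> depends_on s v ->
  S t v eta = \sum_(w : (size s).-tuple bool)
    v (extend_pattern s w) * S t (pattern_fun s w) eta.
Proof.
move=> t0 sv; rewrite semigroupE.
under eq_Rintegral do rewrite (pattern_decomposition _ sv).
rewrite (@mean_lin_comb _ _ _ _ _ _ (fun (w : (size s).-tuple bool) x => pattern_fun s w (X t x)) 1).
- by apply: eq_bigr => w _; rewrite semigroupE.
- by move=> w; apply: measurable_path => //; exact: measurable_pattern_fun.
- by move=> w x; exact: pattern_fun_bound.
Qed.

Lemma semigroup_indic t (B : set (Omega d)) eta : 0 <= t -> measurable B ->
  S t \1_B eta = fine (Pr eta (X t @^-1` B)).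
Proof.
move=> t0 mB; rewrite semigroupE /Rintegral; congr fine.
rewrite (eq_integral (fun w => (\1_(X t @^-1` B) w)%:E))//.
rewrite integral_indic ?setIT//.
by rewrite -[X in measurable X]setTI; exact: (sfp_measurable_state hX).
Qed.

Lemma measurable_semigroup_indic t (B : set (Omega d)) : 0 <= t -> measurable B ->
  measurable_fun setT (S t \1_B).
Proof.
move=> t0 mB.
rewrite (_ : S t \1_B = fun eta => fine (Pr eta (X t @^-1` B))); last first.
  by apply/funext => eta; exact: semigroup_indic.
apply: measurableT_comp => //; apply: (sfp_measurable_law hX).
by rewrite -[X in measurable X]setTI; exact: (sfp_measurable_state hX).
Qed.

Lemma measurable_semigroup s v t : 0 <= t -> depends_on s v ->
  measurable_fun setT (S t v).
Proof.
move=> t0 sv; rewrite (_ : S t v = fun eta => \sum_(w : (size s).-tuple bool)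
    v (extend_pattern s w) * S t (pattern_fun s w) eta); last first.
  by apply/funext => eta; exact: semigroup_decomposition.
apply: measurable_sum => w; apply: measurable_funM => //.
by rewrite pattern_fun_indic; apply: measurable_semigroup_indic => //; exact: measurable_pattern_set.
Qed.

(** The Markov property with the sure event as event of the past. *)
Lemma semigroup_comp_indic (r t : R) (B : set (Omega d)) eta : 0 <= r -> 0 <= t ->
  measurable B -> S (r + t) \1_B eta = S r (S t \1_B) eta.
Proof.
move=> r0 t0 mB; rewrite semigroup_indic ?addr_ge0// semigroupE /Rintegral; congr fine.
have pT : past X r setT by rewrite -setC0; apply: sigma_algebraC; exact: sigma_algebra0.
have := sfp_markov hX eta r0 t0 pT mB; rewrite setTI => ->.
apply: eq_integral => w _; rewrite semigroup_indic// fineK// fin_num_measure//.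
by rewrite -[X in measurable X]setTI; exact: (sfp_measurable_state hX).
Qed.

Lemma semigroup_comp s v (r t : R) eta : 0 <= r -> 0 <= t -> depends_on s v ->
  S (r + t) v eta = S r (S t v) eta.
Proof.
move=> r0 t0 sv; rewrite (semigroup_decomposition _ _ sv) ?addr_ge0//.
rewrite [RHS]semigroupE; under [RHS]eq_Rintegral do rewrite (semigroup_decomposition _ t0 sv).
rewrite (@mean_lin_comb _ _ _ _ _ _ (fun (w : (size s).-tuple bool) x => S t (pattern_fun s w) (X r x)) 1).
- apply: eq_bigr => w _; rewrite pattern_fun_indic semigroup_comp_indic ?semigroupE//.
  exact: measurable_pattern_set.
- move=> w; apply: measurable_path => //; apply: (measurable_semigroup t0).
  exact: depends_on_pattern_fun.
- move=> w x; apply: semigroup_bound => //; first exact: measurable_pattern_fun.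
  by move=> xi; exact: pattern_fun_bound.
Qed.

Lemma measurable_config eta : measurable [set xi : Omega d | xi = eta].
Proof.
rewrite (_ : [set _ | _] = ~` \bigcup_(x in [set: Zd d]) [set xi : Omega d | map xi [:: x] != map eta [:: x]]).
  apply: measurableC; apply: countable_bigcupT_measurable => [|x]; first exact: countableP.
  rewrite (_ : [set _ | _] = ~` [set xi : Omega d | map xi [:: x] == map eta [:: x]]).
    by apply: measurableC; exact: measurable_pattern_set.
  by apply/seteqP; split => xi /= /negP.
apply/seteqP; split => [xi ->|xi /= nxi]; first by move=> [x _] /=; rewrite eqxx.
apply/funext => x; apply/eqP/negP => xix; apply: nxi; exists x => //=.
by apply/eqP => -[/eqP].
Qed.

Lemma semigroup0 v eta : measurable_fun setT v -> S 0 v eta = v eta.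
Proof.
move=> mv; rewrite semigroupE -[RHS](mean_cst (Pr eta)) /Rintegral; congr fine.
apply: ae_eq_integral => //.
  by apply/measurable_EFinP; exact: measurable_path.
have mE : measurable [set w | X 0 w = eta].
  rewrite -[X in measurable X]setTI.
  exact: (sfp_measurable_state hX (lexx (0 : R)) measurableT (measurable_config eta)).
have E0 : Pr eta (~` [set w | X 0 w = eta]) = 0%E.
  by rewrite probability_setC// (sfp_start hX) subee.
exists (~` [set w | X 0 w = eta]); split => //; first exact: measurableC.
by move=> w /= nw Xw; apply: nw => _; rewrite Xw.
Qed.

(** The generator limit is assumed for one cylinder function at a time. Functions of the sites in s
    bounded by M combine finitely many patterns with coefficients at most |M|, which gives
    uniformity. The Euler iterates require it, since they vary with h. *)
Lemma near_generator s : uniq s -> forall M e, 0 < e -> \forall h \near (0:R)^'+,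
  forall v, depends_on s v -> (forall xi, `|v xi| <= M) -> forall eta,
    `|S h v eta - v eta - h * spin_flip_generator c v eta| <= h * e.
Proof.
move=> us M e e0; pose K : R := #|{: (size s).-tuple bool}|%:R * `|M| + 1.
have K0 : 0 < K by rewrite ltr_wpDl// mulr_ge0.
have : \forall h \near (0:R)^'+, forall w : (size s).-tuple bool, forall eta,
   `|(S h (pattern_fun s w) eta - pattern_fun s w eta) / h
     - spin_flip_generator c (pattern_fun s w) eta| <= e / K.
  apply: filter_forall => w; apply: (sfp_generator hX); last by rewrite divr_gt0.
  exact: depends_on_cylinder (@depends_on_pattern_fun _ _ s w).
move=> H; near=> h; have h0 : 0 < h by [].
have hw (w : (size s).-tuple bool) eta : `|S h (pattern_fun s w) eta - pattern_fun s w eta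
     - h * spin_flip_generator c (pattern_fun s w) eta| <= h * (e / K).
  have : `|(S h (pattern_fun s w) eta - pattern_fun s w eta) / h
     - spin_flip_generator c (pattern_fun s w) eta| <= e / K.
    by move: w eta; near: h.
  rewrite -(ler_pM2l h0) -{1}(gtr0_norm h0) -normrM mulrBr.
  by rewrite mulrCA mulfV ?gt_eqF// mulr1.
move=> v sv vM eta.
have -> : S h v eta - v eta - h * spin_flip_generator c v eta =
  \sum_(w : (size s).-tuple bool) v (extend_pattern s w) *
    (S h (pattern_fun s w) eta - pattern_fun s w eta
     - h * spin_flip_generator c (pattern_fun s w) eta).
  have -> : spin_flip_generator c v eta = \sum_(w : (size s).-tuple bool)
      v (extend_pattern s w) * spin_flip_generator c (pattern_fun s w) eta.
    rewrite (spin_flip_generatorE _ _ us sv).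
    under [RHS]eq_bigr do
      rewrite (spin_flip_generatorE _ _ us (@depends_on_pattern_fun _ _ s _)) mulr_sumr.
    rewrite exchange_big/=; apply: eq_bigr => x _.
    rewrite (pattern_decomposition (flip eta x) sv) (pattern_decomposition eta sv).
    rewrite -sumrB mulr_sumr; apply: eq_bigr => w _; ring.
  rewrite (semigroup_decomposition _ (ltW h0) sv) {1}(pattern_decomposition eta sv).
  rewrite mulr_sumr -!sumrB; apply: eq_bigr => w _; ring.
apply: (le_trans (ler_norm_sum _ _ _)).
apply: (@le_trans _ _ (\sum_(w : (size s).-tuple bool) `|M| * (h * (e / K)))).
  apply: ler_sum => w _; rewrite normrM; apply: ler_pM => //.
  exact: le_trans (vM _) (ler_norm _).
rewrite sumr_const -mulr_natl.
have -> : h * e = K * (h * (e / K)) by field; rewrite gt_eqF.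
rewrite mulrA ler_wpM2r ?mulr_ge0 ?(ltW h0) ?invr_ge0 ?(ltW K0) ?(ltW e0)//.
by rewrite /K lerDl ler01.
Unshelve. all: by end_near. Qed.

End process_semigroup.

Lemma near_div_nat {R : realType} (t : R) (Q : R -> Prop) : 0 < t ->
  (\forall h \near 0^'+, Q h) -> \forall N \near \oo, Q (t / N%:R).
Proof.
move=> t0 [e /= e0 He]; exists (Num.truncn (t / e)).+1 => // N /= tN.
have N0 : 0 < N%:R :> R by rewrite ltr0n; exact: leq_ltn_trans tN.
apply: He; last by rewrite divr_gt0.
rewrite /= sub0r normrN ger0_norm ?divr_ge0 ?(ltW t0) ?(ltW N0)//.
rewrite ltr_pdivrMr// mulrC -ltr_pdivrMr//.
by apply: (lt_le_trans (truncnS_gt _)); rewrite ler_nat.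
Qed.

(** * Convergence of the Euler scheme *)

Section voter_process.
Context {R : realType} {d : nat} (p : Zd d -> Zd d -> R) (hp : voter_kernel p)
  {dT : measure_display} {T : measurableType dT}
  (Pr : Omega d -> probability T R) (X : R -> T -> Omega d)
  (hX : is_voter_model p Pr X).
Implicit Types (eta xi : Omega d) (f v g : Omega d -> R) (s : seq (Zd d)) (M e t : R).
Local Notation S := (semigroup Pr X).

(** The semigroup is a contraction in sup norm, so replacing its steps of length h by Euler steps
    one after the other adds up the one-step errors. *)
Lemma euler_telescope s g M h eps N : uniq s -> depends_on s g ->
  (forall xi, `|g xi| <= M) -> 0 <= h -> h * (size s)%:R <= 1 ->
  (forall i eta, (i < N)%N ->
    `|S h (iter i (euler_step p s h) g) eta - iter i.+1 (euler_step p s h) g eta| <= eps) ->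
  forall j i, (i + j <= N)%N -> forall eta,
    `|S (j%:R * h) (iter i (euler_step p s h) g) eta - iter (i + j) (euler_step p s h) g eta|
      <= j%:R * eps.
Proof.
move=> us sg gM h0 hs step.
have sv i : depends_on s (iter i (euler_step p s h) g).
  by elim: i => // i IH; exact: depends_on_euler_step.
have vM i xi : `|iter i (euler_step p s h) g xi| <= M.
  by elim: i xi => // i IH xi; exact: euler_step_bound.
have mv i := measurable_depends_on (sv i).
elim=> [|j IH] i ijN eta.
  by rewrite !mul0r addn0 (semigroup0 hX)// subrr normr0.
have jh0 : 0 <= j%:R * h by rewrite mulr_ge0.
have -> : j.+1%:R * h = j%:R * h + h by rewrite -natr1 mulrDl mul1r.
rewrite (semigroup_comp hX eta jh0 h0 (sv i)).
rewrite -[X in `|X|](subrKA (S (j%:R * h) (iter i.+1 (euler_step p s h) g) eta)).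
apply: (le_trans (ler_normD _ _)); rewrite -natr1 mulrDl mul1r addrC.
apply: lerD.
  by rewrite addnS -addSn; apply: IH; rewrite addSn -addnS.
apply: (semigroup_dist hX (M := M)) => //.
- exact: (measurable_semigroup hX h0 (sv i)).
- by move=> xi; exact: (semigroup_bound hX).
- move=> xi; apply: step; apply: leq_trans ijN.
  by rewrite addnS ltnS leq_addr.
Qed.

Lemma euler_step_error s v D h kappa eta : uniq s -> 0 <= h -> depends_on s v ->
  gradient_bound v D ->
  `|S h v eta - v eta - h * spin_flip_generator (voter_rate p) v eta| <= h * kappa ->
  `|S h v eta - euler_step p s h v eta| <= h * (kappa + \sum_(x <- s) leak p s x * D x).
Proof.
move=> us h0 sv vD gen; rewrite /euler_step.
have -> : S h v eta - (v eta + h * finite_generator p s v eta) =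
  (S h v eta - v eta - h * spin_flip_generator (voter_rate p) v eta) +
  h * (spin_flip_generator (voter_rate p) v eta - finite_generator p s v eta) by ring.
apply: (le_trans (ler_normD _ _)); rewrite [leRHS]mulrDr; apply: lerD => //.
rewrite normrM (ger0_norm h0) ler_wpM2l//.
exact: (generator_finite_error hp).
Qed.

Lemma semigroup_gradient_pos t s0 g D M i eta e : 0 < t -> uniq s0 ->
  depends_on s0 g -> gradient_bound g D -> (forall xi, `|g xi| <= M) -> 0 < e ->
  \forall N \near \oo, `|S t g (flip eta i) - S t g eta| <=
    \sum_(z <- s0) fine (lazy_walk (p 0) (t / N%:R) N (i - z)) * D z + e.
Proof.
move=> t0 us0 s0g gD gM e0.
have D0 x : 0 <= D x by exact: gradient_bound_ge0 gD.
(* The working volume s contains s0; cutting D off outside s0 keeps every gradient sum over s0. *)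
pose D' x := if x \in s0 then D x else 0.
have gD' : gradient_bound g D'.
  move=> x xi; rewrite /D'; case: ifPn => xs; first exact: gD.
  by rewrite (depends_on_flip _ s0g)// subrr normr0.
(* Each of the N steps errs by at most 2 h [lam], in total 2 t [lam] = e / 2, at each of the two
   configurations. *)
pose lam := e / (4 * t); have lam0 : 0 < lam by rewrite divr_gt0// mulr_gt0.
have J0 := mean_jump_ge0 hp.
(* As k h <= t at every step, [C / n] bounds the leak term of each step, so n and the volume are
   chosen independently of N. *)
pose C := \sum_(z <- s0) D z * (t * mean_jump p + l1_weight z + mean_jump p).
have C0 : 0 <= C.
  apply: sumr_ge0 => z _; rewrite mulr_ge0// !addr_ge0 ?l1_weight_ge0//.
  by rewrite mulr_ge0// ltW.
pose n := (Num.truncn (C / lam)).+1.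
have n0 : 0 < n%:R :> R by rewrite ltr0n.
have nC : n%:R^-1 * C <= lam.
  rewrite ler_pdivrMl// mulrC -ler_pdivrMl// mulrC; apply: ltW; exact: truncnS_gt.
have [s1 [us1 s1n]] := @l1_ball_exhaustion R d n.
pose s := s0 ++ [seq a <- s1 | a \notin s0].
have us : uniq s.
  rewrite cat_uniq us0 filter_uniq// andbT /= -all_predC; apply/allP => a.
  by rewrite mem_filter => /andP[].
have sn a : a \notin s -> n%:R <= l1_weight a :> R.
  rewrite mem_cat negb_or mem_filter => /andP[as0]; rewrite as0 => as1; exact: s1n.
have sg : depends_on s g.
  by move=> x y xy; apply: s0g => z zs; apply: xy; rewrite mem_cat zs.
have sD' (F : Zd d -> R) : \sum_(z <- s) F z * D' z = \sum_(z <- s0) F z * D z.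
  rewrite big_cat/= [X in _ + X]big1_seq ?addr0; last first.
    by move=> z /=; rewrite mem_filter => /andP[zs _]; rewrite /D' (negbTE zs) mulr0.
  by apply: eq_big_seq => z zs; rewrite /D' zs.
have nearG := near_div_nat t0 (near_generator hX us M lam0).
have s10 : 0 < (size s)%:R + 1 :> R by rewrite ltr_wpDl.
have nearh r : 0 < r -> \forall N \near \oo, t / N%:R <= r.
  by move=> r0; apply: (near_div_nat (Q := fun h => h <= r)) => //; exact: nbhs_right_le.
have nearh1 := nearh 1 ltr01.
have nearhs : \forall N \near \oo, t / N%:R <= ((size s)%:R + 1)^-1.
  by apply: nearh; rewrite invr_gt0.
near=> N; have N0 : 0 < N%:R :> R by rewrite ltr0n; near: N; exists 1%N.
pose h := t / N%:R; have h0 : 0 < h by rewrite divr_gt0.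
have tE : t = N%:R * h by rewrite /h mulrC divfK// gt_eqF.
have h1 : t / N%:R <= 1 by near: N.
rewrite -/h in h1.
have hs : h * (size s)%:R <= 1.
  have : t / N%:R <= ((size s)%:R + 1)^-1 by near: N.
  rewrite -/h => hh; apply: (@le_trans _ _ (h * ((size s)%:R + 1))).
    by rewrite ler_wpM2l ?(ltW h0)// lerDl.
  by rewrite -ler_pdivlMr// mul1r.
have gen : forall v, depends_on s v -> (forall xi, `|v xi| <= M) -> forall xi,
    `|S (t / N%:R) v xi - v xi - t / N%:R * spin_flip_generator (voter_rate p) v xi|
      <= t / N%:R * lam.
  by near: N.
rewrite -/h in gen.
have sv k : depends_on s (iter k (euler_step p s h) g).
  by elim: k => // k IH; exact: depends_on_euler_step.
have vM k xi : `|iter k (euler_step p s h) g xi| <= M.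
  by elim: k xi => // k IH xi; exact: euler_step_bound (ltW h0) hs _ _.
have vD k := euler_iter_gradient hp (ltW h0) h1 k us hs sg gD'.
have leakD k : (k < N)%N -> \sum_(x <- s) leak p s x *
    (\sum_(z <- s) fine (lazy_walk (p 0) h k (x - z)) * D' z) <= lam.
  move=> kN; apply: le_trans nC; rewrite /C mulr_sumr.
  under eq_bigr do rewrite sD' mulr_sumr.
  rewrite exchange_big/=; apply: ler_sum => z _.
  under eq_bigr do rewrite mulrA.
  rewrite -mulr_suml mulrC mulrCA ler_wpM2l//.
  apply: (le_trans (leak_lazy_walk hp (ltW h0) h1 k z us n0 sn)).
  rewrite ler_wpM2l ?invr_ge0 ?(ltW n0)// !lerD2r mulrA ler_wpM2r// tE.
  by rewrite ler_wpM2r ?(ltW h0)// ler_nat ltnW.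
have step k xi : (k < N)%N ->
    `|S h (iter k (euler_step p s h) g) xi - iter k.+1 (euler_step p s h) g xi| <= h * (lam + lam).
  move=> kN; rewrite iterS.
  apply: (le_trans (euler_step_error us (ltW h0) (sv k) (vD k) (gen _ (sv k) (vM k) xi))).
  by rewrite ler_wpM2l ?(ltW h0)// lerD2l leakD.
have tel := euler_telescope us sg gM (ltW h0) hs step (leqnn (0 + N)).
rewrite add0n /= -tE in tel.
have errE : N%:R * (h * (lam + lam)) = e / 2.
  by rewrite mulrA -tE /lam; field; rewrite gt_eqF.
rewrite errE in tel.
have := vD N i eta; rewrite sD' => grad.
have := tel (flip eta i); have := tel eta; move: grad.
set a := S t g (flip eta i); set b := S t g eta.
set u := iter N _ g (flip eta i); set w := iter N _ g eta.
set B := \sum_(z <- s0) _ => grad eb ea.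
have -> : a - b = (a - u) + (u - w) + (w - b) by ring.
apply: (le_trans (ler_normD _ _)); rewrite (distrC w).
apply: (le_trans (lerD (ler_normD _ _) (lexx _))).
lra.
Unshelve. all: by end_near. Qed.

Lemma semigroup_gradient t s0 g D M i eta e : 0 <= t -> uniq s0 ->
  depends_on s0 g -> gradient_bound g D -> (forall xi, `|g xi| <= M) -> 0 < e ->
  \forall N \near \oo, `|S t g (flip eta i) - S t g eta| <=
    \sum_(z <- s0) fine (lazy_walk (p 0) (t / N%:R) N (i - z)) * D z + e.
Proof.
rewrite le_eqVlt => /predU1P[<-|t0]; last exact: semigroup_gradient_pos.
move=> us0 s0g gD gM e0; apply: nearW => N.
have D0 x : 0 <= D x by exact: gradient_bound_ge0 gD.
have mg := measurable_depends_on s0g.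
rewrite mul0r !(semigroup0 hX)//.
have := euler_iter_gradient hp (lexx (0 : R)) ler01 N us0 _ s0g gD i eta.
rewrite mul0r => /(_ ler01).
rewrite (_ : iter N _ g = g); last first.
  by elim: N => // N IH; rewrite iterS IH; apply/funext => xi; rewrite /euler_step mul0r addr0.
by move/le_trans; apply; rewrite lerDl ltW.
Qed.

End voter_process.

(** * The subprobability that controls the gradient *)

Section voter_kernel_bound.
Context {R : realType} {d : nat} (p : Zd d -> Zd d -> R) (hp : voter_kernel p)
  {dT : measure_display} {T : measurableType dT}
  (Pr : Omega d -> probability T R) (X : R -> T -> Omega d)
  (hX : is_voter_model p Pr X)
  {dW : measure_display} {W : measurableType dW} (P : probability W R)
  (Z : R -> W -> Zd d)
  (hZ : is_random_walk (fun a => p 0 a + p 0 (- a)) P Z).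

(** A single m serves all functions and all sites i, in convolution form; Young's inequality relies
    on this order of quantifiers. *)
Lemma voter_gradient_kernel (t : R) : 0 <= t -> exists m : Zd d -> R,
  [/\ forall a, 0 <= m a,
      (\esum_(a in [set: Zd d]) (m a)%:E <= 1)%E,
      (\esum_(a in [set: Zd d]) (m a ^+ 2)%:E <= P [set w | Z t w = 0%R])%E &
      forall (s : seq (Zd d)) g D M i eta, uniq s -> depends_on s g -> gradient_bound g D ->
        (forall xi, `|g xi| <= M) ->
        `|semigroup Pr X t g (flip eta i) - semigroup Pr X t g eta|
          <= \sum_(z <- s) m (i - z) * D z].
Proof.
move=> t0; pose h N : R := t / N%:R.
have p0 a : 0 <= p 0 a by exact: vk_ge0.
have p1 : (\esum_(a in [set: Zd d]) (p 0 a)%:E = 1)%E by exact: vk_sum1.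
have h0 N : 0 <= h N by rewrite divr_ge0.
have nearh1 : \forall N \near \oo, h N <= 1.
  move: t0; rewrite le_eqVlt => /predU1P[t0|t0].
    by apply: nearW => N; rewrite /h -t0 mul0r.
  by apply: (near_div_nat (Q := fun h => h <= 1)) => //; exact: nbhs_right_le.
(* The value 0 for the finitely many N with t / N > 1 makes every [u N] a subprobability. *)
pose u N a : R := if h N <= 1 then fine (lazy_walk (p 0) (h N) N a) else 0.
have PZ : P [set w | Z t w = 0%R] \is a fin_num.
  by apply: fin_num_measure; exact: (rw_measurable hZ).
have uE N a : h N <= 1 -> (u N a)%:E = lazy_walk (p 0) (h N) N a.
  by move=> hN; rewrite /u hN; exact: lazy_walk_EFin.
have [] := @subprobability_limit R (Zd d) u (fine (P [set w | Z t w = 0%R])).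
- move=> N a; rewrite /u; case: ifP => // hN; exact: (lazy_walk_fine_ge0 hp (h0 N) hN).
- move=> N; have [hN|hN] := boolP (h N <= 1); last first.
    by rewrite esum1 ?lee01// => a _; rewrite /u (negbTE hN).
  by under eq_esum do rewrite uE//; rewrite esum_lazy_walk.
- move=> e e0; have corrE N : h N <= 1 ->
      (\esum_(a in [set: Zd d]) (u N a ^+ 2)%:E = autocorrelation (lazy_walk (p 0) (h N) N) 0%R)%E.
    by move=> hN; apply: eq_esum => a _; rewrite expr2 EFinM !uE// addr0.
  move: (t0); rewrite le_eqVlt => /predU1P[t00|tpos].
    near=> N; have hN : h N <= 1 by near: N.
    rewrite corrE//; apply: (le_trans (autocorrelation_lazy_walk_le1 p0 p1 (h0 N) hN N 0)).
    rewrite -t00 (_ : [set _ | _] = setT) ?probability_setT//=.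
      by rewrite lee_fin lerDl ltW.
    by apply/seteqP; split => w //= _; exact: (rw_start hZ).
  have et : 0 < e / t by rewrite divr_gt0.
  have nearA := near_div_nat tpos (autocorrelation_near_walk p0 p1 hZ et).
  near=> N; have hN : h N <= 1 by near: N.
  have N0 : 0 < N%:R :> R by rewrite ltr0n; near: N; exists 1%N.
  rewrite corrE//.
  have H : forall k c, (autocorrelation (lazy_walk (p 0) (t / N%:R) k) c
      <= P [set w | Z (k%:R * (t / N%:R))%R w = c] + (k%:R * (t / N%:R * (e / t)))%:E)%E by near: N.
  have := H N 0; rewrite [X in Z X](_ : _ = t); last by field; rewrite gt_eqF.
  rewrite (_ : N%:R * (t / N%:R * (e / t)) = e); last by field; rewrite !gt_eqF.
  by rewrite -{1}(fineK PZ) -EFinD.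
- move=> m [m0 m1 m2 mlim]; exists m; split => //; first by rewrite -(fineK PZ).
  move=> s g D M i eta us sg gD gM.
  have := mlim [seq i - z | z <- s] (fun a => D (i - a)).
  rewrite big_map (eq_bigr (fun z => m (i - z) * D z)); last first.
    by move=> z _; rewrite subKr.
  apply=> e e0; have := semigroup_gradient hp hX i eta t0 us sg gD gM e0.
  move=> G; near=> N; have hN : h N <= 1 by near: N.
  rewrite big_map (eq_bigr (fun z => fine (lazy_walk (p 0) (t / N%:R) N (i - z)) * D z)); last first.
    by move=> z _; rewrite subKr /u hN.
  by near: N.
Unshelve. all: by end_near. Qed.

End voter_kernel_bound.

(** * From cylinder functions to bounded measurable functions *)

Section configuration_topology.
Context {d : nat}.
Implicit Types (eta xi : Omega d) (s : seq (Zd d)).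

Lemma open_site x (b : bool) : open [set xi : Omega d | xi x = b].
Proof.
have pc : forall A : set bool, open A -> open ((fun eta : Omega d => eta x) @^-1` A).
  apply/continuousP; exact: (@proj_continuous (Zd d) (fun=> bool) x).
by apply: (pc [set b]); exact: discrete_open.
Qed.

Lemma nbhs_pattern s eta : nbhs eta [set xi : Omega d | {in s, eta =1 xi}].
Proof.
elim: s => [|x s IH]; first by apply: filterE => xi y; rewrite in_nil.
have nx : nbhs eta [set xi : Omega d | xi x = eta x].
  by apply: open_nbhs_nbhs; split => //; exact: open_site.
apply: filterS (filterI nx IH) => xi [/= xx sx] y.
by rewrite inE => /predU1P[->//|]; exact: sx.
Qed.

(** The sets containing all configurations that agree with eta on some finite set form a filter. It
    converges to eta in every coordinate, hence in the product topology. *)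
Lemma open_pattern (O : set (Omega d)) eta : open O -> O eta ->
  exists s, forall xi, {in s, eta =1 xi} -> O xi.
Proof.
move=> oO Oeta.
pose F : set_system (Omega d) := [set A | exists s, forall xi, {in s, eta =1 xi} -> A xi].
have FF : Filter F.
  split.
  - by exists [::].
  - move=> A B [s sA] [s' sB]; exists (s ++ s') => xi e; split.
      by apply: sA => x xs; apply: e; rewrite mem_cat xs.
    by apply: sB => x xs; apply: e; rewrite mem_cat xs orbT.
  - by move=> A B AB [s sA]; exists s => xi /sA; exact: AB.
have : F --> eta.
  apply/cvg_sup => x; apply/cvg_image.
    by apply/seteqP; split => [//|b _]; exists (fun=> b).
  move=> B Bx; exists ((fun xi : Omega d => xi x) @^-1` B).
    exists [:: x] => xi e /=; rewrite -(e x) ?inE//; exact: nbhs_singleton.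
  by apply/seteqP; split => [_ [xi Bxi <-]//|b Bb]; exists (fun=> b).
apply; exact: open_nbhs_nbhs.
Qed.

(** Finite sets that increase to Z^d along a fixed enumeration. *)
Definition sites (n : nat) : seq (Zd d) := pmap pickle_inv (iota 0 n).

Lemma sites_uniq n : uniq (sites n).
Proof. by apply: (pmap_uniq pickle_invK); exact: iota_uniq. Qed.

Lemma sites_pickle n x : (choice.pickle x < n)%N -> x \in sites n.
Proof.
move=> xn; rewrite mem_pmap; apply/mapP; exists (choice.pickle x); last by rewrite pickleK_inv.
by rewrite mem_iota.
Qed.

Lemma sites_sub n m : (n <= m)%N -> {subset sites n <= sites m}.
Proof.
move=> nm x; rewrite !mem_pmap => /mapP[k]; rewrite !mem_iota => /andP[_ kn] kx.
by apply/mapP; exists k => //; rewrite mem_iota/=; exact: leq_trans nm.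
Qed.

Lemma seq_sub_sites s : exists n, {subset s <= sites n}.
Proof.
elim: s => [|x s [n sn]]; first by exists 0%N.
exists (maxn n (choice.pickle x).+1) => y; rewrite inE => /predU1P[->|ys].
  by apply: sites_pickle; rewrite leq_max leqnn orbT.
by apply: (sites_sub (leq_maxl _ _)); exact: sn.
Qed.

Lemma compact_configurations : compact [set: Omega d].
Proof.
rewrite (_ : [set: Omega d] = [set f : forall x : Zd d, bool | forall i, [set: bool] (f i)]); last first.
  by rewrite predeqE.
apply: (@tychonoff (Zd d) (fun=> bool) (fun=> setT)) => _; exact: bool_compact.
Qed.

Lemma open_config_measurable (O : set (Omega d)) : open O -> measurable O.
Proof. by move=> oO; apply: sub_sigma_algebra. Qed.

Lemma closed_config_measurable (K : set (Omega d)) : closed K -> measurable K.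
Proof.
by move=> cK; rewrite -(setCK K); apply: measurableC; apply: open_config_measurable; exact: closed_openC.
Qed.

(** The union of the cylinders over [sites n] contained in O: closed sets that exhaust an open O. *)
Definition cylinder_core (O : set (Omega d)) n : set (Omega d) :=
  [set eta : Omega d | forall xi, {in sites n, eta =1 xi} -> O xi].

Lemma closed_cylinder_core O n : closed (cylinder_core O n).
Proof.
rewrite -openC openE => eta /= neta.
have [xi [e nO]] : exists xi, {in sites n, eta =1 xi} /\ ~ O xi.
  apply/not_existsP => H; apply: neta => xi e; apply/not_notP => nO; exact: (H xi).
apply: filterS (nbhs_pattern (sites n) eta) => z /= ez core.
by apply: nO; apply: core => x xs; rewrite -ez// e.
Qed.

Lemma bigcup_cylinder_core O : open O -> \bigcup_n cylinder_core O n = O.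
Proof.
move=> oO; apply/seteqP; split => [eta [n _]|eta Oeta]; first by apply.
have [s sO] := open_pattern oO Oeta; have [n sn] := seq_sub_sites s.
by exists n => // xi e; apply: sO => x /sn; exact: e.
Qed.

End configuration_topology.

(** * Inner regularity by closed sets *)

Section inner_regularity.
Context {R : realType} {d : nat} (mu : probability (Omega d) R).
Local Open Scope ereal_scope.

Definition inner_regular (A : set (Omega d)) := forall e : R, (0 < e)%R ->
  exists K, [/\ closed K, K `<=` A & mu (A `\` K) <= e%:E].

(* Continuity from above along the increasing finite unions of the closed sets K n. *)
Lemma inner_regular_bigcup_closed (A : set (Omega d)) (K : nat -> set (Omega d)) (e : R) :
  measurable A -> (forall n, closed (K n)) -> \bigcup_n K n `<=` A -> (0 < e)%R ->
  exists N, mu (A `\` \big[setU/set0]_(i < N) K i) <= mu (A `\` \bigcup_n K n) + e%:E.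
Proof.
move=> mA cK KA e0; pose F n := A `\` \big[setU/set0]_(i < n) K i.
have mK n : measurable (K n) by exact: closed_config_measurable.
have mF n : measurable (F n).
  by apply: measurableD => //; apply: bigsetU_measurable => i _.
have FE : \bigcap_n F n = A `\` \bigcup_n K n.
  apply/seteqP; split => [eta H|eta [Ae nK] n _].
    split; first by have [] := H 0%N I.
    move=> [n _ Kn]; have [_] := H n.+1 I; apply.
    by rewrite big_ord_recr; right.
  split => //; rewrite -bigcup_mkord => -[i _ Ki]; apply: nK; by exists i.
have cvgF : mu (F n) @[n --> \oo] --> mu (\bigcap_n F n).
  apply: nonincreasing_cvg_mu => //.
  - by apply: le_lt_trans (probability_le1 mu (mF 0%N)) _; rewrite ltry.
  - by rewrite FE; apply: measurableD => //; exact: bigcupT_measurable.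
  - move=> n m nm; rewrite subsetEset => eta [Ae nK]; split => //.
    rewrite -bigcup_mkord => -[i /= im Ki]; apply: nK.
    by rewrite -bigcup_mkord; exists i => //=; exact: leq_trans nm.
rewrite FE in cvgF.
have mfin : mu (A `\` \bigcup_n K n) \is a fin_num.
  by apply: fin_num_measure; apply: measurableD => //; exact: bigcupT_measurable.
have H : \forall n \near \oo, mu (F n) < mu (A `\` \bigcup_n K n) + e%:E.
  have nb : nbhs (mu (A `\` \bigcup_n K n)) [set x | x < mu (A `\` \bigcup_n K n) + e%:E].
    apply: open_nbhs_nbhs; split; last by rewrite /= lteDl// lte_fin.
    exact: open_ereal_lt_ereal.
  exact: (cvgF _ nb).
have [N _ HN] := H; exists N; apply: ltW; exact: (HN N (leqnn N)).
Qed.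

(** The measurable sets that are inner regular together with their complements form a sigma-algebra.
    It contains the open sets, which are countable unions of closed cores and have closed
    complements. *)
Lemma inner_regular_measurable (B : set (Omega d)) : measurable B -> inner_regular B.
Proof.
pose C : set (set (Omega d)) := [set A | [/\ measurable A, inner_regular A & inner_regular (~` A)]].
suff H : <<s (@open (Omega d)) >> `<=` C by move=> /H[].
apply: smallest_sub; last first.
  move=> O oO; split; first exact: open_config_measurable.
    move=> e e0.
    have coreO : \bigcup_n cylinder_core O n `<=` O by rewrite bigcup_cylinder_core.
    have [N HN] := inner_regular_bigcup_closed (open_config_measurable oO)
      (@closed_cylinder_core _ O) coreO e0.
    exists (\big[setU/set0]_(i < N) cylinder_core O i); split.
    - by apply: closed_bigsetU => i _; exact: closed_cylinder_core.
    - by rewrite -bigcup_mkord => eta [i _ Hi]; exact: Hi.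
    - by apply: le_trans HN _; rewrite bigcup_cylinder_core// setDv measure0 add0e.
  move=> e e0; exists (~` O); split => //; first exact: open_closedC.
  by rewrite setDv measure0 lee_fin ltW.
split.
- have set0r : inner_regular set0.
    move=> e e0; exists set0; split => //; first exact: closed0.
    by rewrite setDv measure0 lee_fin ltW.
  split => // e e0; exists setT; split; [exact: closedT|by rewrite setC0|].
  by rewrite setC0 setDv measure0 lee_fin ltW.
- move=> A [mA rA rA']; rewrite setTD; split => //; first exact: measurableC.
  by rewrite setCK.
- move=> A CA; have mA n : measurable (A n) by have [] := CA n.
  have mUA : measurable (\bigcup_k A k) by exact: bigcupT_measurable.
  have p2 (e : R) n : (0 < e -> 0 < e / (2 ^ n.+1)%:R)%R.
    by move=> e0; rewrite divr_gt0// ltr0n expn_gt0.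
  split => //.
    (* A countable union of closed sets need not be closed: half of e pays for the [K n], half for
       keeping finitely many of them. *)
    move=> e e0; have e2 : (0 < e / 2)%R by rewrite divr_gt0.
    have /choice[K HK] : forall n, exists K, [/\ closed K, K `<=` A n &
        mu (A n `\` K) <= (e / 2 / (2 ^ n.+1)%:R)%:E].
      by move=> n; have [_ rA _] := CA n; exact: (rA _ (p2 _ n e2)).
    have mK n : measurable (K n) by apply: closed_config_measurable; have [] := HK n.
    have KA : \bigcup_n K n `<=` \bigcup_n A n.
      by apply: subset_bigcup => n _; have [] := HK n.
    have [N HN] := inner_regular_bigcup_closed mUA (fun n => let: And3 c _ _ := HK n in c) KA e2.
    exists (\big[setU/set0]_(i < N) K i); split.
    - by apply: closed_bigsetU => i _; have [] := HK i.
    - by rewrite -bigcup_mkord => eta [i _ Ki]; apply: KA; exists i.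
    - apply: le_trans HN _; rewrite [in leRHS](splitr e) EFinD leeD2r//.
      apply: (@le_trans _ _ (\sum_(n <oo) mu (A n `\` K n))).
        apply: measure_sigma_subadditive => //.
        + by move=> n; exact: measurableD.
        + by apply: measurableD => //; exact: bigcupT_measurable.
        + move=> eta [[n _ An] nK]; exists n => //; split => // Kn.
          by apply: nK; exists n.
      apply: le_trans (epsilon_trick0 xpredT (ltW e2)).
      by apply: lee_nneseries => [n *|n *]; [exact: measure_ge0|have [] := HK n].
  move=> e e0.
  have /choice[K HK] : forall n, exists K, [/\ closed K, K `<=` ~` A n &
      mu (~` A n `\` K) <= (e / (2 ^ n.+1)%:R)%:E].
    by move=> n; have [_ _ rA] := CA n; exact: (rA _ (p2 _ n e0)).
  have mK n : measurable (K n) by apply: closed_config_measurable; have [] := HK n.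
  exists (\bigcap_n K n); split.
  - by apply: closed_bigI => n _; have [] := HK n.
  - by move=> eta Ke [n _ An]; have [_ /(_ eta (Ke n I)) + _] := HK n; exact.
  - apply: (@le_trans _ _ (\sum_(n <oo) mu (~` A n `\` K n))).
      apply: measure_sigma_subadditive => //.
      + by move=> n; apply: measurableD => //; exact: measurableC.
      + apply: measurableD; first exact: measurableC.
        exact: bigcapT_measurable.
      + move=> eta [/= nA nK]; have [n nKn] : exists n, ~ K n eta.
          by apply/existsNP => H; apply: nK => n _; exact: H.
        by exists n => //; split => // An; apply: nA; exists n.
    apply: le_trans (epsilon_trick0 xpredT (ltW e0)).
    by apply: lee_nneseries => [n *|n *]; [exact: measure_ge0|have [] := HK n].
Qed.

End inner_regularity.

(** * Inf-convolutions of the levels of f *)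

Section inf_convolution.
Context {R : realType} {d : nat}.
Variables (f : Omega d -> R) (M : R) (b : Zd d -> R) (eps kap : R).
Hypotheses (fM : forall eta, `|f eta| <= M)
  (fb : forall x eta, f (flip eta x) - f eta <= b x) (eps0 : 0 < eps).
Implicit Types (eta xi : Omega d).

Lemma flip_bound_gradient : gradient_bound f b.
Proof.
move=> x eta; rewrite ler_norml fb andbT lerNl opprB.
by have := fb x (flip eta x); rewrite flipK.
Qed.

Let b0 x : 0 <= b x. Proof. exact: gradient_bound_ge0 flip_bound_gradient. Qed.

Lemma finite_difference_bound (l : seq (Zd d)) eta xi :
  (forall z, z \notin l -> eta z = xi z) ->
  f eta - f xi <= \sum_(z <- l) (eta z != xi z)%:R * b z.
Proof.
elim: l xi => [|x l IH] xi e.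
  by rewrite big_nil (_ : eta = xi) ?subrr//; apply/funext => z; exact: e.
pose xi' := set_site xi x (eta x).
have e' z : z \notin l -> eta z = xi' z.
  move=> zl; rewrite /xi' /set_site; case: eqP => [->//|/eqP zx].
  by apply: e; rewrite inE negb_or zx.
rewrite big_cons -(subrKA (f xi')) addrC; apply: lerD.
  have := gradient_bound_set_site xi x (eta x) (xi x) flip_bound_gradient.
  by rewrite set_site_id; apply: le_trans; exact: ler_norm.
apply: (le_trans (IH _ e')); apply: ler_sum => z _; rewrite ler_wpM2r//.
rewrite /xi' /set_site; case: (z =P x) => [->|//].
by rewrite eqxx.
Qed.

(** The truncation to [sites n] makes the inf-convolution a cylinder function; the cost increases
    with n. *)
Definition cost n eta xi : R := \sum_(z <- sites n) (eta z != xi z)%:R * (b z + eps).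

Let w0 z : 0 <= b z + eps. Proof. by rewrite addr_ge0// ltW. Qed.

Lemma cost_ge0 n eta xi : 0 <= cost n eta xi.
Proof. by apply: sumr_ge0 => z _; rewrite mulr_ge0. Qed.

Lemma cost_self n eta : cost n eta eta = 0.
Proof. by rewrite /cost big1// => z _; rewrite eqxx mul0r. Qed.

Lemma cost_le n m eta xi : (n <= m)%N -> cost n eta xi <= cost m eta xi.
Proof.
move=> nm; rewrite /cost.
have sub := @sites_sub d n m nm; have us := @sites_uniq d n; have us' := @sites_uniq d m.
move: (sites n) (sites m) us us' sub => s s' us us' sub.
rewrite [leRHS](bigID (mem s))/= -[leRHS]addrC ler_wpDl//.
  by apply: sumr_ge0 => z _; rewrite mulr_ge0.
rewrite -[leRHS]big_filter (perm_big [seq z <- s' | z \in s])//=.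
apply: uniq_perm; rewrite ?filter_uniq// => z; rewrite mem_filter.
by case: (boolP (z \in s)) => // /sub ->.
Qed.

(* Every differing site costs at least eps, so a cost bound uniform in n leaves
   only finitely many of them. *)
Lemma cost_bounded_difference (C : R) eta xi : (forall n, cost n eta xi <= C) ->
  f eta - f xi <= C.
Proof.
move=> H; pose D n := [seq z <- sites n | eta z != xi z].
have costE n : cost n eta xi = \sum_(z <- D n) (b z + eps).
  rewrite /cost /D big_filter [RHS]big_mkcond; apply: eq_bigr => z _.
  by case: ifP; rewrite ?mul1r ?mul0r.
have DC n : (size (D n) <= Num.truncn (C / eps))%N.
  rewrite -ltnS -(ltr_nat R); apply: le_lt_trans (truncnS_gt _).
  rewrite ler_pdivlMr//; apply: le_trans (H n); rewrite costE.
  rewrite mulr_natl -iter_addr_0 -[size _]count_predT -big_const_seq.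
  by apply: ler_sum => z _; rewrite lerDr.
pose Q k := `[< exists n, size (D n) = k >].
have Q0 : exists k, Q k by exists (size (D 0%N)); apply/asboolP; exists 0%N.
have QC k : Q k -> (k <= Num.truncn (C / eps))%N by move=> /asboolP[n <-].
have [k /asboolP[n nk] kmax] := ex_maxnP Q0 QC.
have agree z : z \notin sites n -> eta z = xi z.
  move=> zn; apply/eqP/negPn/negP => ez.
  pose n' := maxn n (choice.pickle z).+1.
  have := kmax _ (introT (asboolP _) (ex_intro _ n' erefl)).
  rewrite leqNgt => /negP; apply; rewrite -nk.
  have -> : (size (D n)).+1 = size (z :: D n) by [].
  apply: uniq_leq_size.
    by rewrite /= mem_filter (negbTE zn) andbF/= filter_uniq// sites_uniq.
  move=> y; rewrite inE => /predU1P[->|].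
    by rewrite mem_filter ez/=; apply: sites_pickle; rewrite leq_max leqnn orbT.
  rewrite !mem_filter => /andP[-> ys]/=.
  exact: (sites_sub (leq_maxl _ _)).
apply: le_trans (finite_difference_bound agree) _; apply: le_trans (H n).
by apply: ler_sum => z _; rewrite ler_wpM2l// lerDl ltW.
Qed.

Variables (k : nat) (v : 'I_k -> R) (K : 'I_k -> set (Omega d)).
Hypotheses (kap0 : 0 <= kap) (vM : forall j, - M <= v j) (cK : forall j, closed (K j))
  (Kv : forall j xi, K j xi -> v j <= f xi < v j + kap).

(** The value M caps the infimum and keeps the set nonempty even if all [K j] are empty. *)
Definition convolution_set n eta : set R :=
  [set r | r = M \/ exists j xi, K j xi /\ r = v j + cost n eta xi].

Definition inf_convolution n eta : R := inf (convolution_set n eta).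

Let M0 : 0 <= M. Proof. exact: le_trans (fM point). Qed.

Let lbE n eta : lbound (convolution_set n eta) (- M).
Proof.
move=> r [->|[j [xi [_ ->]]]]; first by rewrite (le_trans _ M0)// oppr_le0.
by rewrite -[leLHS]addr0 lerD// cost_ge0.
Qed.

Let nonE n eta : convolution_set n eta !=set0. Proof. by exists M; left. Qed.
Let hasE n eta : has_lbound (convolution_set n eta). Proof. by exists (- M). Qed.

Lemma inf_convolution_bound n eta : `|inf_convolution n eta| <= M.
Proof.
rewrite ler_norml; apply/andP; split; first exact: lb_le_inf (nonE n eta) (@lbE n eta).
by apply: ge_inf => //; left.
Qed.

Lemma inf_convolution_le n j xi : K j xi -> inf_convolution n xi <= f xi.
Proof.
move=> Kj; have /andP[vf _] := Kv Kj; apply: le_trans vf.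
by apply: ge_inf => //; right; exists j, xi; rewrite cost_self addr0.
Qed.

Lemma depends_on_inf_convolution n : depends_on (sites n) (inf_convolution n).
Proof.
move=> eta xi e; congr inf; have ce z : cost n eta z = cost n xi z.
  by apply: eq_big_seq => x xs; rewrite e.
by apply/seteqP; split => r [->|[j [z [Kz ->]]]]; [left|right; exists j, z; rewrite ce
  |left|right; exists j, z; rewrite ce].
Qed.

Lemma cost_flip n eta xi x : cost n (flip eta x) xi <= cost n eta xi + (b x + eps).
Proof.
rewrite /cost; have [xs|xs] := boolP (x \in sites n).
  rewrite (bigD1_seq x)//= ?sites_uniq// [X in _ <= X + _](bigD1_seq x)//= ?sites_uniq//.
  have A0 : 0 <= (eta x != xi x)%:R * (b x + eps) by rewrite mulr_ge0.
  have A1 : (flip eta x x != xi x)%:R * (b x + eps) <= b x + eps.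
    by rewrite ler_piMl// lern1 leq_b1.
  rewrite addrAC; apply: lerD; first by rewrite (le_trans A1)// lerDr.
  by apply: ler_sum => z zx; rewrite /flip (negbTE zx).
rewrite -[leLHS]addr0 lerD// big_seq [leRHS]big_seq; apply: ler_sum => z zs.
by rewrite /flip; case: (z =P x) => // zx; rewrite zx (negbTE xs) in zs.
Qed.

Lemma inf_convolution_gradient n : gradient_bound (inf_convolution n) (fun x => b x + eps).
Proof.
have le eta x : inf_convolution n (flip eta x) - (b x + eps) <= inf_convolution n eta.
  apply: lb_le_inf => // r [->|[j [xi [Kj ->]]]].
    rewrite lerBlDr; apply: (le_trans (ler_norm _)).
    by apply: (le_trans (inf_convolution_bound _ _)); rewrite lerDl.
  rewrite lerBlDr -addrA; apply: le_trans (lerD (lexx _) (cost_flip _ _ _ _)).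
  by apply: ge_inf => //; right; exists j, xi.
move=> x eta; rewrite ler_norml; apply/andP; split; last by have := le eta x; lra.
by have := le (flip eta x) x; rewrite flipK; lra.
Qed.

(** Otherwise, for some j, every n has a point of [K j] reached from eta at too low a cost. These
    points cluster at some xi, still in the closed set [K j]. Each truncated cost depends on
    finitely many sites and increases with n, so all costs from eta to xi are as low; this bounds f
    eta - f xi and contradicts f xi < v j + kap. Continuity of f is replaced by its small
    oscillation on [K j]. *)
Lemma inf_convolution_limit eta : \forall n \near \oo, f eta - kap <= inf_convolution n eta.
Proof.
have near_j (j : 'I_k) : \forall n \near \oo, forall xi, K j xi ->
    f eta - kap <= v j + cost n eta xi.
  have [N HN] : exists n, forall xi, K j xi -> f eta - kap <= v j + cost n eta xi.
    apply: contrapT => /forallNP H.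
    have /choice[u Hu] : forall n, exists xi, K j xi /\ v j + cost n eta xi < f eta - kap.
      move=> n; have /existsNP[xi /not_implyP[Kj /negP]] := H n.
      by rewrite -ltNge; exists xi.
    have compK : compact (K j).
      exact: (@subclosed_compact _ _ _ (@cK j) (@compact_configurations d) (@subsetT _ _)).
    have Fu : (u n @[n --> \oo]) (K j) by apply: (@filterE _ \oo) => n; have [] := Hu n.
    have [xi [Kxi clxi]] := compK (u n @[n --> \oo]) _ Fu.
    have costxi m : cost m eta xi <= f eta - kap - v j.
      have tailm : (u n @[n --> \oo]) [set u n | n in [set n | (m <= n)%N]].
        by exists m => // n /= mn; exists n.
      have [z [[n /= mn <-] e]] := clxi _ _ tailm (nbhs_pattern (sites m) xi).
      have <- : cost m eta (u n) = cost m eta xi.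
        by apply: eq_big_seq => x xs; rewrite e.
      have [_ un] := Hu n.
      have := cost_le eta (u n) mn; lra.
    have := cost_bounded_difference costxi; have /andP[_] := Kv Kxi; lra.
  exists N => // n /= Nn xi Kxi; apply: le_trans (HN xi Kxi) _.
  by rewrite lerD2l; exact: cost_le.
have near_all : \forall n \near \oo, forall j xi, K j xi ->
    f eta - kap <= v j + cost n eta xi by apply: filter_forall.
have [N _ HN] := near_all; exists N => // n Nn.
apply: lb_le_inf => // r [->|[j [xi [Kj ->]]]]; last exact: (HN n Nn).
by rewrite lerBlDr ler_wpDr//; apply: le_trans (ler_norm _) (fM eta).
Qed.

End inf_convolution.

(** * Extension of a comparison of two laws to bounded measurable functions *)

Section gradient_extension.
Context {R : realType} {d : nat} (mu nu : probability (Omega d) R) (a : Zd d -> R).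
Hypotheses (a_sum : (\esum_(z in [set: Zd d]) (a z)%:E <= 1)%E)
  (cylinder_bound : forall (s : seq (Zd d)) g D M, uniq s -> depends_on s g ->
    gradient_bound g D -> (forall xi, `|g xi| <= M) ->
    \int[mu]_xi g xi - \int[nu]_xi g xi <= \sum_(z <- s) a z * D z).

Lemma gradient_extension (f : Omega d -> R) (M : R) (b : Zd d -> R) (B : R) :
  measurable_fun setT f -> (forall xi, `|f xi| <= M) ->
  (forall x eta, f (flip eta x) - f eta <= b x) ->
  (\esum_(z in [set: Zd d]) (a z * b z)%:E <= B%:E)%E ->
  \int[mu]_xi f xi - \int[nu]_xi f xi <= B.
Proof.
move=> mf fM fb aB; apply/ler_addgt0Pr => e e0.
have M0 : 0 <= M by exact: le_trans (fM point).
(* Used both as the extra cost per site and as the spacing of the levels. These two losses and the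
   mass [tau] cost at most e / 4 each. *)
pose eps := e / 4; have eps0 : 0 < eps by rewrite divr_gt0.
(* Off the closed sets the approximation exceeds f by at most 2 M; the summand 1 covers M = 0. *)
pose tau := e / (4 * (2 * M + 1)).
have M21 : 0 < 2 * M + 1 by rewrite ltr_wpDl// mulr_ge0.
have tau0 : 0 < tau by rewrite divr_gt0// mulr_gt0.
have tauM : 2 * M * tau <= e / 4.
  rewrite /tau (_ : 2 * M * _ = e / 4 * (2 * M / (2 * M + 1))); last first.
    by field; rewrite gt_eqF.
  by rewrite ler_piMr ?divr_ge0 ?(ltW e0)// ler_pdivrMr// mul1r lerDl.
(* Enough half-open levels to cover [- M, M], including the value M. *)
pose k := (Num.truncn (2 * M / eps)).+1.
have k0 : 0 < k%:R :> R by rewrite ltr0n.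
pose v (j : 'I_k) : R := - M + j%:R * eps.
have vM j : - M <= v j by rewrite lerDl mulr_ge0// ltW.
pose A (j : 'I_k) := [set xi | v j <= f xi < v j + eps].
have mA j : measurable (A j).
  rewrite -[A j]setTI.
  have : measurable_fun setT (fun xi => v j <= f xi < v j + eps).
    apply: measurable_and; first exact: measurable_fun_ler.
    exact: measurable_fun_ltr.
  by move=> /(_ measurableT [set true]); apply.
have coverA xi : exists j, A j xi.
  pose r := (f xi + M) / eps.
  have r0 : 0 <= r.
    by rewrite divr_ge0 ?(ltW eps0)// -lerBlDr sub0r; have := fM xi; rewrite ler_norml => /andP[].
  have rk : (Num.truncn r < k)%N.
    rewrite ltnS; apply: le_truncn; rewrite ler_pM2r ?invr_gt0//.
    have : f xi <= M by exact: le_trans (ler_norm _) (fM xi).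
    lra.
  exists (Ordinal rk); rewrite /A /v /=.
  have /andP[r1 r2] := truncn_itv r0.
  have rE : f xi = - M + r * eps by rewrite /r divfK ?gt_eqF// addrC addrK.
  rewrite rE lerD2l ler_pM2r// r1/= -addrA ltrD2l.
  by rewrite -[X in _ + X](mul1r eps) -mulrDl natr1 ltr_pM2r.
have tk : 0 < tau / k%:R by rewrite divr_gt0.
have /choice[K HK] : forall j : 'I_k, exists K : set (Omega d), [/\ closed K, K `<=` A j & (nu (A j `\` K) <= (tau / k%:R)%:E)%E].
  by move=> j; exact: (inner_regular_measurable nu (mA j) tk).
have cK j : closed (K j) by have [] := HK j.
have Kv j xi : K j xi -> v j <= f xi < v j + eps.
  by have [_ + _] := HK j => /(_ xi) KA /KA.
pose g := inf_convolution M b eps v K.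
have gM n xi : `|g n xi| <= M by exact: inf_convolution_bound.
have gs n : depends_on (sites n) (g n) by exact: depends_on_inf_convolution.
have mg n : measurable_fun setT (g n) by exact: measurable_depends_on (gs n).
have gg n : gradient_bound (g n) (fun x => b x + eps) by exact: (inf_convolution_gradient fM fb eps0 K vM).
have b0 z : 0 <= b z by exact: gradient_bound_ge0 (flip_bound_gradient fb).
have step1 n : \int[mu]_xi g n xi - \int[nu]_xi g n xi <= B + eps.
  apply: (le_trans (cylinder_bound (sites_uniq n) (gs n) (gg n) (gM n))).
  under eq_bigr do rewrite mulrDr.
  rewrite big_split/= lerD//.
    rewrite -lee_fin -sumEFin; apply: le_trans aB.
    exact: (sum_le_esumT (fun z => (a z * b z)%:E) (sites_uniq n)).
  rewrite -mulr_suml -[leRHS]mul1r ler_wpM2r ?(ltW eps0)//.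
  rewrite -lee_fin -sumEFin; apply: le_trans a_sum.
  exact: (sum_le_esumT (fun z => (a z)%:E) (sites_uniq n)).
pose C := ~` \bigcup_j K j.
have mK j : measurable (K j) by apply: closed_config_measurable; exact: cK.
have mC : measurable C.
  by apply: measurableC; apply: fin_bigcup_measurable => [|j _]; [exact: finite_finset|exact: mK].
have nuC : (nu C <= tau%:E)%E.
  apply: (@le_trans _ _ (\sum_(j < k) nu (A j `\` K j))%E).
    rewrite fsbig_seq ?index_enum_uniq//; apply: content_sub_fsum => //.
      by move=> j _; exact: measurableD.
    move=> xi nK; have [j Aj] := coverA xi; exists j.
      by rewrite /= mem_index_enum.
    by split => // Kj; apply: nK; exists j.
  apply: (@le_trans _ _ (\sum_(j < k) (tau / k%:R)%:E)%E).
    by apply: lee_sum => j _; have [] := HK j.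
  rewrite sumEFin lee_fin sumr_const card_ord -[leLHS]mulr_natr divfK// gt_eqF//.
have step2 n : \int[nu]_xi g n xi <= \int[nu]_xi f xi + e / 4.
  have IC : \int[nu]_xi \1_C xi <= tau.
    rewrite /Rintegral integral_indic// setIT -lee_fin fineK//; exact: fin_num_measure.
  have mI : measurable_fun setT (\1_C : Omega d -> R) by exact: measurable_indic.
  have I1 xi : `|\1_C xi : R| <= 1 by rewrite indicE ger0_norm// lern1 leq_b1.
  have If := bounded_integrable nu mf fM.
  have II := bounded_integrable nu mI I1.
  have I2 : nu.-integrable setT (EFin \o (fun xi => 2 * M * \1_C xi)).
    apply: (@bounded_integrable _ _ _ nu _ (2 * M)); first exact: measurable_funM.
    by move=> xi; rewrite normrM ger0_norm ?mulr_ge0// ler_piMr ?mulr_ge0.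
  apply: (@le_trans _ _ (\int[nu]_xi (f xi + 2 * M * \1_C xi))).
    apply: le_Rintegral => //.
    - exact: bounded_integrable (gM n).
    - apply: (@bounded_integrable _ _ _ nu _ (M + 2 * M)).
        by apply: measurable_funD => //; exact: measurable_funM.
      move=> xi; apply: (le_trans (ler_normD _ _)); apply: lerD => //.
      by rewrite normrM ger0_norm ?mulr_ge0// ler_piMr ?mulr_ge0.
    - move=> xi _; rewrite indicE; case: (boolP (xi \in C)) => [_|/negP nC].
        have := gM n xi; have := fM xi; rewrite !ler_norml => /andP[? ?] /andP[? ?].
        by rewrite mulr1; lra.
      rewrite mulr0 addr0; have [j _ Kj] : (\bigcup_j K j) xi.
        by apply: contrapT => nK; apply: nC; apply/mem_set.
      exact: (inf_convolution_le fM fb eps0 vM Kv n Kj).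
  rewrite RintegralD// RintegralZl// lerD2l; apply: le_trans tauM.
  by rewrite ler_wpM2l// mulr_ge0.
have lim : \int[mu]_xi (f xi - eps) <= B + eps + (\int[nu]_xi f xi + e / 4).
  apply: (@mean_eventually_le _ _ _ mu g _ (M + eps)) => //.
  - exact: measurable_funB.
  - by move=> n xi; apply: le_trans (gM n xi) _; rewrite lerDl ltW.
  - move=> xi; apply: (le_trans (ler_normB _ _)); rewrite (gtr0_norm eps0).
    by rewrite lerD2r.
  - by move=> xi; exact: (inf_convolution_limit fM fb eps0 (ltW eps0) cK Kv).
  - by move=> n; have := step1 n; have := step2 n; lra.
have If := bounded_integrable mu mf fM.
have Ie : mu.-integrable setT (EFin \o (fun=> eps)).
  by apply: (@bounded_integrable _ _ _ mu (cst eps) eps) => // xi; rewrite /= gtr0_norm.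
move: lim; rewrite RintegralB// mean_cst /eps; lra.
Qed.

End gradient_extension.

(** * The semigroup on bounded measurable functions *)

Section bounded_semigroup.
Context {R : realType} {d : nat} (c : Zd d -> Omega d -> R)
  {dT : measure_display} {T : measurableType dT}
  (Pr : Omega d -> probability T R) (X : R -> T -> Omega d)
  (hX : is_spin_flip_process c Pr X).
Implicit Types (eta xi : Omega d) (f : Omega d -> R) (M t : R).

(** Adding M makes the integrand nonnegative, as required for the measurability of integrals against
    a kernel. *)
Lemma measurable_semigroup_bounded t f M : 0 <= t -> measurable_fun setT f ->
  (forall xi, `|f xi| <= M) -> measurable_fun setT (semigroup Pr X t f).
Proof.
move=> t0 mf fM; have mfX := measurable_path hX t0 mf.
have mk : measurable_fun setT (fun w => (f (X t w) + M)%:E).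
  by apply/measurable_EFinP; apply: measurable_funD.
have -> : semigroup Pr X t f =
    fun eta => fine (\int[Pr eta]_w (f (X t w) + M)%:E) - M.
  apply/funext => eta; rewrite semigroupE.
  rewrite -[fine _]/(\int[Pr eta]_w (f (X t w) + M)) RintegralD//.
  - by rewrite (mean_cst (Pr eta)) addrK.
  - by apply: (@bounded_integrable _ _ _ _ _ M).
  - exact: (@bounded_integrable _ _ _ _ (cst M) `|M|).
apply: measurable_funB => //; apply: measurableT_comp => //.
apply: (@measurable_fun_integral_kernel _ _ _ _ _ (fun eta => Pr eta)) => //.
- exact: (sfp_measurable_law hX).
- by move=> w; rewrite lee_fin -lerBlDr sub0r; have := fM (X t w); rewrite ler_norml => /andP[].
Qed.

Lemma semigroup_law t eta : 0 <= t -> exists nu : probability (Omega d) R,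
  forall f M, measurable_fun setT f -> (forall xi, `|f xi| <= M) ->
    semigroup Pr X t f eta = \int[nu]_xi f xi.
Proof.
move=> t0; have mX := sfp_measurable_state hX t0.
have Xmfun : X t \in mfun by apply/mem_set.
exists (distribution (Pr eta) (mfun_Sub Xmfun)) => f M mf fM.
rewrite semigroupE /Rintegral integral_distribution//; first exact/measurable_EFinP.
exact: (bounded_integrable (Pr eta) (measurable_path hX t0 mf) (fun w => fM (X t w))).
Qed.

End bounded_semigroup.

(** * Concentration *)

Section convolution_norm.
Context {R : realType} (G : zmodType) (m b : G -> R).
Hypotheses (m0 : forall a, 0 <= m a) (b0 : forall z, 0 <= b z).
Local Open Scope ereal_scope.

Let conv i := \esum_(z in [set: G]) (m (i - z) * b z)%:E.

Let term_ge0 i z : 0 <= (m (i - z) * b z)%:E.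
Proof. by rewrite lee_fin mulr_ge0. Qed.

Let conv_sqr i : conv i ^+ 2 = \esum_(z in [set: G]) \esum_(y in [set: G])
  ((m (i - z) * b z) * (m (i - y) * b y))%:E.
Proof.
rewrite expe2 -esumTZr//; last exact: esum_ge0.
apply: eq_esum => z _; rewrite -esumTZl//.
Qed.

(** Expand the square and use m(i - z) m(i - y) <= (m(i - z)^2 + m(i - y)^2) / 2. Summed over i, the
    right side is the squared l^2 norm of m for every pair z, y. *)
Lemma convolution_l2_le : \esum_(i in [set: G]) conv i ^+ 2 <=
  (\esum_(z in [set: G]) (b z)%:E) ^+ 2 * \esum_(a in [set: G]) (m a ^+ 2)%:E.
Proof.
set M := (X in _ <= _ * X).
have M0 : 0 <= M by apply: esum_ge0 => a _; rewrite lee_fin sqr_ge0.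
have shift z : \esum_(i in [set: G]) (m (i - z) ^+ 2)%:E = M.
  exact: (esumT_addr (fun a => (m a ^+ 2)%:E)).
have t0 i z y : 0 <= ((m (i - z) * b z) * (m (i - y) * b y))%:E.
  by rewrite lee_fin !mulr_ge0.
under eq_esum do rewrite conv_sqr.
rewrite esumT_swap; last by move=> i z; exact: esum_ge0.
under eq_esum do rewrite esumT_swap//.
have bb0 z y : (0 <= b z * b y / 2)%R by rewrite !mulr_ge0// invr_ge0.
have main z y : \esum_(i in [set: G]) ((m (i - z) * b z) * (m (i - y) * b y))%:E <=
    (b z)%:E * ((b y)%:E * M).
  apply: (@le_trans _ _ (\esum_(i in [set: G]) ((b z * b y / 2)%:E *
      ((m (i - z) ^+ 2)%:E + (m (i - y) ^+ 2)%:E)))).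
    apply: le_esum => i _; rewrite -EFinD -EFinM lee_fin -subr_ge0.
    rewrite (_ : (_ - _)%R = (b z * b y / 2 * (m (i - z) - m (i - y)) ^+ 2)%R); last by field.
    by rewrite mulr_ge0// sqr_ge0.
  rewrite (esumTZl_EFin (bb0 z y)); last by move=> i; rewrite -EFinD lee_fin addr_ge0// sqr_ge0.
  rewrite esumD ?shift; try by move=> i _; rewrite lee_fin sqr_ge0.
  rewrite (_ : M + M = 2%:E * M); last by rewrite mule_natl.
  by rewrite !muleA -!EFinM divfK.
apply: (@le_trans _ _ (\esum_(z in [set: G]) \esum_(y in [set: G]) ((b z)%:E * ((b y)%:E * M)))).
  by apply: le_esum => z _; apply: le_esum => y _; exact: main.
have B0 z : 0 <= (b z)%:E by rewrite lee_fin.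
have inner z : \esum_(y in [set: G]) ((b z)%:E * ((b y)%:E * M)) =
    (b z)%:E * ((\esum_(y in [set: G]) (b y)%:E) * M).
  by rewrite esumTZl// => [|y]; [rewrite esumTZr|exact: mule_ge0].
under eq_esum do rewrite inner.
rewrite esumTZr//; last by rewrite mule_ge0//; exact: esum_ge0.
by rewrite muleA expe2.
Qed.
End convolution_norm.

(** * From GEMB to the L^q bound *)

Section concentration.
Context {R : realType} {d : nat}.
Implicit Types (f g : Omega d -> R) (D : Zd d -> R) (M s : R).

Lemma delta_ge f i eta : ((f (flip eta i) - f eta)%:E <= delta f i)%E.
Proof. by apply: ereal_sup_ubound; exists eta. Qed.

Lemma delta_ge0 f i : (0 <= delta f i)%E.
Proof.
have eta : Omega d := point; have := delta_ge f i eta; have := delta_ge f i (flip eta i).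
rewrite flipK; case: (leP (f eta) (f (flip eta i))) => h h1 h2.
- by apply: le_trans h2; rewrite lee_fin subr_ge0.
- by apply: le_trans h1; rewrite lee_fin subr_ge0 ltW.
Qed.

Lemma delta_le f i e : (forall eta, f (flip eta i) - f eta <= e) -> (delta f i <= e%:E)%E.
Proof. by move=> fe; apply: ge_ereal_sup => _ [eta _ <-]; rewrite lee_fin. Qed.

Lemma delta_norm1 f : delta_norm 1 f = (\esum_(i in [set: Zd d]) delta f i)%E.
Proof.
rewrite /delta_norm invr1.
under eq_esum => i _ do rewrite poweRe1 ?delta_ge0//.
by rewrite poweRe1//; apply: esum_ge0 => i _; exact: delta_ge0.
Qed.

Lemma delta_norm2_sqr_le f D s : (forall i eta, f (flip eta i) - f eta <= D i) ->
  (\esum_(i in [set: Zd d]) (D i ^+ 2)%:E <= s%:E)%E ->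
  (delta_norm 2 f ^+ 2 <= s%:E)%E.
Proof.
move=> fD Ds; rewrite /delta_norm.
have : (\esum_(i in [set: Zd d]) delta f i `^ 2 <= s%:E)%E.
  apply: le_trans Ds; apply: le_esum => i _.
  have := delta_ge0 f i; have := delta_le (fD i).
  case: (delta f i) => [x| |]//; rewrite !lee_fin => xD x0.
  rewrite powR_mulrn// ler_sqr ?nnegrE//.
  exact: le_trans xD.
have : (0 <= \esum_(i in [set: Zd d]) delta f i `^ 2)%E.
  by apply: esum_ge0 => i _; exact: poweR_ge0.
move: (esum _ _) => [x| |]//; rewrite lee_fin => x0 xs; apply: le_trans xs.
by rewrite poweR_EFin -EFin_expe -powR_mulrn ?powR_ge0// -powRrM mulVf// powRr1.
Qed.

Lemma GEMB_Lnorm (c : R) (mu : probability (Omega d) R) g M D s (q : R) :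
  GEMB c mu -> measurable_fun setT g -> (forall eta, `|g eta| <= M) -> 0 <= s ->
  (forall i eta, g (flip eta i) - g eta <= D i) ->
  (\esum_(i in [set: Zd d]) (D i ^+ 2)%:E <= (s ^+ 2)%:E)%E -> 1 <= q ->
  ('N[mu]_(q%:E)[(fun eta => (g eta - fine 'E_mu[g])%:E)]
    <= (2 * Num.sqrt c * (q * Gamma (q / 2)) `^ q^-1 * s)%:E)%E.
Proof.
move=> [c0 gemb] mg gM s0 gD Ds q1.
set m := fine _; set A := 2 * Num.sqrt c * _.
have A0 : 0 <= A by rewrite /A !mulr_ge0 ?sqrtr_ge0 ?powR_ge0.
(* The constant [c * (s + e) ^+ 2] stays positive even when [s = 0]. *)
suff bnd e : 0 < e ->
    ('N[mu]_(q%:E)[(fun eta => (g eta - m)%:E)] <= (A * (s + e))%:E)%E.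
  apply/lee_addgt0Pr => e e0; rewrite -EFinD.
  have e1 : 0 < e / (A + 1) by rewrite divr_gt0// ltr_wpDl.
  apply: (le_trans (bnd _ e1)); rewrite lee_fin mulrDr lerD2l mulrA ler_pdivrMr ?ltr_wpDl//.
  by rewrite mulrC ler_pM2l// lerDl.
move=> e0; have se0 : 0 < s + e by rewrite ltr_wpDl.
pose K := c * (s + e) ^+ 2.
have K0 : 0 < K by rewrite mulr_gt0// exprn_gt0.
have mgm : measurable_fun setT (fun eta => g eta - m) by exact: measurable_funB.
rewrite (_ : A * (s + e) = 2 * Num.sqrt K * (q * Gamma (q / 2)) `^ q^-1); last first.
  by rewrite /K sqrtrM ?(ltW c0)// sqrtr_sqr ger0_norm ?(ltW se0)// /A; ring.
apply: (exp_moment_Lnorm mgm K0 q1) => l.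
have mlg : measurable_fun setT (fun eta => l * g eta) by exact: measurable_funM.
have blg : bounded_fun (fun eta => l * g eta).
  exists (`|l| * M); split; first exact: num_real.
  move=> N MN eta _; apply: le_trans (ltW MN).
  by rewrite /= normrM ler_wpM2l.
have Elg : fine 'E_mu[(fun eta => l * g eta)] = l * m.
  rewrite /m unlock -!/(\int[mu]_eta _ eta) /=.
  by rewrite -[LHS]/(\int[mu]_eta (l * g eta)) RintegralZl//; exact: bounded_integrable gM.
have := gemb _ mlg blg; rewrite Elg unlock /=.
under eq_integral do rewrite -mulrBr.
move=> h; apply: (le_trans h); rewrite -[leRHS]/(expeR (K * l ^+ 2)%:E) lee_expeR.
rewrite /K -mulrA EFinM lee_pmul2l//.
apply: (@delta_norm2_sqr_le _ (fun i => `|l| * D i)).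
  move=> i eta /=; rewrite -mulrBr; case: (leP 0 l) => l0.
    by rewrite ger0_norm// ler_wpM2l.
  (* For l < 0 an increment of l g is |l| times the increment of g along the reverse flip. *)
  rewrite ltr0_norm// -mulrNN opprB ler_wpM2l ?oppr_ge0 ?(ltW l0)//.
  by have := gD i (flip eta i); rewrite flipK.
under eq_esum do rewrite exprMn EFinM.
rewrite esumTZl_EFin ?sqr_ge0//; last by move=> i; rewrite lee_fin sqr_ge0.
rewrite real_normK ?num_real// [(s + e) ^+ 2 * _]mulrC [leRHS]EFinM.
apply: lee_wpmul2l; first by rewrite lee_fin sqr_ge0.
by apply: (le_trans Ds); rewrite lee_fin ler_sqr ?nnegrE ?(ltW se0)// lerDl ltW.
Qed.

End concentration.

Lemma semigroup_gradient_bounded (R : realType) (d : nat) (c : Zd d -> Omega d -> R)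
    (dT : measure_display) (T : measurableType dT)
    (Pr : Omega d -> probability T R) (X : R -> T -> Omega d)
    (hX : is_spin_flip_process c Pr X) (t : R) (i : Zd d) (a : Zd d -> R) :
  0 <= t -> (\esum_(z in [set: Zd d]) (a z)%:E <= 1)%E ->
  (forall (s : seq (Zd d)) (g : Omega d -> R) D (M : R) eta, uniq s -> depends_on s g ->
    gradient_bound g D -> (forall xi, `|g xi| <= M) ->
    `|semigroup Pr X t g (flip eta i) - semigroup Pr X t g eta|
      <= \sum_(z <- s) a z * D z) ->
  forall (f : Omega d -> R) (M : R) (b : Zd d -> R) (B : R) eta, measurable_fun setT f ->
  (forall xi, `|f xi| <= M) -> (forall z xi, f (flip xi z) - f xi <= b z) ->
  (\esum_(z in [set: Zd d]) (a z * b z)%:E <= B%:E)%E ->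
  semigroup Pr X t f (flip eta i) - semigroup Pr X t f eta <= B.
Proof.
move=> t0 a1 grad f M b B eta mf fM fb aB.
have [nu1 h1] := semigroup_law hX (flip eta i) t0.
have [nu2 h2] := semigroup_law hX eta t0.
rewrite (h1 _ _ mf fM) (h2 _ _ mf fM).
apply: (gradient_extension a1 _ mf fM fb aB) => s g D N us sg gD gN.
have mg := measurable_depends_on sg.
rewrite -(h1 _ _ mg gN) -(h2 _ _ mg gN).
exact: le_trans (ler_norm _) (grad _ _ _ _ _ us sg gD gN).
Qed.

Theorem mainTheorem3 (R : realType) (d : nat)
    (p : Zd d -> Zd d -> R) (hp : voter_kernel p)
    (dT : measure_display) (T : measurableType dT)
    (Pr : Omega d -> probability T R) (X : R -> T -> Omega d)
    (hX : is_voter_model p Pr X)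
    (dW : measure_display) (W : measurableType dW) (P : probability W R)
    (Z : R -> W -> Zd d)
    (hZ : is_random_walk (fun a => p 0 a + p 0 (- a)) P Z)
    (c : R) (mu : probability (Omega d) R) (hmu : GEMB c mu)
    (t : R) (ht : 0 <= t) (q : R) (hq : 1 <= q)
    (f : Omega d -> R) (mf : measurable_fun [set: Omega d] f)
    (bf : bounded_fun f) :
  ('N[mu]_(q%:E)[(fun eta => (semigroup Pr X t f eta
                       - fine 'E_mu[semigroup Pr X t f])%:E)]
   <= (2 * Num.sqrt c * (q * Gamma (q / 2)) `^ q^-1
         * Num.sqrt (fine (P [set w | Z t w = 0%R])))%:E
      * delta_norm 1 f)%E.
Proof.
have [M fM] : exists M, forall xi, `|f xi| <= M.
  have [M [_ fM]] := bf; exists (M + 1) => xi; apply: fM => //.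
  by rewrite ltrDl.
have return_gt0 := walk_return_gt0 hZ ht.
have q0 : 0 < q by exact: lt_le_trans hq.
set A := 2 * Num.sqrt c * _; set r := fine _ in return_gt0 *.
have A0 : 0 < A.
  rewrite /A !mulr_gt0 ?sqrtr_gt0 ?hmu.1// powR_gt0// mulr_gt0//.
  by rewrite Gamma_gt0// divr_gt0.
rewrite delta_norm1.
have : (0 <= \esum_(i in [set: Zd d]) delta f i)%E.
  by apply: esum_ge0 => i _; exact: delta_ge0.
(* If the sum is infinite, so is the right side, because its constant is strictly positive; with
   constant 0 the product would be 0. *)
case EB : (\esum_(i in [set: Zd d]) delta f i)%E => [B| |]// B0; last first.
  by rewrite gt0_muley ?leey// lte_fin mulr_gt0// sqrtr_gt0.
rewrite lee_fin in B0.
pose b z := fine (delta f z).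
have bE z : (b z)%:E = delta f z.
  rewrite /b fineK// ge0_fin_numE ?delta_ge0//.
  by apply: le_lt_trans (term_le_esumT (delta f) z) _; rewrite EB ltry.
have b0 z : 0 <= b z by rewrite -lee_fin bE delta_ge0.
have sumb : (\esum_(z in [set: Zd d]) (b z)%:E = B%:E)%E.
  by rewrite -EB; apply: eq_esum => z _; exact: bE.
have fb z xi : f (flip xi z) - f xi <= b z by rewrite -lee_fin bE delta_ge.
have [m [m0 m1 m2 grad]] := voter_gradient_kernel hp hX hZ ht.
have mle1 a : m a <= 1.
  by rewrite -lee_fin; exact: le_trans (term_le_esumT (fun a => (m a)%:E) a) m1.
(* Finite, since m is at most 1 and the sum of b is B. *)
pose D i := fine (\esum_(z in [set: Zd d]) (m (i - z) * b z)%:E)%E.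
have DE i : (D i)%:E = (\esum_(z in [set: Zd d]) (m (i - z) * b z)%:E)%E.
  rewrite /D fineK// ge0_fin_numE; last first.
    by apply: esum_ge0 => z _; rewrite lee_fin mulr_ge0.
  apply: (@le_lt_trans _ _ B%:E); last exact: ltry.
  by rewrite -sumb; apply: le_esum => z _; rewrite lee_fin ler_piMl.
have rE : P [set w | Z t w = 0] = r%:E.
  by rewrite /r fineK// fin_num_measure//; exact: (rw_measurable hZ).
(* The bound is read with s = B sqrt r, which dominates the l^2 norm of D by Young's inequality. *)
rewrite -EFinM -mulrA [_ * B]mulrC.
apply: (GEMB_Lnorm (M := M) (D := D) hmu) => //.
- exact: (measurable_semigroup_bounded hX ht mf fM).
- by move=> eta; exact: (semigroup_bound hX eta ht mf fM).
- by rewrite mulr_ge0 ?sqrtr_ge0.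
- move=> i eta.
  apply: (semigroup_gradient_bounded hX (a := fun z => m (i - z)) ht _ _ eta mf fM fb).
  + apply: le_trans m1; rewrite (esumT_bij (fun a => (m a)%:E) (g := fun z => i - z))//.
    by exists (fun z => i - z) => z; rewrite opprB addrC subrK.
  + by move=> s g E N xi us sg gE gN; exact: grad.
  + by rewrite DE.
- under eq_esum => i _ do rewrite EFin_expe DE.
  apply: (le_trans (convolution_l2_le m0 b0)).
  rewrite sumb exprMn sqr_sqrtr ?(ltW return_gt0)// EFinM -rE EFin_expe.
  by apply: lee_wpmul2l => //; rewrite -EFin_expe lee_fin sqr_ge0.
Qed.
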